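(* Let $\mathbf e=(e_1,e_2)$ be a principal nilpotent pair in $\mathfrak g$. Then there exists a pair $\mathbf h=(h_1,h_2)$ of semisimple elements of $\mathfrak g$ such that: (i) $[h_i,e_j]=\delta_{i,j}\,e_i$ for $i,j\in\{1,2\}$, and $[h_1,h_2]=0$; (ii) $\mathbf h$ is a regular pair, i.e. $\mathfrak z(h_1,h_2)$ is a Cartan subalgebra of $\mathfrak g$; (iii) all eigenvalues of $\operatorname{ad}h_1$ and of $\operatorname{ad}h_2$ on $\mathfrak g$ are integers. Moreover, for any two pairs $\mathbf h=(h_1,h_2)$ and $\mathbf h'=(h_1',h_2')$ of semisimple elements each satisfying the relations in (i), there exists $u\in Z_G^{\mathrm{unip}}(\mathbf e)$ with $\operatorname{Ad}u(h_i)=h_i'$ for $i=1,2$.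
   Context: Let $\mathfrak g$ be a complex semisimple Lie algebra with rank $\operatorname{rk}\mathfrak g$, and let $G$ be its adjoint group (the identity component of $\operatorname{Aut}(\mathfrak g)$), acting on $\mathfrak g\oplus\mathfrak g$ diagonally via $\operatorname{Ad}$. For $x_1,x_2\in\mathfrak g$, $\mathfrak z(x_1,x_2)$ denotes their simultaneous centralizer in $\mathfrak g$ and $Z_G(x_1,x_2)$ their simultaneous centralizer in $G$. A principal nilpotent pair is a pair $\mathbf e=(e_1,e_2)\in\mathfrak g\oplus\mathfrak g$ such that $[e_1,e_2]=0$, $\dim\mathfrak z(e_1,e_2)=\operatorname{rk}\mathfrak g$, and for every $(t_1,t_2)\in\mathbb C^*\times\mathbb C^*$ there is $g\in G$ with $\operatorname{Ad}g(e_1)=t_1e_1$ and $\operatorname{Ad}g(e_2)=t_2e_2$. $Z_G^{\mathrm{unip}}(\mathbf e)$ denotes the unipotent radical of $Z_G(e_1,e_2)$. *)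

(* Defs.v *)
From HB Require Import structures.
From mathcomp Require Import all_boot all_order all_algebra.
From mathcomp Require Import reals complex.
Set Implicit Arguments. Unset Strict Implicit. Unset Printing Implicit Defensive.
Import Order.TTheory GRing.Theory Num.Theory.
Local Open Scope ring_scope.

(* A finite-dimensional Lie algebra over a field C is modelled by C^n = 'rV[C]_n
   (coordinates in a fixed basis) together with a bracket [br].
   A linear subspace of C^n is represented (as usual in mxalgebra) by a matrix
   whose row space is the subspace. *)

Section LieDefs.
Variables (C : fieldType) (n : nat).
Implicit Types (br : 'rV[C]_n -> 'rV[C]_n -> 'rV[C]_n) (x y z : 'rV[C]_n)
  (S I : 'M[C]_n) (g : 'M[C]_n).

(* Lie algebra axioms: bilinear (left linear + alternating), alternating, Jacobi. *)
Definition is_lie_bracket br : Prop :=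
  [/\ forall (a : C) x y z, br (a *: x + y) z = a *: br x z + br y z,
      forall x, br x x = 0
    & forall x y z, br x (br y z) + br y (br z x) + br z (br x y) = 0].

Definition ad br x : 'M[C]_n := lin1_mx (br x).

Definition brspace br S (T : 'M[C]_n) : 'M[C]_n :=
  (\sum_(i < n) \sum_(j < n) <<br (row i S) (row j T)>>)%MS.

Definition lie_subalgebra br S : Prop :=
  forall x y, (x <= S)%MS -> (y <= S)%MS -> (br x y <= S)%MS.

Definition lie_ideal br I : Prop :=
  forall x y, (x <= I)%MS -> (br y x <= I)%MS.

Definition lie_solvable br I : Prop :=
  exists k, (iter k (fun J => brspace br J J) I == (0 : 'M[C]_n))%MS.

Definition lie_nilpotent br S : Prop :=
  exists k, (iter k (fun J => brspace br S J) S == (0 : 'M[C]_n))%MS.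

Definition semisimple br : Prop :=
  is_lie_bracket br /\
  forall I, lie_ideal br I -> lie_solvable br I -> (I == (0 : 'M[C]_n))%MS.

Definition cartan_subalgebra br S : Prop :=
  [/\ lie_subalgebra br S, lie_nilpotent br S
    & forall x, (forall y, (y <= S)%MS -> (br x y <= S)%MS) -> (x <= S)%MS].

Definition centralizer2 br x1 x2 : 'M[C]_n :=
  (kermx (ad br x1) :&: kermx (ad br x2))%MS.

Definition has_rank_dim br (d : nat) : Prop :=
  exists H, cartan_subalgebra br H /\ \rank H = d.

Definition ss_element br x : Prop := diagonalizable (ad br x).

(* Ad g acts on row vectors by x |-> x *m g *)
Definition lie_aut br g : Prop :=
  g \in unitmx /\ forall x y, br x y *m g = br (x *m g) (y *m g).

Inductive polyfun : ('M[C]_n -> C) -> Prop :=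
  | polyfun_cst (c : C) : polyfun (fun _ => c)
  | polyfun_coord (i j : 'I_n) : polyfun (fun A => A i j)
  | polyfun_add p q : polyfun p -> polyfun q -> polyfun (fun A => p A + q A)
  | polyfun_mul p q : polyfun p -> polyfun q -> polyfun (fun A => p A * q A).

Definition zclosed (Z : 'M[C]_n -> Prop) : Prop :=
  exists P : ('M[C]_n -> C) -> Prop,
    (forall p, P p -> polyfun p) /\ (forall A, Z A <-> forall p, P p -> p A = 0).

Definition zconnected (X : 'M[C]_n -> Prop) : Prop :=
  forall Z1 Z2, zclosed Z1 -> zclosed Z2 ->
    (forall A, X A -> Z1 A \/ Z2 A) ->
    (forall A, X A -> Z1 A -> Z2 A -> False) ->
    (forall A, X A -> Z1 A) \/ (forall A, X A -> Z2 A).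

(* adjoint group G = identity component of Aut(g) *)
Definition adjoint_group br g : Prop :=
  exists X : 'M[C]_n -> Prop,
    [/\ forall A, X A -> lie_aut br A, zconnected X, X 1%:M & X g].

Definition centralizer_grp br x1 x2 g : Prop :=
  adjoint_group br g /\ x1 *m g = x1 /\ x2 *m g = x2.

Definition unipotent g : Prop := exists k, (g - 1%:M) ^+ k = 0.

Definition subgroup (N : 'M[C]_n -> Prop) : Prop :=
  [/\ N 1%:M, (forall a b, N a -> N b -> N (a *m b))
    & forall a, N a -> a \in unitmx /\ N (invmx a)].

Definition closed_in_GL (N : 'M[C]_n -> Prop) : Prop :=
  exists Z, zclosed Z /\ forall A, N A <-> (Z A /\ A \in unitmx).

Definition normal_in (N H : 'M[C]_n -> Prop) : Prop :=
  (forall a, N a -> H a) /\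
  forall h a, H h -> N a -> N (invmx h *m a *m h).

(* unipotent radical of a closed subgroup H: the largest closed connected normal
   unipotent subgroup of H; membership = lying in some such subgroup *)
Definition unipotent_radical (H : 'M[C]_n -> Prop) (u : 'M[C]_n) : Prop :=
  exists N, [/\ subgroup N, closed_in_GL N, zconnected N, normal_in N H
                & (forall a, N a -> unipotent a)] /\ N u.

Definition principal_nilpotent_pair br e1 e2 : Prop :=
  [/\ br e1 e2 = 0,
      has_rank_dim br (\rank (centralizer2 br e1 e2))
    & forall t1 t2 : C, t1 != 0 -> t2 != 0 ->
        exists g, adjoint_group br g /\ e1 *m g = t1 *: e1 /\ e2 *m g = t2 *: e2].

Definition pair_relations br e1 e2 h1 h2 : Prop :=
  [/\ br h1 e1 = e1, br h1 e2 = 0, br h2 e1 = 0, br h2 e2 = e2 & br h1 h2 = 0].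

Definition regular_pair br h1 h2 : Prop :=
  cartan_subalgebra br (centralizer2 br h1 h2).

Definition integral_ad_eigenvalues br h : Prop :=
  forall a : C, eigenvalue (ad br h) a -> exists z : int, a = z%:~R.

End LieDefs.

(* Main.v *)
(* Existence. Let the automorphism g scale e1 by 2 and e2 by 3. A Q-linear
   form on the formal logarithms of the eigenvalues of g, compatible with their
   multiplicative relations, equal to 1 at log 2 and to 0 at log 3, defines a
   diagonalizable derivation, which is inner by Killing nondegeneracy:
   it is ad h1. Exchanging 2 and 3 gives h2.

   Regularity. Let L = z(h1, h2) and eps = ad (e1 + e2). The vectors x eps^k with x in
   L and x eps^(k+1) = 0 span a space of dimension dim L, and comparing h1-weights in
   the binomial expansion of eps^(k+1) shows that it lies in Z = z(e1, e2). So dim L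
   is at most the dimension of a Cartan subalgebra, which is the minimal rank of a
   generalized kernel of ad x, and L is the generalized kernel of some ad h. By
   minimality ad y is nilpotent on L for every y in L. Then [L, L] acts nilpotently and
   is Killing-orthogonal to L, so it vanishes: L is abelian, hence Cartan.

   Integrality. The dimensions agree, so Z is that span: it is abelian, with weights
   in N. Powers of e1 and e2 move any eigenvector of h1 or h2 to a nonzero element of
   Z, changing its eigenvalue by a natural number.

   Conjugacy. Every element of Z is ad-nilpotent and ad (h1 + h2) is bijective on Z.
   The differences h1' - h1 and h2' - h2 lie in Z, which yields y in Z with
   [y, hi] = hi' - hi, and exp (ad y) does the job. The group exp (ad Z) is closed
   because y is a linear function of exp (ad y) evaluated at h1 + h2, and it is
   connected by the polynomial curves t -> exp (t ad y). *)

Require Import Defs.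
From HB Require Import structures.
From mathcomp Require Import all_boot all_order all_algebra.
From mathcomp Require Import reals complex.
From mathcomp Require Import boolp ring zify.
Import Order.TTheory GRing.Theory Num.Theory.
Local Open Scope ring_scope.

Set Implicit Arguments. Unset Strict Implicit. Unset Printing Implicit Defensive.

(** * Functions of a matrix *)

Section SpectralCalculus.
Variable C : numClosedFieldType.

(** The Lie bracket is assumed linear on the left only, and alternation alone does not give
    antisymmetry, so bilinearity is itself derived from semisimplicity before any structure theory.
    The formal logarithms replace the torus of an algebraic group: a form over the rationals
    respects every multiplicative relation between eigenvalues and kills roots of unity. The scalars
    2 and 3 serve because they are multiplicatively independent, so the values 1 and 0 can be
    prescribed at them. The rank hypothesis supplies one Cartan subalgebra with no link to the pair.
    Its dimension is therefore compared with L through a lower bound valid for the generalized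
    kernel of every ad x, obtained by deforming characteristic polynomials. One trace argument
    recurs: if F acts on each generalized eigenspace of A by the conjugate of the eigenvalue, then
    tr (A F) is a sum of squared moduli, and A is nilpotent once this trace vanishes. It serves for
    Cartan's criterion, for e1, e2 and e1 + e2, and for [L, L]. *)

Lemma crt_interp (phi : C -> C) (m : nat) (rs : seq C) : uniq rs ->
  exists q : {poly C}, forall a, a \in rs -> ('X - a%:P) ^+ m %| q - (phi a)%:P.
Proof.
elim: rs => [|b rs IH] /=; first by exists 0.
move=> /andP[bNrs /IH[q qP]].
pose P := \prod_(a <- rs) ('X - a%:P) ^+ m.
have cop : coprimep P (('X - b%:P) ^+ m).
  rewrite coprimep_expr // /P coprimep_XsubC.
  rewrite /root horner_prod prodf_seq_neq0; apply/allP => a ars /=.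
  rewrite horner_exp hornerXsubC expf_eq0 negb_and subr_eq0.
  by rewrite (memPnC bNrs) ?orbT.
have /Bezout_eq1_coprimepP[[u w] /= uw] := cop.
(* By Bezout [u * P] is 1 modulo the new factor and 0 modulo the old ones. *)
exists (q + ((phi b)%:P - q) * (u * P)) => a; rewrite inE => /predU1P[->|ars].
  have -> : q + ((phi b)%:P - q) * (u * P) - (phi b)%:P
     = (q - (phi b)%:P) * (w * ('X - b%:P) ^+ m).
    have -> : u * P = 1 - w * ('X - b%:P) ^+ m by rewrite -uw addrK.
    by ring.
  by rewrite mulrA dvdp_mulIr.
rewrite addrAC dvdp_add ?qP //; apply/dvdp_mull/dvdp_mull.
by rewrite /P (big_rem _ ars) /= dvdp_mulr.
Qed.

Definition geig n (A : 'M[C]_n) (a : C) (v : 'rV[C]_n) :=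
  exists k, v *m (A - a%:M) ^+ k = 0.

Lemma geig_horner n' (n := n'.+1) (A : 'M[C]_n) (v : 'rV[C]_n) (p q : {poly C}) :
  p %| q -> v *m horner_mx A p = 0 -> v *m horner_mx A q = 0.
Proof.
move=> /dvdpP[r ->] vp; rewrite mulrC rmorphM /= -mulmxE mulmxA.
by rewrite vp mul0mx.
Qed.

Lemma horner_mx_geig n' (n := n'.+1) (A : 'M[C]_n) a k :
  horner_mx A (('X - a%:P) ^+ k) = (A - a%:M) ^+ k.
Proof. by rewrite rmorphXn rmorphB /= horner_mx_X horner_mx_C. Qed.

Lemma mulmx_exp_le n (B : 'M[C]_n) (v : 'rV[C]_n) m k :
  (m <= k)%N -> v *m B ^+ m = 0 -> v *m B ^+ k = 0.
Proof. by move=> /subnKC<- vm; rewrite exprD -mulmxE mulmxA vm mul0mx. Qed.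

Lemma eigenvector_exp n (A : 'M[C]_n) a (v : 'rV[C]_n) k :
  v *m A = a *: v -> v *m A ^+ k = a ^+ k *: v.
Proof.
move=> vA; elim: k => [|j IH]; first by rewrite !expr0 scale1r mulmx1.
by rewrite !exprS -mulmxE mulmxA vA -scalemxAl IH scalerA.
Qed.

(** Write the characteristic polynomial as q (X - a)^m with m <= n and q prime to (X - a)^k.
    Multiplying a Bezout relation by (X - a)^m leaves two terms, one killed by Cayley-Hamilton and
    the other by the assumption on [v]. *)
Lemma geig_index n (A : 'M[C]_n) a v : geig A a v -> v *m (A - a%:M) ^+ n = 0.
Proof.
case: n A v => [|n'] A v [k vk]; first by rewrite (thinmx0 v) mul0mx.
set n := n'.+1 in A v vk *.
have chin0 : char_poly A != 0 by rewrite monic_neq0 ?char_poly_monic.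
have [m [q [qa chiE]]] := multiplicity_XsubC (char_poly A) a.
rewrite chin0 /= in qa.
have mn : (m <= n)%N.
  have := size_char_poly A; rewrite chiE size_Mmonic ?monic_exp ?monicXsubC //.
    rewrite size_exp_XsubC; suff: (0 < size q)%N by lia.
    by rewrite size_poly_gt0; apply: contraNneq qa => ->; rewrite root0.
  by apply: contraNneq qa => ->; rewrite root0.
have /Bezout_eq1_coprimepP[[u w] /= uw] : coprimep q (('X - a%:P) ^+ k).
  by rewrite coprimep_expr // coprimep_XsubC.
have: v *m horner_mx A (('X - a%:P) ^+ m) = 0.
  rewrite -[_ ^+ m]mulr1 -uw mulrDr rmorphD mulmxDr.
  rewrite (geig_horner (p := char_poly A)) ?Cayley_Hamilton ?mulmx0 //; last first.
    by rewrite chiE mulrCA [_ * q]mulrC dvdp_mulIr.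
  rewrite (geig_horner (p := ('X - a%:P) ^+ k)) ?addr0 // ?horner_mx_geig //.
  by rewrite mulrA dvdp_mulIr.
rewrite horner_mx_geig => vm.
exact: mulmx_exp_le mn vm.
Qed.

Lemma geig_eigenvector n (A : 'M[C]_n) a v : geig A a v -> v != 0 ->
  exists2 w : 'rV[C]_n, w != 0 & w *m A = a *: w.
Proof.
move=> [k]; elim: k v => [|k IH] v; first by rewrite expr0 mulmx1 => ->; rewrite eqxx.
rewrite exprS -mulmxE mulmxA => vk vn0.
have [w0|wn0] := eqVneq (v *m (A - a%:M)) 0; last exact: IH wn0.
exists v => //; apply/eqP; rewrite -subr_eq0 -w0 mulmxBr.
by rewrite -[a%:M]scalemx1 -scalemxAr mulmx1.
Qed.

Lemma prod_exp_XsubC_dvdp m (s : seq C) (p : {poly C}) : uniq s ->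
  (forall a, a \in s -> ('X - a%:P) ^+ m %| p) ->
  \prod_(a <- s) ('X - a%:P) ^+ m %| p.
Proof.
elim: s => [|b s IH] /=; first by rewrite big_nil dvd1p.
move=> /andP[bs us] H; rewrite big_cons Gauss_dvdp ?H ?mem_head //=.
  by apply: IH => // a as_; apply: H; rewrite inE as_ orbT.
rewrite coprimep_expl // coprimep_sym coprimep_XsubC /root horner_prod.
rewrite prodf_seq_neq0; apply/allP => a ars /=.
rewrite horner_exp hornerXsubC expf_eq0 negb_and subr_eq0.
by rewrite (memPnC bs) ?orbT.
Qed.

(** Chinese remaindering gives polynomials that are 1 modulo one factor (X - b)^n and 0 modulo the
    others. They sum to 1 modulo a multiple of the characteristic polynomial and cut [v] into
    generalized eigenvectors. *)
Lemma geig_sub n (A : 'M[C]_n) m (U : 'M[C]_(m, n)) :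
  (forall a v, geig A a v -> (v <= U)%MS) -> forall v : 'rV[C]_n, (v <= U)%MS.
Proof.
case: n A U => [|n'] A U HU v; first by rewrite (thinmx0 v) sub0mx.
set n := n'.+1 in A U HU v *.
have [rs chiE] := closed_field_poly_normal (char_poly A).
rewrite (monicP (char_poly_monic A)) scale1r in chiE.
pose us := undup rs.
have srs : (size rs <= n)%N.
  by have := size_char_poly A; rewrite chiE size_prod_XsubC => -[->].
pose Q := \prod_(a <- us) ('X - a%:P) ^+ n.
have Qkill (p : {poly C}) : (forall a, a \in us -> ('X - a%:P) ^+ n %| p) -> Q %| p.
  exact/prod_exp_XsubC_dvdp/undup_uniq.
have chiQ : char_poly A %| Q.
  rewrite chiE -prodr_undup_exp_count /Q.
  apply: (big_ind2 (fun p q : {poly C} => p %| q)) => // [p1 q1 p2 q2|a _].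
    exact: dvdp_mul.
  by rewrite dvdp_exp2l // (leq_trans (count_size _ _)).
have vQ : v *m horner_mx A Q = 0.
  by apply: geig_horner chiQ _; rewrite Cayley_Hamilton mulmx0.
have qP (b : C) : exists q : {poly C}, forall a, a \in us ->
    ('X - a%:P) ^+ n %| q - ((a == b)%:R)%:P.
  exact: (crt_interp (fun a => (a == b)%:R) n (undup_uniq rs)).
have [q {}qP] := boolp.choice qP.
have sumq : Q %| 1 - \sum_(b <- us) q b.
  apply: Qkill => a aus.
  rewrite -[1 - _]opprB -[- (_ - 1)]scaleN1r dvdpZr ?oppr_eq0 ?oner_eq0 // (bigD1_seq a) ?undup_uniq //= addrAC dvdp_add //.
    by have := qP a a aus; rewrite eqxx.
  rewrite big_seq_cond; apply: (big_ind (fun p : {poly C} => _ %| p)) => //.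
    by move=> *; apply: dvdp_add.
  move=> b /andP[_ ba]; have := qP b a aus.
  by rewrite eq_sym (negbTE ba) polyC0 subr0.
have -> : v = \sum_(b <- us) v *m horner_mx A (q b).
  apply/eqP; rewrite -subr_eq0; apply/eqP.
  have := geig_horner sumq vQ.
  by rewrite rmorphB rmorph1 mulmxBr raddf_sum mulmx_sumr [v *m 1]mulmx1.
rewrite big_seq; apply: summx_sub => b bus; apply: (HU b).
exists n; rewrite -horner_mx_geig -mulmxA mulmxE -rmorphM; apply: geig_horner vQ.
apply: Qkill => a aus; have [->|ab] := eqVneq a b; first by rewrite dvdp_mulIr.
by rewrite dvdp_mulr //; have := qP b a aus; rewrite (negbTE ab) polyC0 subr0.
Qed.

Lemma geig_mx0 n (A : 'M[C]_n) m (B : 'M[C]_(n, m)) :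
  (forall a v, geig A a v -> v *m B = 0) -> B = 0.
Proof.
move=> HB; apply/row_matrixP => i; rewrite row0 rowE; apply/sub_kermxP.
by apply: (geig_sub (A := A)) => a v /HB /sub_kermxP.
Qed.

Lemma nilpotent_eig n (A : 'M[C]_n) :
  (forall a (v : 'rV_n), v != 0 -> v *m A = a *: v -> a = 0) -> A ^+ n = 0.
Proof.
move=> HA; apply: (geig_mx0 (A := A)) => a v gv.
have [->|vn0] := eqVneq v 0; first by rewrite mul0mx.
have [w wn0 wA] := geig_eigenvector gv vn0.
by have := geig_index gv; rewrite (HA _ _ wn0 wA) raddf0 subr0.
Qed.

Lemma mxtrace_nilpotent n (A : 'M[C]_n) k : A ^+ k = 0 -> \tr A = 0.
Proof.
case: n A => [|n'] A Ak; first by rewrite /mxtrace big_ord0.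
have [rs chiE] := closed_field_poly_normal (char_poly A).
rewrite (monicP (char_poly_monic A)) scale1r in chiE.
have rs0 : all (pred1 0) rs.
  apply/allP => a ars /=.
  have: eigenvalue A a by rewrite eigenvalue_root_char chiE root_prod_XsubC.
  case/eigenvalueP => v vA vn0.
  have := eigenvector_exp k vA; rewrite Ak mulmx0 => /esym/eqP; rewrite scaler_eq0 (negbTE vn0) orbF.
  by rewrite expf_eq0 => /andP[_].
have := char_poly_trace A isT; rewrite chiE.
have {}rs0 : rs = nseq (size rs) 0 by apply/all_pred1P.
rewrite rs0.
rewrite big_nseq subr0 iter_mulr_1 coefXn.
have -> : size rs = n'.+1.
  by have := size_char_poly A; rewrite chiE size_prod_XsubC => -[].
by rewrite ltn_eqF //= => /esym/eqP; rewrite oppr_eq0 => /eqP.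
Qed.

Lemma diagonalizable_rows n (A : 'M[C]_n) : diagonalizable A ->
  exists P d, P \in unitmx /\ P *m A = diag_mx d *m P.
Proof.
case=> P Pu /diagonalizable_forPex[d /(simmxLR Pu) ->]; exists P, d; split=> //.
by rewrite mxpoly.conjVmx // !mulmxA mulmxV // mul1mx.
Qed.

(* [F] is the polynomial in [A] acting by [phi a] on the generalized [a]-eigenspace. *)
Lemma spectral_fun n (A : 'M[C]_n) (phi : C -> C) : exists F : 'M[C]_n,
  [/\ (forall a v, geig A a v -> v *m F = phi a *: v),
      diagonalizable F,
      (forall c, eigenvalue F c -> exists2 a, eigenvalue A a & c = phi a),
      (forall B : 'M[C]_n, A *m B = B *m A -> F *m B = B *m F)
    & (phi 0 = 0 -> exists2 G : 'M[C]_n, A *m G = G *m A & F = G *m A)].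
Proof.
case: n A => [|n'] A.
  exists 0; split; first by move=> *; rewrite [LHS]thinmx0 [RHS]thinmx0.
  - exact: diagonalizable0.
  - by move=> c /eigenvalueP[v _]; rewrite (thinmx0 v) eqxx.
  - by move=> B _; rewrite mul0mx mulmx0.
  - by exists 0; rewrite ?mul0mx ?mulmx0.
set n := n'.+1 in A *.
have [rs chiE] := closed_field_poly_normal (char_poly A).
rewrite (monicP (char_poly_monic A)) scale1r in chiE.
have rsP a : (a \in rs) = eigenvalue A a.
  by rewrite eigenvalue_root_char chiE root_prod_XsubC.
(* The node 0 is added even if it is not an eigenvalue, so that [phi 0 = 0] makes [q] divisible by
   X; this yields the factorization [F = G *m A]. *)
have [q qP] := crt_interp phi n (undup_uniq (0 :: rs)).
pose F := horner_mx A q.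
have Fact a v : geig A a v -> v *m F = phi a *: v.
  move=> gv; have [->|vn0] := eqVneq v 0; first by rewrite mul0mx scaler0.
  have [w wn0 wA] := geig_eigenvector gv vn0.
  have ars : a \in rs by rewrite rsP; apply/eigenvalueP; exists w.
  have dq : ('X - a%:P) ^+ n %| q - (phi a)%:P.
    by apply: qP; rewrite mem_undup inE ars orbT.
  apply/eqP; rewrite -subr_eq0 -mul_mx_scalar -mulmxBr -(horner_mx_C A) -rmorphB.
  by rewrite (geig_horner dq) // horner_mx_geig; exact: geig_index.
(* A polynomial with simple roots that annihilates [F]: it gives diagonalizability and locates the
   eigenvalues. *)
pose p := \prod_(x <- undup (map phi rs)) ('X - x%:P).
have pF : horner_mx F p = 0.
  apply: (geig_mx0 (A := A)) => a v gv.
  have [->|vn0] := eqVneq v 0; first by rewrite mul0mx.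
  have [w wn0 wA] := geig_eigenvector gv vn0.
  have ars : a \in rs by rewrite rsP; apply/eigenvalueP; exists w.
  have : phi a \in undup (map phi rs) by rewrite mem_undup map_f.
  rewrite -root_prod_XsubC -/p => /factor_theorem[r ->].
  rewrite mulrC rmorphM rmorphB /= horner_mx_X horner_mx_C -mulmxE mulmxA mulmxBr.
  by rewrite (Fact _ _ gv) mul_mx_scalar subrr mul0mx.
exists F; split=> //.
- apply/diagonalizableP; exists (undup (map phi rs)); first exact: undup_uniq.
  exact: mxminpoly_min.
- move=> c; rewrite eigenvalue_root_min => /root_dvdp.
  move=> /(_ p) /(_ (mxminpoly_min pF)); rewrite root_prod_XsubC mem_undup.
  by case/mapP => a ars ->; exists a => //; rewrite -rsP.
- by move=> B AB; apply: comm_horner_mx.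
- move=> phi0; have : root q 0.
    have := qP 0; rewrite mem_undup mem_head => /(_ isT); rewrite phi0 polyC0 !subr0.
    by move=> dq; rewrite -dvdp_XsubCl subr0 (dvdp_trans _ dq) // exprS dvdp_mulIl.
  move=> /factor_theorem[r qE]; exists (horner_mx A r).
    by apply/comm_mx_sym/comm_horner_mx.
  by rewrite /F qE rmorphM rmorphB /= horner_mx_X horner_mx_C raddf0 subr0.
Qed.

(* The trace is the sum of the [|a|^2] over the eigenvalues [a] of [A]. *)
Lemma nilpotent_trace_conj n (A F : 'M[C]_n) :
  (forall a v, geig A a v -> v *m F = a^* *: v) ->
  A *m F = F *m A -> \tr (A *m F) = 0 -> A ^+ n = 0.
Proof.
move=> Fact AF trAF.
have [F2 [F2act F2diag F2eig F2comm _]] := spectral_fun A (fun a => a * a^*).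
have tr2 : \tr F2 = 0.
  suff : \tr (A *m F - F2) = 0 by rewrite raddfB /= trAF sub0r => /eqP; rewrite oppr_eq0 => /eqP.
  have F2A : F2 *m A = A *m F2 by exact: F2comm.
  have F2F : F2 *m F = F *m F2 by exact: F2comm.
  (* On the generalized eigenspace of a, [A *m F - F2] is the conjugate of a times [A - a], hence
     nilpotent: the two traces agree. *)
  have AFE v a : geig A a v -> v *m (A *m F - F2) = a^* *: (v *m (A - a%:M)).
    move=> gv; rewrite AF mulmxBr mulmxA (Fact _ _ gv) (F2act _ _ gv) mulmxBr mul_mx_scalar scalerBr.
    by rewrite -scalemxAl scalerA [a * _]mulrC.
  have gst a v : geig A a v -> geig A a (v *m (A - a%:M)).
    by case=> k vk; exists k; rewrite -mulmxA mulmxE -exprS exprSr -mulmxE mulmxA vk mul0mx.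
  apply: (@mxtrace_nilpotent _ _ n); apply: (geig_mx0 (A := A)) => a v gv.
  have Hk k w : geig A a w ->
      w *m (A *m F - F2) ^+ k = (a^* ^+ k) *: (w *m (A - a%:M) ^+ k).
    elim: k w => [|k IH] w gw; first by rewrite !expr0 scale1r.
    rewrite !exprS -!mulmxE !mulmxA (AFE _ _ gw) -scalemxAl IH; last exact: gst.
    by rewrite scalerA.
  by rewrite Hk // geig_index // scaler0.
(* [F2] is diagonalizable with nonnegative eigenvalues of sum 0. *)
have F20 : F2 = 0.
  have [P [d [Pu PF2]]] := diagonalizable_rows F2diag.
  have dge j : 0 <= d 0 j.
    have [a _ ->] : exists2 a, eigenvalue A a & d 0 j = a * a^*.
      apply: F2eig; apply/eigenvalueP; exists (row j P).
        by rewrite -row_mul PF2 row_mul row_diag_mx -scalemxAl -rowE.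
      apply/eqP => Pj0; have /rowP/(_ j) : row j (P *m invmx P) = 0.
        by rewrite row_mul Pj0 mul0mx.
      by rewrite mulmxV // !mxE eqxx => /eqP; rewrite oner_eq0.
    exact: mul_conjC_ge0.
  have F2E : F2 = invmx P *m (diag_mx d *m P) by rewrite -PF2 mulKmx.
  have dE j : d 0 j = 0.
    have : \tr F2 = \sum_j d 0 j.
      by rewrite F2E mxtrace_mulC mulmxK // mxtrace_diag.
    rewrite tr2 => /esym/eqP; rewrite psumr_eq0 // => /allP/(_ j).
    by rewrite mem_index_enum => /(_ isT)/eqP.
  rewrite F2E (_ : d = 0) ?raddf0 ?mul0mx ?mulmx0 //.
  by apply/rowP => j; rewrite dE mxE.
apply: nilpotent_eig => a v vn0 vA.
have : v *m F2 = (a * a^*) *: v.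
  by apply: F2act; exists 1%N; rewrite expr1 mulmxBr vA mul_mx_scalar subrr.
rewrite F20 mulmx0 => /esym/eqP; rewrite scaler_eq0 (negbTE vn0) orbF.
by rewrite mul_conjC_eq0 => /eqP.
Qed.

End SpectralCalculus.

Section Subspace.
Variables (C : fieldType) (n : nat).

(** A matrix of maximal rank among those whose rows satisfy [P] works: adjoining any further vector
    of [P] would raise the rank. *)
Lemma subspace_mx (P : 'rV[C]_n -> Prop) :
  P 0 -> (forall a x y, P x -> P y -> P (a *: x + y)) ->
  exists S : 'M[C]_n, forall v, (v <= S)%MS <-> P v.
Proof.
move=> P0 Plin.
have Psub m (S : 'M[C]_(m, n)) : (forall i, P (row i S)) -> forall v, (v <= S)%MS -> P v.
  move=> PS v /submxP[u ->]; rewrite mulmx_sum_row.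
  by elim/big_rec: _ => // i x _ Px; apply: Plin.
pose p r := `[< exists S : 'M[C]_n, (forall i, P (row i S)) /\ \rank S = r >].
have exp : exists r, p r.
  by exists 0%N; apply/asboolP; exists 0; split; [move=> i; rewrite row0 | rewrite mxrank0].
have bp r : p r -> (r <= n)%N by move=> /asboolP[S [_ <-]]; apply: rank_leq_col.
case: (ex_maxnP exp bp) => r /asboolP[S [PS Sr]] rmax.
exists S => v; split; first exact: Psub.
move=> Pv; have PSv u : (u <= S + v)%MS -> P u.
  move=> /sub_addsmxP[[a b] -> /=]; rewrite addrC [b]mx11_scalar mul_scalar_mx.
  by apply: Plin => //; apply: (Psub _ S) => //; apply: submxMl.
have : p (\rank (S + v)%MS).
  by apply/asboolP; exists (S + v)%MS; split=> // i; apply: PSv; apply: row_sub.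
move/rmax; rewrite -Sr => le.
have : (S + v <= S)%MS by rewrite -(mxrank_leqif_sup (addsmxSl S v)) eqn_leq le mxrankS ?addsmxSl.
by rewrite addsmx_sub => /andP[].
Qed.

End Subspace.

Lemma geig_ind (C : numClosedFieldType) n (A : 'M[C]_n) (P : 'rV[C]_n -> Prop) :
  P 0 -> (forall a x y, P x -> P y -> P (a *: x + y)) ->
  (forall a v, geig A a v -> P v) -> forall v, P v.
Proof.
move=> P0 Plin Pg v; have [S SP] := subspace_mx P0 Plin.
by apply/SP; apply: (geig_sub (A := A)) => a w /Pg /SP.
Qed.

(** * Right linearity of a semisimple bracket *)

Section LeftLinear.
Variables (C : numClosedFieldType) (n : nat).
Variable br : 'rV[C]_n -> 'rV[C]_n -> 'rV[C]_n.
Hypothesis ss : semisimple br.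
Local Notation T x y z := (br x (br y z)).
Local Notation vec := 'rV[C]_n.

Local Lemma left_linear a x y z : br (a *: x + y) z = a *: br x z + br y z.
Proof. by case: ss => -[]. Qed.
Local Lemma alternating x : br x x = 0.
Proof. by case: ss => -[]. Qed.
Local Lemma jacobi x y z : T x y z + T y z x + T z x y = 0.
Proof. by case: ss => -[]. Qed.

Local Lemma left_add x y z : br (x + y) z = br x z + br y z.
Proof. by have := left_linear 1 x y z; rewrite !scale1r. Qed.
Local Lemma left0 z : br 0 z = 0.
Proof. by apply: (addIr (br 0 z)); rewrite -left_add !add0r. Qed.
Local Lemma left_scale a x z : br (a *: x) z = a *: br x z.
Proof. by have := left_linear a x 0 z; rewrite left0 !addr0. Qed.
Local Lemma left_opp x z : br (- x) z = - br x z.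
Proof. by rewrite -scaleN1r left_scale scaleN1r. Qed.

Local Lemma mulr3n_eq0 (v : vec) : v *+ 3 = 0 -> v = 0.
Proof. by move/eqP; rewrite -scaler_nat scaler_eq0 pnatr_eq0 => /eqP. Qed.
Local Lemma eq_opp0 (v : vec) : v = - v -> v = 0.
Proof. by move/eqP; rewrite -addr_eq0 -mulr2n -scaler_nat scaler_eq0 pnatr_eq0 => /eqP. Qed.

Local Lemma right0 x : br x 0 = 0.
Proof. by have := jacobi x x x; rewrite alternating -mulr2n -mulrSr => /mulr3n_eq0. Qed.

(* Additive in [z] by the Jacobi identity, symmetric in [(y, y')], and zero for
   [y' = z]: with the cocycle identity this forces it to vanish. *)
Local Definition defect x y y' z := T x (y + y') z - T x y z - T x y' z.

Local Lemma defectE x y y' z : defect x y y' z =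
  - (T z x (y + y') - T z x y - T z x y').
Proof.
rewrite /defect; have := jacobi x (y + y') z; have := jacobi x y z; have := jacobi x y' z.
rewrite (left_add y y' (br z x)); move: (T x (y + y') z) (T z x (y + y')) (T x y z) (T x y' z) => a b c d.
move: (T z x y) (T z x y') (T y z x) (T y' z x) => e f g h H1 H2 H3.
have : (a + (g + h) + b) - (c + g + e) - (d + h + f) = 0 by rewrite H1 H2 H3 !subr0.
move=> H; apply/eqP; rewrite -addr_eq0 -{}[X in _ == X]H; apply/eqP.
by apply/rowP => j; rewrite !mxE; ring.
Qed.

Local Lemma defectDz x y y' z z' :
  defect x y y' (z + z') = defect x y y' z + defect x y y' z'.
Proof. by rewrite !defectE !left_add; apply/rowP => j; rewrite !mxE; ring. Qed.

Local Lemma defectC x y y' z : defect x y y' z = defect x y' y z.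
Proof. by rewrite /defect [y + y']addrC addrAC. Qed.

Local Lemma defect_diag x y z : defect x y z z = 0.
Proof. by rewrite /defect left_add alternating addr0 right0 subr0 subrr. Qed.

Local Lemma defect_cocycle x y y' y'' z : defect x y (y' + y'') z =
  defect x (y + y'') y' z + defect x y y'' z - defect x y'' y' z.
Proof.
rewrite /defect (addrAC y y'' y') -addrA (addrC y'' y').
by apply/rowP => j; rewrite !mxE; ring.
Qed.

Local Lemma defect_anti x y z z' : defect x y z z' = - defect x y z' z.
Proof.
apply/eqP; rewrite -addr_eq0; have := defect_diag x y (z + z').
rewrite defectDz (defect_cocycle x y z z' z) !defect_diag add0r subr0 (addrC z z').
by rewrite (defect_cocycle x y z' z z') !defect_diag add0r subr0 addrC => ->.
Qed.

Local Lemma defect0 x y y' z : defect x y y' z = 0.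
Proof.
apply: eq_opp0.
by rewrite {1}defect_anti defectC defect_anti defectC opprK defect_anti defectC.
Qed.

Local Lemma T_add_mid x y y' z : T x (y + y') z = T x y z + T x y' z.
Proof. by have /eqP := defect0 x y y' z; rewrite /defect -addrA -opprD subr_eq0 => /eqP. Qed.

Local Lemma T_add_right x y z z' : T x y (z + z') = T x y z + T x y z'.
Proof.
have /eqP := defect0 y z z' x; rewrite defectE oppr_eq0 -addrA -opprD subr_eq0.
by move/eqP.
Qed.

Local Lemma T_anti x y z : T x y z = - T x z y.
Proof.
apply/eqP; rewrite -addr_eq0; have := alternating (y + z) => /(congr1 (br x)).
by rewrite right0 T_add_mid !T_add_right !alternating right0 add0r addr0 => ->.
Qed.

(** The obstruction [D] is symmetric in its outer arguments by the Jacobi identity and antisymmetric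
    in the last two. Composing these transpositions gives D = - D. *)
Local Lemma T_scale_mid c x y z : T x (c *: y) z = c *: T x y z.
Proof.
pose D x y z := T x (c *: y) z - c *: T x y z.
have D13 u v w : D u v w = D w v u.
  have := jacobi u (c *: v) w; have := jacobi u v w.
  rewrite (left_scale c v (br w u)) (T_anti w u (c *: v)) (T_anti w u v) /D.
  move: (T v w u) (T u (c *: v) w) (T w (c *: v) u) (T u v w) (T w v u).
  move=> e a b a' b' J1 J2; apply/eqP; rewrite -subr_eq0; apply/eqP.
  have <- : a + c *: e - b - c *: (a' + e - b') = 0 by rewrite J1 J2 scaler0 subr0.
  by apply/rowP => j; rewrite !mxE; ring.
have Dr u v w w' : D u v (w + w') = D u v w + D u v w'.
  by rewrite /D !T_add_right scalerDr opprD addrACA.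
have Dm u v v' w : D u (v + v') w = D u v w + D u v' w.
  by rewrite /D scalerDr !T_add_mid scalerDr opprD addrACA.
have D23 u v w : D u v w = - D u w v.
  have Dd a : D u a a = 0 by rewrite /D left_scale alternating scaler0 right0 scaler0 subr0.
  apply/eqP; rewrite -addr_eq0; have := Dd (v + w).
  by rewrite Dm !Dr !Dd add0r addr0 => ->.
apply/eqP; rewrite -subr_eq0 -/(D x y z); apply/eqP/eq_opp0.
by rewrite {1}D23 D13 D23 D13 opprK D23 D13.
Qed.

Local Lemma T_scale_right c x y z : T x y (c *: z) = c *: T x y z.
Proof. by rewrite T_anti T_scale_mid T_anti scalerN opprK. Qed.

Local Lemma abelian_ideal0 (S : 'M[C]_n) :
  (forall x v : vec, (v <= S)%MS -> (br x v <= S)%MS) ->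
  (forall v w : vec, (v <= S)%MS -> (w <= S)%MS -> br v w = 0) ->
  forall v : vec, (v <= S)%MS -> v = 0.
Proof.
move=> Sid Sab v vS; case: ss => _ /(_ S) H.
have /andP[S0 _] : (S == (0 : 'M[C]_n))%MS.
  apply: H; first by move=> x y; apply: Sid.
  exists 1%N; rewrite /= /brspace big1 ?submx_refl // => i _.
  by rewrite big1 // => j _; rewrite Sab ?row_sub // genmx0.
by apply/eqP; rewrite -submx0 (submx_trans vS).
Qed.

(** All multiples of [m] occur in the hypothesis because [br x] is not yet known to be homogeneous;
    the line through [m] is then an abelian ideal. *)
Local Lemma annihilated_line0 m : (forall c x, br x (c *: m) = 0) -> m = 0.
Proof.
move=> Hm; have [S SP] : exists S : 'M[C]_n, forall v, (v <= S)%MS <-> exists c, v = c *: m.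
  apply: subspace_mx; first by exists 0; rewrite scale0r.
  by move=> a _ _ [c ->] [c' ->]; exists (a * c + c'); rewrite scalerDl scalerA.
apply: (abelian_ideal0 (S := S)).
- by move=> x v /SP[c ->]; rewrite Hm sub0mx.
- by move=> v w _ /SP[c ->].
by apply/SP; exists 1; rewrite scale1r.
Qed.

Local Lemma middle_kernel0 r : (forall x z, T x r z = 0) -> r = 0.
Proof.
move=> Hr; apply: annihilated_line0 => c y; apply: annihilated_line0 => d x.
by rewrite -left_scale T_anti T_scale_mid Hr scaler0 oppr0.
Qed.

Local Lemma prod_anti x y z : br y (br x z) = - br (br x z) y.
Proof.
set a := br x z; apply/eqP; rewrite -addr_eq0; apply/eqP/middle_kernel0 => w p.
rewrite T_anti T_add_right; have -> : br p (br a y) = br (- p) (br y a).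
  by rewrite left_opp (T_anti p y a) opprK.
by rewrite -[- p]scaleN1r T_scale_mid scaleN1r subrr oppr0.
Qed.

(* [br y (a + b) - br y a - br y b] and [br y (c *: a) - c *: br y a] belong to
   [kills_killers], an abelian ideal, hence vanish. *)
Local Definition kills_products v := forall w p, T v w p = 0.
Local Definition kills_killers v := kills_products v /\ forall u, kills_products u -> br v u = 0.

Local Lemma kills_killers0 v : kills_killers v -> v = 0.
Proof.
have [S SP] : exists S : 'M[C]_n, forall v, (v <= S)%MS <-> kills_killers v.
  apply: subspace_mx; first by split=> [w p|u _]; rewrite left0.
  move=> a x y [x0 x1] [y0 y1]; split=> [w p|u u0].
    by rewrite left_linear x0 y0 scaler0 addr0.
  by rewrite left_linear x1 // y1 // scaler0 addr0.
have prod_kills u y z : kills_products u -> br (br y z) u = 0.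
  by move=> Vu; apply/eqP; rewrite -oppr_eq0 -prod_anti Vu.
move=> Vv; apply: (abelian_ideal0 (S := S)); last exact/SP.
- move=> x u /SP[u0 u1]; apply/SP; split=> [w p|u']; last exact: prod_kills.
  apply/eqP; rewrite -oppr_eq0 -prod_anti.
  by have := jacobi (br w p) x u; rewrite u0 right0 addr0 u0 addr0 => ->; rewrite eqxx.
- by move=> u w /SP[_ u1] /SP[w0 _]; apply: u1.
Qed.

Lemma semisimple_linear x : linear (br x).
Proof.
move=> a y z; apply/eqP; rewrite -subr_eq0; apply/eqP/kills_killers0; split=> [w p|u u0].
  have pl u : br (br x u) (br w p) = - T (br w p) x u by rewrite (prod_anti x (br w p) u) opprK.
  by rewrite left_add left_opp left_linear !pl T_add_right T_scale_right; apply/rowP => j; rewrite !mxE; ring.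
have pl v : br (br x v) u = 0.
  by apply/eqP; rewrite -oppr_eq0 -prod_anti u0.
by rewrite left_add left_opp left_linear !pl scaler0 addr0 subr0.
Qed.

End LeftLinear.

(* [is_lie_bracket] only asks for linearity on the left; linearity on the right
   has to be deduced from semisimplicity. *)
Class lie_algebra (C : fieldType) n (br : 'rV[C]_n -> 'rV[C]_n -> 'rV[C]_n) : Prop :=
  LieAlgebra { lie_bracket : is_lie_bracket br; br_linear : forall x, linear (br x) }.

Lemma semisimple_lie_algebra (C : numClosedFieldType) n
  (br : 'rV[C]_n -> 'rV[C]_n -> 'rV[C]_n) : semisimple br -> lie_algebra br.
Proof. by move=> ss; split; [case: ss | exact: semisimple_linear]. Qed.

(** * Engel's theorem *)

Section LieBasics.
Variables (C : numClosedFieldType) (n : nat).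
Variable br : 'rV[C]_n -> 'rV[C]_n -> 'rV[C]_n.
Context {Hlie : lie_algebra br}.
Implicit Types (x y z v w : 'rV[C]_n) (K N U W S T : 'M[C]_n).

Lemma brlin a x y z : br (a *: x + y) z = a *: br x z + br y z.
Proof. by case: (lie_bracket (br := br)). Qed.

Lemma brDl x y z : br (x + y) z = br x z + br y z.
Proof. by have := brlin 1 x y z; rewrite !scale1r. Qed.

Lemma br0l z : br 0 z = 0.
Proof. by apply: (addIr (br 0 z)); rewrite -brDl !add0r. Qed.

Lemma brZl a x z : br (a *: x) z = a *: br x z.
Proof. by have := brlin a x 0 z; rewrite br0l !addr0. Qed.

Lemma brxx x : br x x = 0.
Proof. by case: (lie_bracket (br := br)). Qed.

Lemma adE x v : v *m ad br x = br x v.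
Proof.
pose f : {linear 'rV[C]_n -> 'rV[C]_n} :=
  HB.pack (br x) (GRing.isLinear.Build _ _ _ _ _ (br_linear x)).
exact: (mul_rV_lin1 f v).
Qed.

Lemma brDr x y z : br x (y + z) = br x y + br x z.
Proof. by rewrite -!adE mulmxDl. Qed.

Lemma brZr a x y : br x (a *: y) = a *: br x y.
Proof. by rewrite -!adE scalemxAl. Qed.

Lemma brNr x y : br x (- y) = - br x y.
Proof. by rewrite -!adE mulNmx. Qed.

Lemma brNl x y : br (- x) y = - br x y.
Proof. by rewrite -scaleN1r brZl scaleN1r. Qed.

Lemma brBr x y z : br x (y - z) = br x y - br x z.
Proof. by rewrite brDr brNr. Qed.

Lemma brBl x y z : br (x - y) z = br x z - br y z.
Proof. by rewrite brDl brNl. Qed.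

Lemma brC x y : br x y = - br y x.
Proof.
apply/eqP; rewrite -addr_eq0; have := brxx (x + y).
by rewrite brDl !brDr !brxx add0r addr0 => ->.
Qed.

Lemma br0r x : br x 0 = 0.
Proof. by rewrite -adE mul0mx. Qed.

Lemma br_jacobi x y z : br x (br y z) = br (br x y) z + br y (br x z).
Proof.
case: (lie_bracket (br := br)) => _ _ /(_ x y z) J.
rewrite (brC (br x y)) (brC x z) brNr; apply/eqP; rewrite -subr_eq0.
by rewrite !opprD !opprK addrA addrAC J.
Qed.

Lemma adP a x y : ad br (a *: x + y) = a *: ad br x + ad br y.
Proof.
apply/row_matrixP => i; rewrite rowE adE brlin linearD linearZ /=.
by rewrite !rowE -!adE.
Qed.

Lemma adZ a x : ad br (a *: x) = a *: ad br x.
Proof. by apply/row_matrixP => i; rewrite rowE adE brZl linearZ /= rowE -adE. Qed.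

Lemma adD x y : ad br (x + y) = ad br x + ad br y.
Proof. by have := adP 1 x y; rewrite !scale1r. Qed.

Lemma adN x : ad br (- x) = - ad br x.
Proof. by rewrite -scaleN1r adZ scaleN1r. Qed.

Lemma ad0 : ad br 0 = 0.
Proof. by rewrite -(scale0r 0) adZ scale0r. Qed.

(** Operators act on row vectors from the right, which reverses the usual order of the
    commutator. *)
Lemma ad_br x y : ad br (br x y) = ad br y *m ad br x - ad br x *m ad br y.
Proof.
apply/row_matrixP => i; rewrite linearB /= !rowE !mulmxA !adE br_jacobi.
by rewrite addrK.
Qed.

Lemma brspace_sub S T U :
  (forall x y, (x <= S)%MS -> (y <= T)%MS -> (br x y <= U)%MS) ->
  (brspace br S T <= U)%MS.
Proof.
move=> H; apply/sumsmx_subP => i _; apply/sumsmx_subP => j _.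
by rewrite genmxE H ?row_sub.
Qed.

Lemma brspace_mem S T x y :
  (x <= S)%MS -> (y <= T)%MS -> (br x y <= brspace br S T)%MS.
Proof.
move=> xS yT; rewrite -adE; apply: submx_trans (submxMr _ yT) _.
apply/row_subP => j; rewrite row_mul adE brC -adE eqmx_opp.
apply: submx_trans (submxMr _ xS) _; apply/row_subP => i.
rewrite row_mul adE brC eqmx_opp.
by apply: (sumsmx_sup i) => //; apply: (sumsmx_sup j) => //; rewrite genmxE.
Qed.

Lemma brspaceS S S' T T' : (S <= S')%MS -> (T <= T')%MS ->
  (brspace br S T <= brspace br S' T')%MS.
Proof.
move=> SS TT; apply: brspace_sub => x y xS yT.
by rewrite brspace_mem ?(submx_trans xS) ?(submx_trans yT).
Qed.

Definition ad_stable K U := forall x, (x <= K)%MS -> (U *m ad br x <= U)%MS.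

Lemma ad_stable_br K U x u : ad_stable K U -> (x <= K)%MS -> (u <= U)%MS ->
  (br x u <= U)%MS.
Proof. by move=> sU xK uU; rewrite -adE (submx_trans (submxMr _ uU)) ?sU. Qed.

Lemma ad_stableP K U :
  (forall x u, (x <= K)%MS -> (u <= U)%MS -> (br x u <= U)%MS) -> ad_stable K U.
Proof. by move=> H x xK; apply/row_subP => i; rewrite row_mul adE H ?row_sub. Qed.

(** Engel's theorem for [K] acting on [W] modulo [U]. The ambient [N] contains both [K] and [W], so
    that a single nilpotency assumption covers this action and the adjoint action of [K] on itself,
    to which the induction is also applied. *)
Lemma engel_vector d K N U W : (\rank K <= d)%N -> lie_subalgebra br K ->
  (K <= N)%MS -> (W <= N)%MS ->
  (forall x, (x <= K)%MS -> N *m ad br x ^+ n = 0) ->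
  ad_stable K U -> ad_stable K W -> ~~ (W <= U)%MS ->
  exists v, [/\ (v <= W)%MS, ~~ (v <= U)%MS
    & forall x, (x <= K)%MS -> (br x v <= U)%MS].
Proof.
elim: d K U W => [|d IH] K U W rK Ksub KN WN nil sU sW WU.
  have [i iU] : exists i, ~~ (row i W <= U)%MS.
    apply/existsP; rewrite -negb_forall; apply: contra WU => /forallP H.
    exact/row_subP.
  exists (row i W); split; rewrite ?row_sub // => x.
  move: rK; rewrite leqn0 mxrank_eq0 => /eqP->; rewrite submx0 => /eqP->.
  by rewrite br0l sub0mx.
have [K0|Kn0] := posnP (\rank K); first by apply: IH; rewrite ?K0.
pose p r := `[< exists P, [/\ lie_subalgebra br P, (P <= K)%MS, \rank P = r & (r < \rank K)%N]>].
have exp : exists r, p r.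
  exists 0%N; apply/asboolP; exists 0; split; rewrite ?sub0mx ?mxrank0 //.
  by move=> x y; rewrite submx0 => /eqP-> _; rewrite br0l sub0mx.
have bp r : p r -> (r <= \rank K)%N by move=> /asboolP[P [_ _ _ /ltnW]].
case: (ex_maxnP exp bp) => r /asboolP[P [Psub PK Pr rltK]] rmax.
have sK : ad_stable K K by apply: ad_stableP => x u; apply: Ksub.
have wK Z : ad_stable K Z -> ad_stable P Z.
  by move=> sZ x xP; apply: sZ; apply: submx_trans xP PK.
have nilP x : (x <= P)%MS -> N *m ad br x ^+ n = 0.
  by move=> xP; apply: nil; apply: submx_trans xP PK.
have PN := submx_trans PK KN.
have Pd : (\rank P <= d)%N by rewrite Pr -ltnS (leq_trans rltK).
(* The induction hypothesis for [P] acting on [K] modulo [P] yields a vector normalizing [P];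
   maximality of [P] then forces [K] to be [P] plus one line. *)
have [|v [vK vP Pv]] := IH P P K Pd Psub PN KN nilP (ad_stableP Psub) (wK _ sK).
  by apply: contraL rltK => /mxrankS; rewrite Pr leqNgt.
have KPv : (K <= P + v)%MS.
  have PvK : (P + v <= K)%MS by rewrite addsmx_sub PK.
  have Pvsub : lie_subalgebra br (P + v)%MS.
    move=> x y /sub_addsmxP[[a b] ->] /sub_addsmxP[[a' b'] ->] /=.
    have line (c : 'rV_1) : c *m v = c 0 0 *: v.
      by rewrite {1}[c]mx11_scalar mul_scalar_mx.
    rewrite !line !brDl !brDr !brZl !brZr brxx !scaler0 addr0.
    apply: submx_trans (addsmxSl P v); apply: addmx_sub; first apply: addmx_sub.
    - by apply: Psub; apply: submxMl.
    - by apply/scalemx_sub/Pv/submxMl.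
    by rewrite brC; apply: scalemx_sub; rewrite eqmx_opp; apply/Pv/submxMl.
  rewrite -(mxrank_leqif_sup PvK) eqn_leq mxrankS //= leqNgt; apply/negP => lt.
  have : p (\rank (P + v)%MS) by apply/asboolP; exists (P + v)%MS.
  move/rmax; rewrite -Pr leqNgt => /negP; apply.
  rewrite ltn_neqAle mxrankS ?addsmxSl // andbT.
  by rewrite (mxrank_leqif_sup (addsmxSl P v)) addsmx_sub submx_refl.
(* Applying [ad v] preserves the property of being sent into [U] by [P], so the last iterate of [w0]
   outside [U] is the required vector. *)
have [w0 [w0W w0U Pw0]] := IH P U W Pd Psub PN WN nilP (wK _ sU) (wK _ sW) WU.
pose w k := w0 *m ad br v ^+ k.
have wS k : w k.+1 = br v (w k) by rewrite /w exprSr -mulmxE mulmxA adE.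
have wW k : (w k <= W)%MS.
  elim: k => [|k IHk]; first by rewrite /w expr0 mulmx1.
  by rewrite wS (ad_stable_br sW).
have Pw k x : (x <= P)%MS -> (br x (w k) <= U)%MS.
  elim: k x => [|k IHk] x xP; first by rewrite /w expr0 mulmx1 Pw0.
  rewrite wS br_jacobi addmx_sub ?IHk ?Pv // (ad_stable_br sU) //.
  exact: IHk.
have [k [kU k1U]] : exists k, ~~ (w k <= U)%MS /\ (w k.+1 <= U)%MS.
  have exk : exists k, (w k <= U)%MS.
    exists n; have /submxP[c w0E] := submx_trans w0W WN.
    by rewrite /w w0E -mulmxA nil // mulmx0 sub0mx.
  case: (ex_minnP exk) => -[|k] kU kmin.
    by move: kU; rewrite /w expr0 mulmx1 (negbTE w0U).
  by exists k; split=> //; apply/negP => /kmin; rewrite ltnn.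
exists (w k); split=> // x xK.
have /sub_addsmxP[[a b] -> /=] := submx_trans xK KPv.
rewrite brDl; apply: addmx_sub; first exact/Pw/submxMl.
by rewrite {1}[b]mx11_scalar mul_scalar_mx brZl scalemx_sub // -wS.
Qed.

(** Engel vectors are adjoined to [U] until the next one would fill [W]. The resulting strict drop
    of rank bounds the length of descending series. *)
Lemma engel_flag K N U W : lie_subalgebra br K ->
  (K <= N)%MS -> (W <= N)%MS ->
  (forall x, (x <= K)%MS -> N *m ad br x ^+ n = 0) ->
  ad_stable K U -> ad_stable K W -> (U <= W)%MS -> ~~ (W <= U)%MS ->
  exists U' : 'M[C]_n, [/\ (U' <= W)%MS, ~~ (W <= U')%MS
    & forall x, (x <= K)%MS -> (W *m ad br x <= U')%MS].
Proof.
move=> Ksub KN WN nil + sW; move: {2}(\rank W - \rank U)%N (leqnn (\rank W - \rank U)) => d.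
elim: d U => [|d IH] U rd sU UW WU.
  move: rd; rewrite leqn0 subn_eq0 => rd; case/negP: WU.
  by rewrite -(mxrank_leqif_sup UW) eqn_leq rd mxrankS.
have [v [vW vU Kv]] := engel_vector (leqnn _) Ksub KN WN nil sU sW WU.
have UvE : ad_stable K (U + v)%MS /\ forall x, (x <= K)%MS -> ((U + v)%MS *m ad br x <= U)%MS.
  have H x : (x <= K)%MS -> ((U + v)%MS *m ad br x <= U)%MS.
    by move=> xK; rewrite addsmxMr addsmx_sub sU //= adE Kv.
  by split=> // x xK; rewrite (submx_trans (H x xK)) ?addsmxSl.
have UvW : (U + v <= W)%MS by rewrite addsmx_sub UW.
have [WUv|WUv] := boolP (W <= U + v)%MS.
  exists U; split=> // x xK; apply: submx_trans (submxMr _ WUv) _.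
  exact: UvE.2.
have ltU : (\rank U < \rank (U + v)%MS)%N.
  rewrite ltn_neqAle mxrankS ?addsmxSl // andbT.
  by rewrite (mxrank_leqif_sup (addsmxSl U v)) addsmx_sub submx_refl.
by apply: (IH (U + v)%MS) => //; [have := mxrankS UvW; lia | exact: UvE.1].
Qed.

End LieBasics.

(** * Derivations and the Killing form *)

Section Derivations.
Variables (C : numClosedFieldType) (n : nat).
Variable br : 'rV[C]_n -> 'rV[C]_n -> 'rV[C]_n.
Context {Hlie : lie_algebra br}.
Implicit Types (x y z v w : 'rV[C]_n) (D F : 'M[C]_n).

Definition derivation D :=
  forall x y, br x y *m D = br (x *m D) y + br x (y *m D).

Lemma derivationP D : derivation D <->
  forall x, ad br (x *m D) = ad br x *m D - D *m ad br x.
Proof.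
split=> H x; last first.
  move=> y; have /(congr1 (mulmx y)) := H x.
  by rewrite mulmxBr !mulmxA !adE => ->; rewrite subrK.
apply/row_matrixP => i; rewrite linearB /= !rowE !mulmxA !adE.
by rewrite H addrK.
Qed.

Lemma derivation_geig D a b x y : derivation D ->
  geig D a x -> geig D b y -> geig D (a + b) (br x y).
Proof.
move=> HD [k xk] [l yl]; exists (k + l)%N.
move: {-1}(k + l)%N (leqnn (k + l)) => s; elim: s k l x y xk yl => [|s IH] k l x y xk yl.
  rewrite leqn0 addn_eq0 => /andP[/eqP k0 _]; move: xk.
  by rewrite k0 expr0 mulmx1 => ->; rewrite br0l mul0mx.
move=> kls; rewrite exprS -mulmxE mulmxA.
have -> : br x y *m (D - (a + b)%:M) = br (x *m (D - a%:M)) y + br x (y *m (D - b%:M)).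
  rewrite !mulmxBr !mul_mx_scalar HD brBl brBr brZl brZr scalerDl opprD.
  by rewrite addrACA.
rewrite mulmxDl.
case: k xk kls => [|k] xk kls.
  move: xk; rewrite expr0 mulmx1 => ->.
  by rewrite mul0mx !br0l mul0mx addr0.
case: l yl kls => [|l] yl kls.
  move: yl; rewrite expr0 mulmx1 => ->.
  by rewrite mul0mx !br0r mul0mx addr0.
rewrite (IH k l.+1) ?(IH k.+1 l) ?addr0 //; try lia.
  by move: yl; rewrite exprS -mulmxE mulmxA.
by move: xk; rewrite exprS -mulmxE mulmxA.
Qed.

(** On brackets, g - ab expands as (g - a, g - b) + b (g - a, 1) + a (1, g - b), and each term
    lowers [k + l]. *)
Lemma aut_geig g a b x y : lie_aut br g ->
  geig g a x -> geig g b y -> geig g (a * b) (br x y).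
Proof.
case=> _ Hg [k xk] [l yl]; exists (k + l)%N.
move: {-1}(k + l)%N (leqnn (k + l)) => s; elim: s k l x y xk yl => [|s IH] k l x y xk yl.
  rewrite leqn0 addn_eq0 => /andP[/eqP k0 _]; move: xk.
  by rewrite k0 expr0 mulmx1 => ->; rewrite br0l mul0mx.
move=> kls; rewrite exprS -mulmxE mulmxA.
set x' := x *m (g - a%:M); set y' := y *m (g - b%:M).
have -> : br x y *m (g - (a * b)%:M) = br x' y' + b *: br x' y + a *: br x y'.
  rewrite /x' /y' !mulmxBr !mul_mx_scalar Hg !brBl !brBr !brZl !brZr.
  by apply/rowP => j; rewrite !mxE; ring.
case: k xk kls => [|k] xk kls.
  move: xk; rewrite expr0 mulmx1 /x' => ->.
  by rewrite mul0mx !br0l !scaler0 !addr0 mul0mx.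
case: l yl kls => [|l] yl kls.
  move: yl; rewrite expr0 mulmx1 /y' => ->.
  by rewrite mul0mx !br0r !scaler0 !addr0 mul0mx.
have xk' : x' *m (g - a%:M) ^+ k = 0 by move: xk; rewrite exprS -mulmxE mulmxA.
have yl' : y' *m (g - b%:M) ^+ l = 0 by move: yl; rewrite exprS -mulmxE mulmxA.
rewrite !mulmxDl -!scalemxAl (IH k l _ _ xk' yl') ?(IH k l.+1 _ _ xk' yl); try lia.
by rewrite (IH k.+1 l _ _ xk yl') ?scaler0 ?addr0 //; lia.
Qed.

(** With [op] equal to addition this applies to functions of a derivation, with multiplication to
    functions of an automorphism. Additivity of [phi] is asked only when the bracket is nonzero,
    that is when [op a b] really is an eigenvalue. *)
Lemma spectral_derivation (A F : 'M[C]_n) (phi : C -> C) (op : C -> C -> C) :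
  (forall a b x y, geig A a x -> geig A b y -> geig A (op a b) (br x y)) ->
  (forall a v, geig A a v -> v *m F = phi a *: v) ->
  (forall a b x y, geig A a x -> geig A b y -> br x y != 0 ->
     phi (op a b) = phi a + phi b) ->
  derivation F.
Proof.
move=> Aop AF phiD; apply/derivationP.
apply: (geig_ind (A := A)).
- by rewrite mul0mx ad0 mul0mx mulmx0 subr0.
- move=> a x y Hx Hy; rewrite mulmxDl -scalemxAl !adP Hx Hy mulmxDl mulmxDr.
  by rewrite -scalemxAl -scalemxAr scalerBr opprD addrACA.
move=> b y gy; apply/eqP; rewrite -subr_eq0; apply/eqP.
apply: (geig_mx0 (A := A)) => a x gx.
rewrite !mulmxBr !mulmxA !adE (AF _ _ gy) (AF _ _ gx) brZl brZr.
rewrite (AF _ _ (Aop _ _ _ _ gy gx)).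
have [->|xy0] := eqVneq (br y x) 0; first by rewrite !scaler0 !subr0.
by rewrite (phiD _ _ _ _ gy gx xy0) scalerDl addrK subrr.
Qed.

Definition kill x y := \tr (ad br x *m ad br y).

Lemma killC x y : kill x y = kill y x.
Proof. exact: mxtrace_mulC. Qed.

Lemma kill_br x y z : kill (br x y) z = kill x (br y z).
Proof.
rewrite /kill !ad_br mulmxBl mulmxBr !raddfB /= -!mulmxA; congr (_ - _).
by rewrite mxtrace_mulC -mulmxA.
Qed.

Lemma killP a x y z : kill (a *: x + y) z = a * kill x z + kill y z.
Proof. by rewrite /kill adP mulmxDl -scalemxAl linearD linearZ. Qed.

End Derivations.

Section Semisimple.
Variables (C : numClosedFieldType) (n : nat).
Variable br : 'rV[C]_n -> 'rV[C]_n -> 'rV[C]_n.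
Hypothesis ss : semisimple br.
Local Instance semisimple_lie : lie_algebra br := semisimple_lie_algebra ss.
Implicit Types (x y z v w : 'rV[C]_n) (D F : 'M[C]_n).

(** By Engel every nonzero term of the derived series strictly contains the next, so [n] steps reach
    0. *)
Lemma ad_nilpotent_solvable (J : 'M[C]_n) : lie_subalgebra br J ->
  (forall x, (x <= J)%MS -> ad br x ^+ n = 0) -> lie_solvable br J.
Proof.
move=> Jsub nil; exists n; pose D k := iter k (fun J => brspace br J J).
rewrite -/(D n J).
have DP k : [/\ (D k J <= J)%MS, lie_subalgebra br (D k J) & (\rank (D k J) <= n - k)%N].
  elim: k => [|k [DJ Dsub Dr]].
    by split; rewrite ?submx_refl ?subn0 ?rank_leq_col.
  have DS : (D k.+1 J <= D k J)%MS by apply: brspace_sub => x y; apply: Dsub.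
  split; first exact: submx_trans DS DJ.
    by move=> x y xD yD; apply: brspace_mem; apply: submx_trans DS.
  have [D0|Dn0] := eqVneq (D k J) 0.
    have : (D k.+1 J <= (0 : 'M[C]_n))%MS by rewrite -D0.
    by rewrite submx0 => /eqP ->; rewrite mxrank0.
  have [U [UD DU KU]] : exists U : 'M[C]_n, [/\ (U <= D k J)%MS, ~~ (D k J <= U)%MS
      & forall x, (x <= D k J)%MS -> (D k J *m ad br x <= U)%MS].
    apply: (engel_flag (N := 1%:M) (U := 0) Dsub); rewrite ?submx1 ?sub0mx ?submx0 //.
    - by move=> x xD; rewrite nil ?mulmx0 // (submx_trans xD).
    - by move=> x _; rewrite mul0mx sub0mx.
    - by apply: ad_stableP => x u; apply: Dsub.
  have DU' : (D k.+1 J <= U)%MS.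
    apply: brspace_sub => x y xD yD; rewrite -adE.
    exact: submx_trans (submxMr _ yD) (KU _ xD).
  have : (\rank U < \rank (D k J))%N.
    rewrite ltn_neqAle mxrankS // andbT; apply: contra DU => H.
    by rewrite -(mxrank_leqif_sup UD).
  have := mxrankS DU'; lia.
have [_ _] := DP n; rewrite subnn leqn0 mxrank_eq0 => /eqP ->.
by rewrite submx_refl.
Qed.

Lemma solvable_ideal0 (J : 'M[C]_n) : lie_ideal br J -> lie_solvable br J -> J = 0.
Proof.
by move=> Ji Js; case: ss => _ /(_ J Ji Js) /andP[+ _]; rewrite submx0 => /eqP.
Qed.

(* Cartan's criterion: if [x] is in [[S, g]], [S] the radical of the Killing form,
   let [F] act as the complex conjugate of the eigenvalue on each generalized
   eigenspace of [ad x]; [F] is a derivation with values in [S], and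
   [tr (ad x F) = sum |lambda|^2] vanishes. *)
Lemma kill_nondegenerate x : (forall y, kill br x y = 0) -> x = 0.
Proof.
have [S SP] : exists S : 'M[C]_n, forall v, (v <= S)%MS <-> forall y, kill br v y = 0.
  apply: subspace_mx; first by move=> y; rewrite /kill ad0 mul0mx raddf0.
  by move=> a u v Hu Hv y; rewrite killP Hu Hv mulr0 addr0.
have Sid : lie_ideal br S.
  move=> v y vS; rewrite brC eqmx_opp; apply/SP => z.
  by rewrite kill_br; move/SP: vS; apply.
pose J := brspace br S 1%:M.
have JS : (J <= S)%MS.
  by apply: brspace_sub => v y vS _; rewrite brC eqmx_opp Sid.
have Jid : lie_ideal br J.
  move=> v y vJ; rewrite brC eqmx_opp; apply: brspace_mem; last exact: submx1.
  exact: submx_trans JS.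
have Jnil v : (v <= J)%MS -> ad br v ^+ n = 0.
  move=> vJ; have vS := submx_trans vJ JS.
  have [F [Fact _ _ Fcomm FG]] := spectral_fun (ad br v) (fun a => a^*).
  have {FG} [|G _ FG] := FG; first exact: conjC0.
  have FD : derivation br F.
    apply: (spectral_derivation (op := +%R) _ Fact).
      move=> a b y z; apply: derivation_geig => y' z'.
      by rewrite !adE br_jacobi.
    by move=> a b y z _ _ _; rewrite rmorphD.
  have FS y : (y *m F <= S)%MS.
    by rewrite FG mulmxA adE brC eqmx_opp Sid.
  apply: (nilpotent_trace_conj Fact); first by rewrite Fcomm.
  have [U UP] : exists U : 'M[C]_n, forall z, (z <= U)%MS <-> \tr (ad br z *m F) = 0.
    apply: subspace_mx; first by rewrite ad0 mul0mx raddf0.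
    by move=> a y z Hy Hz; rewrite adP mulmxDl -scalemxAl linearD linearZ /= Hy Hz mulr0 addr0.
  apply/UP/(submx_trans vJ)/brspace_sub => a b aS _; apply/UP.
  have /derivationP/(_ b) FDb := FD.
  rewrite ad_br mulmxBl raddfB /= -!mulmxA mxtrace_mulC -mulmxA -raddfB -mulmxBr.
  rewrite -opprB -FDb mulmxN raddfN /=; move/SP: aS => /(_ (b *m F)).
  by rewrite /kill => ->; rewrite oppr0.
have J0 : J = 0.
  apply: solvable_ideal0 => //; apply: ad_nilpotent_solvable => // u v _; exact: Jid.
have S0 : S = 0.
  apply: solvable_ideal0 => //; exists 1%N; rewrite /= -[X in (_ == X)%MS]J0.
  rewrite brspaceS ?submx1 // J0; have : (brspace br S S <= J)%MS by rewrite brspaceS ?submx1.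
  by rewrite J0 submx0 => /eqP->; rewrite submx_refl.
by move=> /SP; rewrite S0 submx0 => /eqP.
Qed.

Lemma ad_inj x y : ad br x = ad br y -> x = y.
Proof.
move=> H; apply/eqP; rewrite -subr_eq0; apply/eqP/kill_nondegenerate => z.
by rewrite /kill adD adN H subrr mul0mx raddf0.
Qed.

Lemma kill_delta x y : (forall j, kill br x (delta_mx 0 j) = 0) -> kill br x y = 0.
Proof.
move=> H; rewrite killC [y]row_sum_delta.
elim/big_rec: _ => [|j v _ Hv]; first by rewrite /kill ad0 mul0mx raddf0.
by rewrite killP Hv killC H mulr0 addr0.
Qed.

(** Let [h] represent the form y -> tr (D ad y) with respect to the Killing form. Then E = D - ad h
    is trace-orthogonal to every ad y. As ad (x E) is the commutator of ad x and E, the Killing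
    product of x E with y is tr (E ad [x, y]) = 0, and x E vanishes. *)
Lemma derivation_inner D : derivation br D -> exists h, D = ad br h.
Proof.
move=> HD; pose M := \matrix_(i, j) kill br (delta_mx 0 i) (delta_mx 0 j).
have ME x j : (x *m M) 0 j = kill br x (delta_mx 0 j).
  rewrite mxE {2}[x]row_sum_delta; elim/big_rec2: _ => [|i u v _ IH].
    by rewrite /kill ad0 mul0mx raddf0.
  by rewrite killP -IH mxE.
have Mu : M \in unitmx.
  rewrite -row_free_unit -kermx_eq0; apply/rowV0P => v /sub_kermxP vM.
  apply: kill_nondegenerate => y; apply: kill_delta => j.
  by rewrite -ME vM mxE.
pose h := (\row_j \tr (D *m ad br (delta_mx 0 j))) *m invmx M.
exists h; apply/eqP; rewrite -subr_eq0; apply/eqP.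
set E := D - ad br h.
have Ed j : \tr (E *m ad br (delta_mx 0 j)) = 0.
  by rewrite mulmxBl raddfB /= -/(kill br h _) -ME mulmxKV // mxE subrr.
have E0 y : \tr (E *m ad br y) = 0.
  rewrite [y]row_sum_delta; elim/big_rec: _ => [|j v _ Hv].
    by rewrite ad0 mulmx0 raddf0.
  by rewrite adP mulmxDr -scalemxAr linearD linearZ /= Ed Hv mulr0 addr0.
have ED x : ad br (x *m E) = ad br x *m E - E *m ad br x.
  have /derivationP HDx := HD.
  by rewrite mulmxBr adE adD adN HDx ad_br mulmxBr mulmxBl !opprB addrACA [in RHS]addrACA
     [- _ + _]addrC.
apply/row_matrixP => i; rewrite row0 rowE; apply: kill_nondegenerate => y.
rewrite /kill ED mulmxBl raddfB /= mxtrace_mulC mulmxA mxtrace_mulC -!mulmxA -raddfB.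
by rewrite -mulmxBr -ad_br; exact: E0.
Qed.

End Semisimple.

(** * Existence of the semisimple pair *)

Section MultiplicativeLog.
Variable C : numClosedFieldType.

(* A linear form on the Q-span of formal logarithms of the elements of [s], modulo
   the multiplicative relations involving them and [t2]. *)
Lemma multiplicative_log (s : seq C) (t1 t2 : C) :
  uniq s -> 0 \notin s -> t1 \in s -> t2 \in s ->
  (forall N M : int, t1 ^ N * t2 ^ M = 1 -> N = 0) ->
  exists phi : C -> C, [/\ phi t1 = 1, phi t2 = 0
    & forall a b, a \in s -> b \in s -> a * b \in s -> phi (a * b) = phi a + phi b].
Proof.
move=> us s0 t1s t2s indep; pose m := size s.
have sn0 a : a \in s -> a != 0 by move=> as_; apply: contraNneq s0 => <-.
have nn0 (j : 'I_m) : s`_j != 0 by apply/sn0/mem_nth.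
pose d a : 'rV[rat]_m := \row_j (s`_j == a)%:R.
pose pw (u : 'I_m -> int) := \prod_(j < m) s`_j ^ u j.
(* Rational vectors with a nonzero integral multiple that is the exponent vector of a monomial in
   [s] equal to a power of [t2]. Allowing powers of [t2] makes the form vanish at [t2]. *)
pose P (v : 'rV[rat]_m) := exists (N : int) (u : 'I_m -> int) (M : int),
  [/\ N != 0, forall j, N%:~R * v 0 j = (u j)%:~R & pw u * t2 ^ M = 1].
have t2n0 := sn0 _ t2s.
have pwD u v : pw (fun j => u j + v j) = pw u * pw v.
  by rewrite /pw -big_split /=; apply: eq_bigr => j _; rewrite expfzDr.
have pwM u k : pw (fun j => u j * k) = pw u ^ k.
  rewrite /pw; elim/big_rec2: _ => [|j x y _ ->]; first by rewrite exp1rz.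
  by rewrite expfzMl exprz_exp.
have pwd a : a \in s -> pw (fun j => (s`_j == a)%:R) = a.
  move=> as_; have ia : (index a s < m)%N by rewrite index_mem.
  rewrite /pw (bigD1 (Ordinal ia)) //= nth_index // eqxx expr1z big1 ?mulr1 // => j ja.
  suff /negbTE-> : s`_j != a by rewrite expr0z.
  apply: contra ja => /eqP sa; apply/eqP/val_inj => /=.
  by rewrite -sa index_uniq.
have [S SP] : exists S : 'M[rat]_m, forall v, (v <= S)%MS <-> P v.
  apply: subspace_mx.
    exists 1, (fun=> 0), 0; split=> // [j|]; first by rewrite mxE mulr0.
    by rewrite /pw big1 ?mulr1.
  move=> a x y [N [u [M [N0 Nu pu]]]] [N' [u' [M' [N'0 Nu' pu']]]].
  exists (denq a * N * N'), (fun j => u j * (numq a * N') + u' j * (denq a * N)).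
  exists (M * (numq a * N') + M' * (denq a * N)); split.
  - by rewrite !mulf_neq0 ?denq_neq0.
  - move=> j; rewrite !mxE !rmorphD !rmorphM /= -Nu -Nu' -[a in a * x 0 j]divq_num_den.
    have : (denq a)%:~R != 0 :> rat by rewrite intr_eq0 denq_neq0.
    by move=> dn0; field.
  - rewrite pwD !pwM expfzDr //.
    by rewrite mulrACA -!exprz_exp -!expfzMl pu pu' !exp1rz mulr1.
have dS a b : a \in s -> b \in s -> a * b \in s -> (d (a * b)%R - d a - d b <= S)%MS.
  move=> as_ bs abs; apply/SP; exists 1, (fun j => (s`_j == (a * b)%R)%:R + (s`_j == a)%:R * (-1) + (s`_j == b)%:R * (-1)), 0.
  split=> // [j|]; first by rewrite !mxE mul1r !rmorphD !rmorphM /= !mulrN1 !natz.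
  rewrite !pwD !pwM !pwd // mulr1 exprN1 -mulrA -invfM mulfV // mulf_neq0 ?sn0 //.
have t2S : (d t2 <= S)%MS.
  apply/SP; exists 1, (fun j => (s`_j == t2)%:R), (-1); split=> // [j|].
    by rewrite !mxE mul1r natz.
  by rewrite pwd // exprN1 mulfV.
have t1S : ~~ (d t1 <= S)%MS.
  apply/negP => /SP[N [u [M [N0 Nu pu]]]].
  have uE j : u j = (s`_j == t1)%:R * N.
    apply: (intr_inj (R := rat)); rewrite -Nu mxE rmorphM /= mulrC.
    by case: (_ == _).
  have : t1 ^ N * t2 ^ M = 1.
    rewrite -pu; congr (_ * _); rewrite -[in LHS](pwd t1) // -pwM /pw.
    by apply: eq_bigr => j _; rewrite -uE.
  by move/indep/eqP; rewrite (negbTE N0).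
(* A coordinate of the quotient by [S] not vanishing at [d t1]; normalized there, it is the required
   form. *)
have [j tj] : exists j, (d t1 *m cokermx S) 0 j != 0.
  apply/existsP; rewrite -negb_forall; apply: contra t1S => /forallP H.
  by rewrite submxE; apply/eqP/rowP => j; rewrite [RHS]mxE; apply/eqP.
pose psi a := (d a *m cokermx S) 0 j / (d t1 *m cokermx S) 0 j.
exists (fun a => ratr (psi a)); split.
- by rewrite /psi divff ?rmorph1.
- rewrite /psi; move: t2S; rewrite submxE => /eqP->.
  by rewrite mxE mul0r rmorph0.
- move=> a b as_ bs abs; rewrite -rmorphD /psi; congr ratr.
  have := dS a b as_ bs abs; rewrite submxE !mulmxBl => /eqP/rowP/(_ j).
  rewrite !mxE => H; rewrite -mulrDl; congr (_ / _).
  by apply/eqP; rewrite -subr_eq0 opprD addrA H.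
Qed.

(** Comparison of [p]-adic valuations; the four sign cases are each rewritten as an equality of
    natural numbers. *)
Lemma prime_powers_indep (p q : nat) (N M : int) : prime p -> prime q -> p != q ->
  (p%:R : C) ^ N * q%:R ^ M = 1 -> N = 0.
Proof.
move=> pp pq pNq.
have lq b : logn p (q ^ b) = 0%N by rewrite lognX logn_prime // (negbTE pNq) muln0.
have lp a : logn p (p ^ a) = a by rewrite pfactorK.
have pn0 a : (p%:R : C) ^+ a != 0 by rewrite expf_neq0 // pnatr_eq0 -lt0n prime_gt0.
have qn0 a : (q%:R : C) ^+ a != 0 by rewrite expf_neq0 // pnatr_eq0 -lt0n prime_gt0.
have pq0 a b : (0 < p ^ a)%N /\ (0 < q ^ b)%N by rewrite !expn_gt0 !prime_gt0.
have main a b : (p ^ a * q ^ b = 1 \/ p ^ a = q ^ b)%N -> a = 0%N.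
  have [pa qb] := pq0 a b; case=> /(congr1 (logn p)).
    by rewrite lognM // lp lq addn0 logn1.
  by rewrite lp lq.
case: N => a; case: M => b /eqP.
- rewrite -!exprnP -!natrX -natrM (eqr_nat _ _ 1) => /eqP H.
  by rewrite (main a b) //; left.
- rewrite NegzE -exprnN -exprnP -[X in _ == X](mulfV (qn0 b.+1)).
  rewrite (inj_eq (mulIf _)) ?invr_eq0 // -!natrX eqr_nat => /eqP H.
  by rewrite (main a b.+1) //; right.
- rewrite NegzE -exprnN -exprnP mulrC -[X in _ == X](mulfV (pn0 a.+1)).
  rewrite (inj_eq (mulIf _)) ?invr_eq0 // -!natrX eqr_nat => /eqP H.
  by have := main a.+1 b (or_intror (esym H)).
- rewrite !NegzE -!exprnN -invfM invr_eq1 -!natrX -natrM (eqr_nat _ _ 1) => /eqP H.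
  by have := main a.+1 b.+1 (or_introl H).
Qed.

End MultiplicativeLog.

Section Existence.
Variables (C : numClosedFieldType) (n : nat).
Variable br : 'rV[C]_n -> 'rV[C]_n -> 'rV[C]_n.
Hypothesis ss : semisimple br.
Local Instance existence_lie : lie_algebra br := semisimple_lie_algebra ss.

Lemma eigenvalues_seq (A : 'M[C]_n) : exists s : seq C, forall a, (a \in s) = eigenvalue A a.
Proof.
case: n A => [|n'] A.
  exists [::] => a; rewrite in_nil; apply/esym/negbTE/negP => /eigenvalueP[v _].
  by rewrite (thinmx0 v) eqxx.
have [rs chiE] := closed_field_poly_normal (char_poly A).
rewrite (monicP (char_poly_monic A)) scale1r in chiE.
by exists rs => a; rewrite eigenvalue_root_char chiE root_prod_XsubC.
Qed.

Lemma pair_from_aut e1 e2 g : lie_aut br g ->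
  e1 *m g = 2%:R *: e1 -> e2 *m g = 3%:R *: e2 ->
  exists h1 h2, [/\ ss_element br h1, ss_element br h2 & pair_relations br e1 e2 h1 h2].
Proof.
move=> gaut ge1 ge2; have [rs rsP] := eigenvalues_seq g.
(* 2 and 3 are adjoined by hand: if [e1] or [e2] is 0, the corresponding scalar need not be an
   eigenvalue of [g]. *)
pose s := undup ([:: 2%:R; 3%:R] ++ rs).
have s0 : 0 \notin s.
  rewrite mem_undup mem_cat negb_or !inE negb_or ![0 == _]eq_sym !pnatr_eq0 /= rsP.
  apply/negP => /eigenvalueP[v vg]; rewrite -(mulmxK gaut.1 v) vg scale0r mul0mx.
  by rewrite eqxx.
have s2 : 2%:R \in s by rewrite mem_undup inE eqxx.
have s3 : 3%:R \in s by rewrite mem_undup !inE eqxx orbT.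
have ind23 N M : (2%:R : C) ^ N * 3%:R ^ M = 1 -> N = 0 by apply: prime_powers_indep.
have ind32 N M : (3%:R : C) ^ N * 2%:R ^ M = 1 -> N = 0 by apply: prime_powers_indep.
have [phi1 [p12 p13 p1D]] := multiplicative_log (undup_uniq _) s0 s2 s3 ind23.
have [phi2 [p23 p22 p2D]] := multiplicative_log (undup_uniq _) s0 s3 s2 ind32.
have gs a v : geig g a v -> v != 0 -> a \in s.
  move=> gv vn0; have [w wn0 wA] := geig_eigenvector gv vn0.
  by rewrite mem_undup mem_cat rsP orbC; apply/orP; left; apply/eigenvalueP; exists w.
have gop a b x y := @aut_geig _ _ br existence_lie g a b x y gaut.
have phiD (phi : C -> C) :
    (forall a b, a \in s -> b \in s -> a * b \in s -> phi (a * b) = phi a + phi b) ->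
    forall a b x y, geig g a x -> geig g b y -> br x y != 0 -> phi (a * b) = phi a + phi b.
  move=> H a b x y gx gy xy0; apply: H; last exact: gs (gop _ _ _ _ gx gy) xy0.
    by apply: gs gx _; apply: contraNneq xy0 => ->; rewrite br0l.
  by apply: gs gy _; apply: contraNneq xy0 => ->; rewrite br0r.
have [F1 [F1act F1diag _ F1comm _]] := spectral_fun g phi1.
have [F2 [F2act F2diag _ F2comm _]] := spectral_fun g phi2.
have F1D := spectral_derivation (Hlie := existence_lie) gop F1act (phiD _ p1D).
have F2D := spectral_derivation (Hlie := existence_lie) gop F2act (phiD _ p2D).
have [h1 h1E] := derivation_inner ss F1D; have [h2 h2E] := derivation_inner ss F2D.
have ge a e : e *m g = a *: e -> geig g a e.
  by move=> ea; exists 1%N; rewrite expr1 mulmxBr ea mul_mx_scalar subrr.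
have e1g := ge _ _ ge1; have e2g := ge _ _ ge2.
exists h1, h2; split; rewrite /ss_element -?h1E -?h2E //; split.
- by rewrite -adE -h1E (F1act _ _ e1g) p12 scale1r.
- by rewrite -adE -h1E (F1act _ _ e2g) p13 scale0r.
- by rewrite -adE -h2E (F2act _ _ e1g) p22 scale0r.
- by rewrite -adE -h2E (F2act _ _ e2g) p23 scale1r.
(* [F1] and [F2] commute, both being functions of [g], and [ad] is injective. *)
apply: (ad_inj ss); rewrite ad_br ad0 -h1E -h2E F1comm ?subrr //.
by rewrite F2comm.
Qed.

End Existence.

(** * Polynomial families of matrices *)

Section PolyMatrices.
Variable C : numClosedFieldType.

Definition evalmx m p (t : C) (Q : 'M[{poly C}]_(m, p)) : 'M[C]_(m, p) :=
  map_mx (horner_eval t) Q.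
Definition constmx m p (A : 'M[C]_(m, p)) : 'M[{poly C}]_(m, p) := map_mx polyC A.

Lemma evalmxM m p q t (A : 'M[{poly C}]_(m, p)) (B : 'M_(p, q)) :
  evalmx t (A *m B) = evalmx t A *m evalmx t B.
Proof. exact: map_mxM. Qed.

Lemma evalmxD m p t (A B : 'M[{poly C}]_(m, p)) :
  evalmx t (A + B) = evalmx t A + evalmx t B.
Proof. exact: map_mxD. Qed.

Lemma evalmxZ m p t a (A : 'M[{poly C}]_(m, p)) : evalmx t (a *: A) = a.[t] *: evalmx t A.
Proof. exact: map_mxZ. Qed.

Lemma evalmxX n t (A : 'M[{poly C}]_n) k : evalmx t (A ^+ k) = evalmx t A ^+ k.
Proof.
elim: k => [|k IH]; first by rewrite !expr0 /evalmx map_mx1.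
by rewrite !exprS -!mulmxE evalmxM IH.
Qed.

Lemma evalmx_const m p t (A : 'M[C]_(m, p)) : evalmx t (constmx A) = A.
Proof. by apply/matrixP => i j; rewrite !mxE /horner_eval hornerC. Qed.

Lemma evalmx_sum m p t (I : Type) (r : seq I) (P : pred I) (F : I -> 'M[{poly C}]_(m, p)) :
  evalmx t (\sum_(i <- r | P i) F i) = \sum_(i <- r | P i) evalmx t (F i).
Proof. exact: raddf_sum. Qed.

Lemma poly_fun0 (p : {poly C}) : (forall t, p.[t] = 0) -> p = 0.
Proof.
move=> Hp; apply/eqP/negP => /negP pn0.
pose rs : seq C := [seq k%:R | k <- iota 0 (size p)].
have urs : uniq rs.
  by rewrite map_inj_uniq ?iota_uniq // => i j /eqP; rewrite eqr_nat => /eqP.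
have := max_poly_roots pn0 _ urs; rewrite size_map size_iota ltnn => H.
by apply: notF; apply: H; apply/allP => t _; apply/eqP.
Qed.

Lemma polymx_fun0 m q (Q : 'M[{poly C}]_(m, q)) (p : {poly C}) : p != 0 ->
  (forall t, p.[t] != 0 -> evalmx t Q = 0) -> Q = 0.
Proof.
move=> pn0 H; apply/matrixP => i j; rewrite mxE; apply/eqP.
suff : Q i j * p = 0 by move/eqP; rewrite mulf_eq0 (negbTE pn0) orbF.
apply: poly_fun0 => t; rewrite hornerM.
have [->|/H/matrixP/(_ i j)] := eqVneq p.[t] 0; first by rewrite mulr0.
by rewrite !mxE /horner_eval => ->; rewrite mul0r.
Qed.

Lemma polymx_ext m q (Q Q' : 'M[{poly C}]_(m, q)) :
  (forall t, evalmx t Q = evalmx t Q') -> Q = Q'.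
Proof.
move=> H; apply/eqP; rewrite -subr_eq0; apply/eqP.
apply: (@polymx_fun0 _ _ _ 1); first exact: oner_neq0.
by move=> t _; rewrite evalmxD /evalmx map_mxN -/(evalmx t _) -/(evalmx t _) H subrr.
Qed.

(** Semicontinuity of the rank: constant matrices [L] and [R] reduce the value at 0 to an identity
    matrix, and [p] is the determinant of [L *m Q *m R], equal to 1 at 0. *)
Lemma polymx_rank m q (Q : 'M[{poly C}]_(m, q)) : exists2 p : {poly C}, p != 0
  & forall t, p.[t] != 0 -> (\rank (evalmx 0 Q) <= \rank (evalmx t Q))%N.
Proof.
set A := evalmx 0 Q; set r := \rank A.
pose L : 'M_(r, m) := pid_mx r *m invmx (col_ebase A).
pose R : 'M_(q, r) := invmx (row_ebase A) *m pid_mx r.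
have LAR : L *m A *m R = 1%:M.
  rewrite -{1}(mulmx_ebase A) /L /R -!mulmxA (mulmxA (row_ebase A)).
  rewrite mulmxV ?row_ebase_unit // mul1mx (mulmxA (invmx _)) mulVmx ?col_ebase_unit //.
  by rewrite mul1mx -/r !pid_mx_id ?rank_leq_row ?rank_leq_col ?pid_mx_1.
pose p := \det (constmx L *m Q *m constmx R).
have pE t : p.[t] = \det (L *m evalmx t Q *m R).
  rewrite -[LHS]/(horner_eval t p) /p -det_map_mx -/(evalmx t _) !evalmxM.
  by rewrite !evalmx_const.
exists p.
  by apply/eqP => p0; have := pE 0; rewrite p0 horner0 LAR det1 => /esym/eqP; rewrite oner_eq0.
move=> t; rewrite pE -unitfE -[_ \is a _]/(_ \in unitmx) -row_free_unit => /eqP <-.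
by apply: leq_trans (mxrankM_maxl _ _) (mxrankM_maxr _ _).
Qed.

(** For generic t, (A + t B)^n has rank n - rk M modulo [M], as at t = 0; this is also the largest
    rank allowed by the hypothesis. Its image therefore meets [M] trivially, and since [M] is
    stable, (A + t B)^n kills [M]. The coefficient of t^n is the claim. *)
Lemma pencil_nilpotent n (A B M : 'M[C]_n) :
  (M == kermx (A ^+ n))%MS -> (M *m B <= M)%MS ->
  (forall t, (\rank M <= \rank (kermx ((A + t *: B) ^+ n)))%N) ->
  M *m B ^+ n = 0.
Proof.
move=> /andP[Mker kerM] MB rkM.
have MA : (M *m A <= M)%MS.
  apply: submx_trans kerM; apply/sub_kermxP.
  rewrite -mulmxA mulmxE -exprS exprSr -mulmxE mulmxA.
  by have /sub_kermxP -> := Mker; rewrite mul0mx.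
have stab t k : (M *m (A + t *: B) ^+ k <= M)%MS.
  elim: k => [|k IH]; first by rewrite expr0 mulmx1.
  rewrite exprSr -mulmxE mulmxA; apply: submx_trans (submxMr _ IH) _.
  by rewrite mulmxDr addmx_sub // -scalemxAr scalemx_sub.
pose Q := (constmx A + 'X *: constmx B) ^+ n.
have QE t : evalmx t Q = (A + t *: B) ^+ n.
  by rewrite evalmxX evalmxD evalmxZ !evalmx_const hornerX.
have [p pn0 pP] := polymx_rank (constmx (M^C)%MS *m Q *m constmx (cokermx M)).
have E0 t : p.[t] != 0 -> M *m (A + t *: B) ^+ n = 0.
  move=> /pP; rewrite !evalmxM !evalmx_const !QE scale0r addr0.
  set X := (M^C)%MS *m (A + t *: B) ^+ n.
  have -> : \rank ((M^C)%MS *m A ^+ n *m cokermx M) = (n - \rank M)%N.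
    rewrite -mulmxA -mxrank_compl; apply/mxrank_injP.
    rewrite -submx0; apply/rV_subP => v; rewrite sub_capmx => /andP[vC].
    move=> /sub_kermxP vA; have : (v *m A ^+ n <= M)%MS by rewrite submxE -mulmxA vA.
    move=> /submx_trans/(_ Mker)/sub_kermxP; rewrite -mulmxA mulmxE -exprD => vA2.
    have gv : geig A 0 v by exists (n + n)%N; rewrite raddf0 subr0.
    have /geig_index := gv; rewrite raddf0 subr0 => /sub_kermxP /submx_trans/(_ kerM) vM.
    by rewrite -(capmx_compl M) sub_capmx vM.
  move=> rX; have rC : (\rank ((A + t *: B) ^+ n) <= n - \rank M)%N.
    have := rkM t; rewrite mxrank_ker; have := rank_leq_row ((A + t *: B) ^+ n).
    by move: (\rank M) (\rank ((A + t *: B) ^+ n)) => a b; lia.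
  have XC : (X <= (A + t *: B) ^+ n)%MS by apply: submxMl.
  have rXX : (\rank (X *m cokermx M) <= \rank X)%N by apply: mxrankM_maxl.
  have CX : ((A + t *: B) ^+ n <= X)%MS.
    by rewrite -(mxrank_leqif_sup XC) eqn_leq mxrankS //= (leq_trans rC) // (leq_trans rX).
  have XM : (X :&: M = 0)%MS.
    have /mxrank_injP : \rank (X *m cokermx M) = \rank X.
      by apply/eqP; rewrite eqn_leq rXX /= (leq_trans _ rX) // (leq_trans (mxrankS XC)).
    move/eqP=> XK; apply/eqP; rewrite -submx0 -XK; apply: capmxS; rewrite ?submx_refl //.
    by apply/sub_kermxP; apply: mulmx_coker.
  apply/eqP; rewrite -submx0 -XM sub_capmx stab andbT.
  by apply: submx_trans CX; apply: submxMl.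
have Q0 : constmx M *m Q = 0.
  apply: (polymx_fun0 pn0) => t pt; rewrite evalmxM evalmx_const QE; exact: E0.
have Q't t : evalmx t (constmx M *m Q) = 0 by rewrite Q0 /evalmx map_mx0.
(* Replacing t by 1/t turns the leading coefficient [M *m B ^+ n] into the value at 0. *)
pose Q' := constmx M *m ('X *: constmx A + constmx B) ^+ n.
have Q'0 : Q' = 0.
  apply: (@polymx_fun0 _ _ _ 'X); first by rewrite polyX_eq0.
  move=> t; rewrite hornerX => tn0.
  rewrite evalmxM evalmxX evalmxD evalmxZ !evalmx_const hornerX.
  have -> : t *: A + B = t *: (A + t^-1 *: B) by rewrite scalerDr scalerA divff // scale1r.
  have := Q't t^-1; rewrite evalmxM evalmx_const QE => H.
  suff -> k : (t *: (A + t^-1 *: B)) ^+ k = t ^+ k *: (A + t^-1 *: B) ^+ k.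
    by rewrite -scalemxAr H scaler0.
  elim: k => [|k IH]; first by rewrite !expr0 scale1r.
  by rewrite !exprS -!mulmxE IH -scalemxAl -scalemxAr scalerA.
have : evalmx 0 Q' = 0 by rewrite Q'0 /evalmx map_mx0.
by rewrite evalmxM evalmxX evalmxD evalmxZ !evalmx_const hornerX scale0r add0r.
Qed.

Lemma char_poly_horner n (A : 'M[C]_n) t : (char_poly A).[t] = \det (t%:M - A).
Proof.
rewrite -[LHS]/(horner_eval t _) /char_poly -det_map_mx; congr (\det _).
apply/matrixP => i j; rewrite !mxE rmorphB rmorphMn /= /horner_eval hornerX.
by rewrite hornerC.
Qed.

Lemma char_poly_nilpotent n (A : 'M[C]_n) k : A ^+ k = 0 -> char_poly A = 'X^n.
Proof.
move=> Ak; have [rs chiE] := closed_field_poly_normal (char_poly A).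
rewrite (monicP (char_poly_monic A)) scale1r in chiE.
have rs0 : all (pred1 0) rs.
  apply/allP => a ars /=.
  have: eigenvalue A a by rewrite eigenvalue_root_char chiE root_prod_XsubC.
  case/eigenvalueP => v vA vn0.
  have := eigenvector_exp k vA; rewrite Ak mulmx0 => /esym/eqP; rewrite scaler_eq0 (negbTE vn0) orbF.
  by rewrite expf_eq0 => /andP[_].
have {}rs0 : rs = nseq (size rs) 0 by apply/all_pred1P.
have sz : size rs = n.
  by have := size_char_poly A; rewrite chiE size_prod_XsubC => -[].
by rewrite chiE rs0 big_nseq subr0 iter_mulr_1 sz.
Qed.

Lemma det_1_sub_nilpotent n (A : 'M[C]_n) k : A ^+ k = 0 -> \det (1%:M - A) = 1.
Proof. by move=> Ak; rewrite -char_poly_horner (char_poly_nilpotent Ak) hornerXn expr1n. Qed.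

Lemma full_factor_idempotent n d (c : 'M[C]_(n, d)) (r : 'M[C]_(d, n)) :
  row_full c -> row_free r -> (c *m r) *m (c *m r) = c *m r -> r *m c = 1%:M.
Proof.
move=> cf rf H; apply: (row_full_inj cf); apply: (row_free_inj rf).
by rewrite /= mulmx1 -[RHS]H !mulmxA.
Qed.

Lemma idempotent_mxtrace n (F : 'M[C]_n) : F *m F = F -> \tr F = (\rank F)%:R.
Proof.
move=> F2; rewrite -{1}(mulmx_base F) mxtrace_mulC full_factor_idempotent ?mxtrace1 //.
- exact: col_base_full.
- exact: row_base_free.
by rewrite mulmx_base.
Qed.

(* [F] projects onto the generalized kernel: [t - A] is the commuting product of
   [t F + (1 - F)], [1 - t^-1 A F] and [F + (t - A) (1 - F)]. *)
Lemma char_poly_geig0 n (A : 'M[C]_n) : exists2 q : {poly C}, q.[0] != 0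
  & char_poly A = 'X^(\rank (kermx (A ^+ n))) * q.
Proof.
have [F [Fact Fdiag Feig Fcomm _]] := spectral_fun A (fun a => (a == 0)%:R).
set d := \rank _.
have FA : F *m A = A *m F by apply: Fcomm.
have F2 : F *m F = F.
  apply/eqP; rewrite -subr_eq0; apply/eqP; apply: (geig_mx0 (A := A)) => a v gv.
  rewrite mulmxBr mulmxA !(Fact _ _ gv) -scalemxAl (Fact _ _ gv).
  by case: eqP; rewrite ?scale1r ?scale0r subrr.
have FAn : F *m A ^+ n = 0.
  apply: (geig_mx0 (A := A)) => a v gv; rewrite mulmxA (Fact _ _ gv) -scalemxAl.
  have [a0|_] := eqVneq a 0; last by rewrite scale0r.
  by have := geig_index gv; rewrite a0 raddf0 subr0 => ->; rewrite scaler0.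
have rF : \rank F = d.
  apply/eqP; rewrite eqn_leq mxrankS; last exact/sub_kermxP.
  suff kF : (kermx (A ^+ n) <= F)%MS by rewrite mxrankS.
  apply/rV_subP => v /sub_kermxP vA; have gv : geig A 0 v by exists n; rewrite raddf0 subr0.
  by have := Fact _ _ gv; rewrite eqxx scale1r => <-; apply: submxMl.
have detF t : \det (t *: F + (1%:M - F)) = t ^+ d.
  have [P [e [Pu PF]]] := diagonalizable_rows Fdiag.
  have e01 i : e 0 i = 0 \/ e 0 i = 1.
    have [|a _ ->] := Feig (e 0 i); last by case: eqP; [right | left].
    apply/eigenvalueP; exists (row i P).
      by rewrite -row_mul PF row_mul row_diag_mx -scalemxAl -rowE.
    apply/eqP => Pi0; have /rowP/(_ i) : row i (P *m invmx P) = 0.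
      by rewrite row_mul Pi0 mul0mx.
    by rewrite mulmxV // !mxE eqxx => /eqP; rewrite oner_eq0.
  have FE : F = invmx P *m (diag_mx e *m P) by rewrite -PF mulKmx.
  pose e' := \row_i (t * e 0 i + (1 - e 0 i)).
  have PL : P *m (t *: F + (1%:M - F)) = diag_mx e' *m P.
    rewrite mulmxDr -scalemxAr mulmxBr mulmx1 PF !mul_diag_mx.
    by apply/matrixP => i j; rewrite !mxE; ring.
  have -> : t *: F + (1%:M - F) = invmx P *m (diag_mx e' *m P) by rewrite -PL mulKmx.
  rewrite !det_mulmx mulrCA -det_mulmx mulVmx // det1 mulr1 det_diag.
  have -> : d = (\sum_i (e 0%R i != 0%R))%N.
    apply/eqP; rewrite -rF -(eqr_nat C); apply/eqP; rewrite -(idempotent_mxtrace F2).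
    rewrite FE mxtrace_mulC mulmxK // mxtrace_diag natr_sum; apply: eq_bigr => i _.
    by case: (e01 i) => ->; rewrite ?eqxx ?oner_eq0.
  rewrite -prodrXr; apply: eq_bigr => i _; rewrite mxE.
  by case: (e01 i) => ->; rewrite ?eqxx ?oner_eq0 /= ?mulr0 ?mulr1 ?subr0 ?subrr ?add0r ?addr0.
pose g := \det (constmx F + ('X%:M - constmx A) *m constmx (1%:M - F)).
have gE t : g.[t] = \det (F + (t%:M - A) *m (1%:M - F)).
  rewrite -[LHS]/(horner_eval t g) /g -det_map_mx -/(evalmx t _) evalmxD evalmxM.
  rewrite !evalmx_const; congr (\det (_ + _ *m _)).
  apply/matrixP => i j; rewrite !mxE rmorphB rmorphMn /= /horner_eval hornerX.
  by rewrite hornerC.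
exists g.
  rewrite gE -unitfE -[_ \is a _]/(_ \in unitmx) -row_free_unit -kermx_eq0.
  apply/rowV0P => v /sub_kermxP; rewrite raddf0 sub0r => vE.
  have vF : v *m F = 0.
    have := congr1 (mulmx^~ F) vE; rewrite mul0mx -mulmxA mulmxDl F2 -mulmxA mulmxBl.
    by rewrite mul1mx F2 subrr mulmx0 addr0.
  have vA : v *m A = 0.
    move: vE; rewrite mulmxDr vF add0r mulNmx mulmxN mulmxBr mulmx1.
    rewrite mulmxBr -FA !mulmxA vF mul0mx subr0.
    by move/eqP; rewrite oppr_eq0 => /eqP.
  have gv : geig A 0 v by exists 1%N; rewrite raddf0 subr0 expr1.
  by have := Fact _ _ gv; rewrite vF eqxx scale1r.
apply/eqP; rewrite -subr_eq0; apply/eqP.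
suff : (char_poly A - 'X^d * g) * 'X = 0.
  by move/eqP; rewrite mulf_eq0 polyX_eq0 orbF => /eqP.
apply: poly_fun0 => t; rewrite hornerM hornerX.
have [->|tn0] := eqVneq t 0; first by rewrite mulr0.
rewrite hornerD hornerN hornerM hornerXn char_poly_horner gE -detF.
have nilAF : (t^-1 *: (A *m F)) ^+ n = 0.
  have pk k : (t^-1 *: (A *m F)) ^+ k *m F = t^-1 ^+ k *: (F *m A ^+ k).
    elim: k => [|k IH]; first by rewrite !expr0 mul1mx mulmx1 scale1r.
    rewrite exprS -mulmxE -mulmxA IH -scalemxAl -scalemxAr scalerA -exprS.
    by rewrite -mulmxA (mulmxA F) F2 [A ^+ k.+1]exprS -mulmxE !mulmxA FA.
  have [n0|n1] := posnP n; first by apply/matrixP => i; have := ltn_ord i; rewrite {2}n0.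
  have kF k : (0 < k)%N -> (t^-1 *: (A *m F)) ^+ k *m F = (t^-1 *: (A *m F)) ^+ k.
    by case: k => // k _; rewrite exprSr -mulmxE -mulmxA -scalemxAl -mulmxA F2.
  by rewrite -kF // pk FAn scaler0.
pose B := A *m F; pose G : 'M[C]_n := 1%:M - F.
have FB : F *m B = B by rewrite /B mulmxA FA -mulmxA F2.
have BF : B *m F = B by rewrite /B -mulmxA F2.
have FG : F *m G = 0 by rewrite mulmxBr mulmx1 F2 subrr.
have GF : G *m F = 0 by rewrite mulmxBl mul1mx F2 subrr.
have GG : G *m G = G by rewrite {2}/G mulmxBr mulmx1 GF subr0.
have BG : B *m G = 0 by rewrite /B -mulmxA FG mulmx0.
have GA : (t%:M - A) *m G = G *m (t%:M - A).
  have AG : A *m G = G *m A by rewrite /G mulmxBr mulmxBl mulmx1 mul1mx FA.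
  by rewrite mulmxBl [RHS]mulmxBr scalar_mxC AG.
have TA : t%:M - A = (t *: F + G) *m (1%:M - t^-1 *: B) *m (F + (t%:M - A) *m G).
  have -> : (t *: F + G) *m (1%:M - t^-1 *: B) = t *: F + G - B.
    rewrite mulmxBr mulmx1 -scalemxAr mulmxDl -scalemxAl FB /G mulmxBl mul1mx FB.
    by rewrite subrr addr0 scalerA mulVf // scale1r.
  have XF : (t *: F + G - B) *m F = t *: F - B.
    by rewrite mulmxBl (mulmxDl (t *: F) G) -scalemxAl F2 GF BF addr0.
  have XG : (t *: F + G - B) *m G = G.
    by rewrite (mulmxBl (t *: F + G)) (mulmxDl (t *: F) G) -scalemxAl FG GG BG scaler0 add0r subr0.
  rewrite GA mulmxDr mulmxA XF XG /G mulmxBl mul1mx mulmxBr FA -/B.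
  by rewrite mul_mx_scalar; apply/matrixP => i j; rewrite !mxE; ring.
rewrite -/G {1}TA !det_mulmx (det_1_sub_nilpotent nilAF) mulr1.
by rewrite subrr mul0r.
Qed.

End PolyMatrices.

(** * Cartan subalgebras have minimal Engel rank *)

Section TruncatedExp.

Lemma sum_triangle (V : zmodType) N (F : nat -> nat -> V) :
  \sum_(i < N) \sum_(j < N) F j i =
  \sum_(m < N) \sum_(i < m.+1) F (m - i)%N i +
  \sum_(i < N) \sum_(j < N | (N <= i + j)%N) F j i.
Proof.
have -> : \sum_(m < N) \sum_(i < m.+1) F (m - i)%N i =
    \sum_(i < N) \sum_(j < N - i) F j i.
  elim: N => [|N IH]; first by rewrite !big_ord0.
  rewrite big_ord_recr /= IH [RHS]big_ord_recr /= subSnn big_ord1.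
  rewrite [in LHS]big_ord_recr /= subnn addrA; congr (_ + _).
  rewrite -big_split /=; apply: eq_bigr => i _.
  by rewrite subSn ?big_ord_recr // ltnW.
rewrite -big_split /=; apply: eq_bigr => i _.
rewrite (bigID (fun j : 'I_N => (j < N - i)%N)) /= (big_ord_widen N (fun j => F j i) (leq_subr i N)).
by congr (_ + _); apply: eq_bigl => j; rewrite ltn_subRL -leqNgt.
Qed.

(* [A] is meant to be a polynomial ring, hence the explicit inverse factorials. *)
Variables (A : comNzRingType) (n : nat).
Variable Ad : 'rV[A]_n -> 'M[A]_n.
Hypothesis Adlin : forall a x y, Ad (a *: x + y) = a *: Ad x + Ad y.
Variable inv : nat -> A.
Hypothesis invP : forall j, inv j * (j`!)%:R = 1.

Definition texp N (D : 'M[A]_n) := \sum_(j < N) inv j *: D ^+ j.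

Lemma Ad_sum N (c : 'I_N -> A) (v : 'I_N -> 'rV[A]_n) :
  Ad (\sum_i c i *: v i) = \sum_i c i *: Ad (v i).
Proof.
have Ad0 : Ad 0 = 0.
  by have := Adlin (-1) 0 0; rewrite scaleN1r oppr0 addr0 scaleN1r addNr.
elim/big_rec2: _ => [|i x y _ <-]; first exact: Ad0.
by rewrite Adlin.
Qed.

Lemma inv_bin m i : (i <= m)%N -> inv m * ('C(m, i))%:R = inv (m - i) * inv i.
Proof.
move=> im; have := bin_fact im => /(congr1 (fun k => k%:R : A)); rewrite !natrM => binE.
have := invP m; rewrite -binE; have := invP i; have := invP (m - i).
move: (inv m) (inv i) (inv (m - i)) ('C(m, i)%:R : A) (i`!%:R : A) ((m - i)`!%:R : A).
move=> a u v c p q vq up acpq; transitivity (a * c * (u * p) * (v * q)).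
  by rewrite up vq !mulr1.
have -> : a * c * (u * p) * (v * q) = a * (c * (p * q)) * (v * u) by ring.
by rewrite acpq mul1r.
Qed.

Lemma Ad_leibniz (D : 'M[A]_n) x m :
  (forall x, Ad x *m D = D *m Ad x + Ad (x *m D)) ->
  Ad x *m D ^+ m = \sum_(i < m.+1) ('C(m, i))%:R *: (D ^+ (m - i) *m Ad (x *m D ^+ i)).
Proof.
move=> HD; pose f a i := D ^+ a *m Ad (x *m D ^+ i).
elim: m => [|m IH]; first by rewrite big_ord1 /= bin0 scale1r !expr0 !mulmx1 mul1mx.
rewrite exprSr -mulmxE mulmxA IH mulmx_suml.
have -> : \sum_(i < m.+1) ('C(m, i)%:R *: (D ^+ (m - i) *m Ad (x *m D ^+ i))) *m D
   = \sum_(i < m.+1) 'C(m, i)%:R *: f (m.+1 - i)%N i + \sum_(i < m.+1) 'C(m, i)%:R *: f (m - i)%N i.+1.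
  rewrite -big_split /=; apply: eq_bigr => i _.
  rewrite -scalemxAl -scalerDr /f -mulmxA HD mulmxDr mulmxA; congr (_ *: (_ *m _ + _ *m Ad _)).
    by rewrite mulmxE -exprSr subSn // -ltnS.
  by rewrite -mulmxA mulmxE -exprSr.
rewrite [RHS]big_ord_recl /= bin0 subn0.
under [in RHS]eq_bigr => i _ do rewrite /bump /= add1n binS natrD scalerDl subSS.
rewrite big_split /= addrA; congr (_ + _).
rewrite [in RHS]big_ord_recr /= bin_small // scale0r addr0.
by rewrite big_ord_recl /= bin0 subn0; congr (_ + _); apply: eq_bigr => i _; rewrite /bump /= add1n subSS.
Qed.

(** The exponential of a derivation is an automorphism, up to the displayed terms of total degree at
    least [N]. These disappear later, either by nilpotency or modulo a power of the
    indeterminate. *)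
Lemma texp_Ad (D : 'M[A]_n) x N : (forall x, Ad x *m D = D *m Ad x + Ad (x *m D)) ->
  texp N D *m Ad (x *m texp N D) = Ad x *m texp N D +
  \sum_(i < N) \sum_(j < N | (N <= i + j)%N) (inv j * inv i) *: (D ^+ j *m Ad (x *m D ^+ i)).
Proof.
move=> HD; have tri := sum_triangle N (fun j i => (inv j * inv i) *: (D ^+ j *m Ad (x *m D ^+ i))).
have -> : Ad x *m texp N D = \sum_(m < N) \sum_(i < m.+1) (inv (m - i) * inv i) *: (D ^+ (m - i) *m Ad (x *m D ^+ i)).
  rewrite /texp mulmx_sumr; apply: eq_bigr => m _.
  rewrite -scalemxAr Ad_leibniz // scaler_sumr; apply: eq_bigr => i _.
  by rewrite scalerA inv_bin // -ltnS.
rewrite -tri exchange_big /= /texp mulmx_suml; apply: eq_bigr => j _.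
have -> : x *m (\sum_(i < N) inv i *: D ^+ i) = \sum_(i < N) inv i *: (x *m D ^+ i).
  by rewrite mulmx_sumr; apply: eq_bigr => i _; rewrite -scalemxAr.
rewrite Ad_sum mulmx_sumr; apply: eq_bigr => i _.
by rewrite -scalemxAl -scalemxAr scalerA.
Qed.

Lemma texpD (D E : 'M[A]_n) N : D *m E = E *m D ->
  (forall i j, (N <= i + j)%N -> D ^+ j *m E ^+ i = 0) ->
  texp N (D + E) = texp N D *m texp N E.
Proof.
move=> DE DE0; have tri := sum_triangle N (fun j i => (inv j * inv i) *: (D ^+ j *m E ^+ i)).
rewrite [X in _ = _ + X]big1 ?addr0 in tri; last first.
  by move=> i _; rewrite big1 // => j /DE0->; rewrite scaler0.
have -> : texp N (D + E) = \sum_(m < N) \sum_(i < m.+1) (inv (m - i) * inv i) *: (D ^+ (m - i) *m E ^+ i).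
  apply: eq_bigr => m _; rewrite exprDn_comm ?scaler_sumr; last exact: DE.
  by apply: eq_bigr => i _; rewrite -scaler_nat scalerA inv_bin // -ltnS.
rewrite -tri exchange_big /= mulmx_suml; apply: eq_bigr => j _.
rewrite mulmx_sumr; apply: eq_bigr => i _.
by rewrite -scalemxAl -scalemxAr scalerA.
Qed.

Lemma texp0 N : (0 < N)%N -> texp N 0 = 1%:M.
Proof.
case: N => // N _; rewrite /texp big_ord_recl big1 ?addr0.
  by rewrite expr0 -[inv _]mulr1 -[1]/((0`!)%:R) invP scale1r.
by move=> i _; rewrite expr0n /= scaler0.
Qed.

End TruncatedExp.

Section DetCongr.

Lemma det_add_scale (A : comNzRingType) n (c : A) (M B : 'M[A]_n) :
  exists r, \det (M + c *: B) = \det M + c * r.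
Proof.
pose p := \det (map_mx polyC M + 'X *: map_mx polyC B).
have pE t : p.[t] = \det (M + t *: B).
  rewrite -[LHS]/(horner_eval t p) /p -det_map_mx; congr (\det _).
  apply/matrixP => i j; rewrite !mxE rmorphD rmorphM /= /horner_eval hornerX.
  by rewrite !hornerC.
have : root (p - (p.[0])%:P) 0 by rewrite /root hornerD hornerN hornerC subrr.
case/factor_theorem => q; rewrite subr0 => pq.
exists q.[c]; rewrite -pE -[\det M]addr0 -[M]addr0 -[X in \det (_ + X)](scale0r B) -pE.
rewrite addr0; have /(congr1 (fun p => p.[c])) := pq.
by rewrite hornerD hornerN hornerC hornerMX => /eqP; rewrite subr_eq addrC mulrC => /eqP.
Qed.

End DetCongr.

(** * Deformation of characteristic polynomials into a Cartan subalgebra *)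

Section RankMin.
Variables (C : numClosedFieldType) (n : nat).
Variable br : 'rV[C]_n -> 'rV[C]_n -> 'rV[C]_n.
Context {Hlie : lie_algebra br}.
Local Notation vec := 'rV[C]_n.
Local Notation pvec := 'rV[{poly C}]_n.

Definition adp (x : pvec) : 'M[{poly C}]_n :=
  \sum_i x 0 i *: constmx (ad br (delta_mx 0 i)).

Lemma adp_lin a x y : adp (a *: x + y) = a *: adp x + adp y.
Proof.
rewrite /adp scaler_sumr -big_split /=; apply: eq_bigr => i _.
by rewrite !mxE scalerDl scalerA.
Qed.

Lemma evalmx_adp t x : evalmx t (adp x) = ad br (evalmx t x).
Proof.
rewrite /adp evalmx_sum [evalmx t x]row_sum_delta.
elim/big_rec2: _ => [|i u v _ IH]; first by rewrite ad0.
by rewrite adP evalmxZ evalmx_const IH !mxE.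
Qed.

Lemma adp_derivation k (y : vec) x :
  let D := 'X^k *: constmx (ad br y) in adp x *m D = D *m adp x + adp (x *m D).
Proof.
move=> D; apply: polymx_ext => t.
rewrite evalmxD !evalmxM !evalmx_adp evalmxM evalmxZ evalmx_const hornerXn.
rewrite -!scalemxAr adZ adE ad_br -scalemxAl -scalerDr; congr (_ *: _).
by rewrite addrC subrK.
Qed.

Definition char_sim N (x y : pvec) := forall k,
  'X^N %| (char_poly (adp x))`_k - (char_poly (adp y))`_k.

Lemma char_sim_scale N x y w : x = y + 'X^N *: w -> char_sim N x y.
Proof.
move=> -> k; rewrite /char_poly.
have -> : char_poly_mx (adp (y + 'X^N *: w)) =
    char_poly_mx (adp y) + ('X^N)%:P *: - map_mx polyC (adp w).
  rewrite addrC adp_lin /char_poly_mx; apply/matrixP => i j; rewrite !mxE rmorphD rmorphM /=; ring.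
have [r ->] := det_add_scale ('X^N)%:P (char_poly_mx (adp y)) (- map_mx polyC (adp w)).
by rewrite coefD addrC addKr coefCM dvdp_mulIl.
Qed.

Lemma char_sim_trans N x y z : char_sim N x y -> char_sim N y z -> char_sim N x z.
Proof. by move=> H1 H2 k; have := dvdp_add (H1 k) (H2 k); rewrite addrA subrK. Qed.

Let inv j : {poly C} := ((j`!)%:R^-1)%:P.
Let invP j : inv j * (j`!)%:R = 1.
Proof. by rewrite /inv -polyC_natr -polyCM mulVf // pnatr_eq0 -lt0n fact_gt0. Qed.

Lemma dvdXn_cancel N (e a b r : {poly C}) : e.[0] != 0 ->
  e * a = e * b + 'X^N * r -> 'X^N %| a - b.
Proof.
move=> e0 H; have : 'X^N %| e * (a - b) by rewrite mulrBr H addrC addKr dvdp_mulIl.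
rewrite Gauss_dvdpr //; apply: coprimep_expl.
by rewrite -[X in coprimep X _]subr0 -polyC0 coprimep_sym coprimep_XsubC.
Qed.

(** Modulo 'X^N the truncated exponential [E] intertwines [adp x] and [adp (x *m E)]. Its
    determinant is 1 at 0, so it cancels modulo 'X^N. *)
Lemma char_sim_exp N k (x : pvec) (y : vec) : (0 < k)%N -> (0 < N)%N ->
  char_sim N (x *m texp inv N ('X^k *: constmx (ad br y))) x.
Proof.
move=> k0 N0; set D := 'X^k *: _; set E := texp _ _ _; move=> i.
have [R ER] : exists R, E *m adp (x *m E) = adp x *m E + 'X^N *: R.
  rewrite /E (texp_Ad adp_lin invP) => [|z]; last exact: adp_derivation.
  have DX a : D ^+ a = 'X^(k * a) *: constmx (ad br y) ^+ a.
    elim: a => [|a IH]; first by rewrite muln0 !expr0 scale1r.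
    by rewrite !exprS -!mulmxE IH mulnS exprD -scalemxAl -scalemxAr scalerA.
  pose P (Q : 'M[{poly C}]_n) := exists R, Q = 'X^N *: R.
  suff [R ->] : P (\sum_(i < N) \sum_(j < N | (N <= i + j)%N)
     (inv j * inv i) *: (D ^+ j *m adp (x *m D ^+ i))) by exists R.
  have PD Q Q' : P Q -> P Q' -> P (Q + Q').
    by move=> [R ->] [R' ->]; exists (R + R'); rewrite scalerDr.
  have P0 : P 0 by exists 0; rewrite scaler0.
  apply: (big_ind P) => // a _; apply: (big_ind P) => // b Nab.
  have adpZ c z : adp (c *: z) = c *: adp z.
    by rewrite /adp scaler_sumr; apply: eq_bigr => j _; rewrite !mxE scalerA.
  rewrite !DX -scalemxAr adpZ -scalemxAl -scalemxAr !scalerA.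
  have le : (N <= k * b + k * a)%N by rewrite -mulnDr addnC (leq_trans Nab) ?leq_pmull.
  exists ((inv b * inv a * 'X^(k * b + k * a - N)) *: (constmx (ad br y) ^+ b *m adp (x *m constmx (ad br y) ^+ a))).
  by rewrite scalerA [in RHS]mulrCA -exprD subnKC // exprD mulrA.
pose Ec := map_mx polyC E.
have mxE1 : Ec *m char_poly_mx (adp (x *m E)) =
   char_poly_mx (adp x) *m Ec + ('X^N)%:P *: - map_mx polyC R.
  rewrite /char_poly_mx mulmxBr mulmxBl -!map_mxM ER scalar_mxC.
  by apply/matrixP => a b; rewrite !mxE rmorphD rmorphM /=; ring.
have [r] := det_add_scale ('X^N)%:P (char_poly_mx (adp x) *m Ec) (- map_mx polyC R).
rewrite -mxE1 !det_mulmx det_map_mx => /(congr1 (fun p : {poly {poly C}} => p`_i)).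
rewrite coefD !coefCM coefMC => H; apply: (@dvdXn_cancel N (\det E) _ _ r`_i).
  rewrite -[_.[_]]/(horner_eval 0 (\det E)) -det_map_mx -/(evalmx 0 E).
  have -> : evalmx 0 E = 1%:M; last by rewrite det1 oner_eq0.
  rewrite /E; case: (N) N0 => // N' _; rewrite /texp big_ord_recl evalmxD evalmx_sum big1 ?addr0.
    by rewrite expr0 evalmxZ /evalmx map_mx1 /inv hornerC fact0 invr1 scale1r.
  move=> j _; rewrite evalmxZ evalmxX evalmxZ hornerXn expr0n eqn0Ngt k0 scale0r.
  by rewrite expr0n /= scaler0.
by rewrite [LHS]H [X in X + _]mulrC.
Qed.

Lemma texp_expand N k (c : 'M[{poly C}]_n) : (0 < k)%N ->
  exists R, texp inv N.+2 ('X^k *: c) = 1%:M + 'X^k *: c + 'X^(k.+1) *: R.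
Proof.
move=> k0; have DX a : ('X^k *: c) ^+ a = 'X^(k * a) *: c ^+ a.
  elim: a => [|a IH]; first by rewrite muln0 !expr0 scale1r.
  by rewrite !exprS -!mulmxE IH mulnS exprD -scalemxAl -scalemxAr scalerA.
have inv1 j : (j <= 1)%N -> inv j = 1.
  by case: j => [|[|]] // _; rewrite /inv invr1.
rewrite /texp big_ord_recl big_ord_recl /= !inv1 // !scale1r expr0 expr1 /bump /=.
exists (\sum_(i < N) (inv i.+2 * 'X^(k * i.+2 - k.+1)) *: c ^+ i.+2).
rewrite addrA; congr (_ + _); rewrite scaler_sumr; apply: eq_bigr => i _.
rewrite !add1n DX !scalerA mulrCA -exprD subnKC //.
by rewrite !mulnS; lia.
Qed.

Lemma polymx_divX m p (q : 'M[{poly C}]_(m, p)) : evalmx 0 q = 0 ->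
  exists q', q = 'X *: q'.
Proof.
move=> q0; exists (map_mx (fun p => p %/ 'X) q); apply/matrixP => i j; rewrite !mxE.
rewrite mulrC divpK // -['X]subr0 dvdp_XsubCl /root.
by have /matrixP/(_ i j) := q0; rewrite !mxE /horner_eval => ->.
Qed.

Lemma fitting_split (A : 'M[C]_n) (H : 'M[C]_n) (w : vec) : (kermx (A ^+ n) <= H)%MS ->
  exists (w0 : vec) (u : vec), (w0 <= H)%MS /\ w = w0 + u *m A.
Proof.
move=> kH; move: w; apply: (geig_ind (A := A)).
- by exists 0, 0; rewrite sub0mx mul0mx addr0.
- move=> a x y [x0 [u [x0H ->]]] [y0 [v [y0H ->]]].
  exists (a *: x0 + y0), (a *: u + v); split; first by rewrite addmx_sub ?scalemx_sub.
  by rewrite mulmxDl -scalemxAl scalerDr addrACA.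
move=> a w gw; have [a0|an0] := eqVneq a 0.
  exists w, 0; rewrite mul0mx addr0; split=> //; apply: submx_trans kH.
  by apply/sub_kermxP; have := geig_index gw; rewrite a0 raddf0 subr0.
suff [u ->] : exists u, w = u *m A by exists 0, u; rewrite sub0mx add0r.
case: gw => k; elim: k w => [|k IH] w; first by rewrite expr0 mulmx1 => ->; exists 0; rewrite mul0mx.
rewrite exprS -mulmxE mulmxA => /IH[u uE].
exists (a^-1 *: (w - u)); rewrite -scalemxAl mulmxBl -uE mulmxBr mul_mx_scalar.
by rewrite opprB addrC subrK scalerA mulVf // scale1r.
Qed.

(* Order by order in [t], the curve [s + t (x - s)] is conjugate into [H]. *)
Lemma engel_rank_min (H : 'M[C]_n) (s : vec) :
  (forall h : vec, (h <= H)%MS -> H *m ad br h ^+ n = 0) ->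
  (s <= H)%MS -> (kermx (ad br s ^+ n) <= H)%MS ->
  forall x, (\rank H <= \rank (kermx (ad br x ^+ n)))%N.
Proof.
move=> Hnil sH kH x; pose X : pvec := constmx s + 'X *: constmx (x - s).
(* [xm] agrees with a curve [h] in [H] up to order m. Splitting w(0) = w0 + [s, u] with w0 in [H],
   conjugation by exp (t^(m+1) ad u) removes [s, u], because [u, s] = - [s, u]. *)
have main N m : exists (xm h w : pvec), [/\ xm = h + 'X^(m.+1) *: w, char_sim N.+2 xm X,
    forall t, (evalmx t h <= H)%MS & evalmx 0 h = s].
  elim: m => [|m [xm [h [w [xE xsim hH h0]]]]].
    exists X, (constmx s), (constmx (x - s)); split=> // [k|t|].
    - by rewrite subrr dvdp0.
    - by rewrite evalmx_const.
    - by rewrite evalmx_const.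
  have [w0 [u [w0H wE]]] := fitting_split (evalmx 0 w) kH.
  set k := m.+1 in xE *.
  have [R RE] := @texp_expand N k (constmx (ad br u)) isT.
  have [|q qE] := @polymx_divX _ _ (w + xm *m constmx (ad br u) - constmx w0).
    rewrite !evalmxD /evalmx map_mxN -!/(evalmx _ _) evalmxM !evalmx_const wE xE.
    rewrite evalmxD evalmxZ hornerXn expr0n /= scale0r addr0 h0 !adE brC.
    by rewrite subrK subrr.
  exists (xm *m texp inv N.+2 ('X^k *: constmx (ad br u))), (h + 'X^k *: constmx w0).
  exists (q + xm *m R); split.
  - rewrite RE !mulmxDr mulmx1 -!scalemxAr {1}xE scalerDr addrA; congr (_ + _).
    rewrite exprSr -scalerA -qE -addrA -addrA; congr (_ + _).
    by rewrite -!scalerDr; congr (_ *: _); rewrite [RHS]addrC subrK.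
  - by apply: char_sim_trans xsim; apply: char_sim_exp.
  - by move=> t; rewrite evalmxD evalmxZ evalmx_const addmx_sub // scalemx_sub.
  - by rewrite evalmxD evalmxZ hornerXn expr0n /= scale0r addr0 h0.
have evalc t y k : ((char_poly (adp y))`_k).[t] = (char_poly (ad br (evalmx t y)))`_k.
  rewrite -[LHS]/(horner_eval t _) -coef_map map_char_poly -/(evalmx _ _).
  by rewrite evalmx_adp.
(* This coefficient vanishes for a curve inside [H], where [ad h] is nilpotent on [H]. The
   approximation by such a curve is taken beyond the size of [c], so [c] must be 0. *)
have coef0 k : (k < \rank H)%N -> (char_poly (adp X))`_k = 0.
  move=> kr; apply/eqP/negP => /negP cn0.
  set c := (char_poly (adp X))`_k in cn0 *.
  have [xm [h [w [xE xsim hH _]]]] := main (size c) (size c).+1.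
  have hsim : char_sim (size c).+2 xm h by apply: char_sim_scale xE.
  have hk0 : (char_poly (adp h))`_k = 0.
    apply: poly_fun0 => t; rewrite evalc.
    have [q _ ->] := char_poly_geig0 (ad br (evalmx t h)).
    rewrite coefXnM (leq_trans kr) //; apply/mxrankS/sub_kermxP/Hnil/hH.
  have : 'X^((size c).+2) %| c.
    have aux (p a a0 b : {poly C}) : a0 = 0 -> p %| a - a0 -> p %| a - b -> p %| b.
      by move=> -> H1 H2; have := dvdp_sub H1 H2; rewrite subr0 opprB addrC subrK.
    exact: aux hk0 (hsim k) (xsim k).
  by move/(dvdp_leq cn0); rewrite size_polyXn => /ltnW/ltnW; rewrite ltnn.
(* At t = 1 the curve passes through [x], and the lowest nonzero coefficient there has the rank of
   the generalized kernel as its index. *)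
have [q q0 qE] := char_poly_geig0 (ad br x); rewrite leqNgt; apply/negP => lt.
have X1 : evalmx 1 X = x.
  by rewrite evalmxD evalmxZ !evalmx_const hornerX scale1r addrC subrK.
have := evalc 1 X (\rank (kermx (ad br x ^+ n))).
rewrite coef0 // X1 horner0 qE coefXnM ltnn subnn -horner_coef0 => /esym/eqP.
by rewrite (negbTE q0).
Qed.

Lemma ad_stable_nilpotent (H : 'M[C]_n) x k : H *m ad br x ^+ k = 0 ->
  H *m ad br x ^+ n = 0.
Proof.
move=> Hk; apply/row_matrixP => i; rewrite row0 row_mul.
have gi : geig (ad br x) 0 (row i H) by exists k; rewrite raddf0 subr0 -row_mul Hk row0.
by have := geig_index gi; rewrite raddf0 subr0.
Qed.

Lemma kermx_geig0 (A : 'M[C]_n) (v : vec) : (v <= kermx (A ^+ n))%MS <-> geig A 0 v.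
Proof.
split=> [/sub_kermxP vA|/geig_index]; first by exists n; rewrite raddf0 subr0.
by rewrite raddf0 subr0 => /sub_kermxP.
Qed.

Lemma engel_subalgebra x : lie_subalgebra br (kermx (ad br x ^+ n)).
Proof.
move=> y z /kermx_geig0 gy /kermx_geig0 gz; apply/kermx_geig0.
rewrite -[0]addr0; apply: derivation_geig => // u v.
by rewrite !adE br_jacobi.
Qed.

Lemma engel_minimal (x y : vec) : (y <= kermx (ad br x ^+ n))%MS ->
  (forall t, (\rank (kermx (ad br x ^+ n)) <= \rank (kermx (ad br (x + t *: y) ^+ n)))%N) ->
  kermx (ad br x ^+ n) *m ad br y ^+ n = 0.
Proof.
move=> yx rk; apply: (pencil_nilpotent (A := ad br x)); first by apply/andP; rewrite !submx_refl.
  by apply/row_subP => i; rewrite row_mul adE; apply: engel_subalgebra; rewrite ?row_sub.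
by move=> t; have := rk t; rewrite adD adZ.
Qed.

(** Take [s] in [H] with generalized kernel [M] of least rank. By minimality [H] acts nilpotently on
    [M]; if [M] were not inside [H], Engel would produce a vector outside [H] normalizing it, which
    a Cartan subalgebra excludes. *)
Lemma cartan_engel (H : 'M[C]_n) : cartan_subalgebra br H ->
  exists s, [/\ (s <= H)%MS, (kermx (ad br s ^+ n) <= H)%MS
    & forall h, (h <= H)%MS -> H *m ad br h ^+ n = 0].
Proof.
case=> Hsub [k Hk] Hnorm.
have Hnil h : (h <= H)%MS -> H *m ad br h ^+ n = 0.
  move=> hH; apply: (@ad_stable_nilpotent _ _ k); apply/eqP; rewrite -submx0.
  have /andP[Hk0 _] := Hk; apply: submx_trans Hk0.
  elim: (k) => [|j IH]; first by rewrite expr0 mulmx1 submx_refl.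
  rewrite exprSr -mulmxE mulmxA /=; apply: submx_trans (submxMr _ IH) _.
  by apply/row_subP => i; rewrite row_mul adE brspace_mem ?row_sub.
pose p r := `[< exists2 s : vec, (s <= H)%MS & \rank (kermx (ad br s ^+ n)) = r >].
have exp : exists r, p r.
  by exists (\rank (kermx (ad br (0 : vec) ^+ n))); apply/asboolP; exists 0; rewrite ?sub0mx.
case: (ex_minnP exp) => r /asboolP[s sH <-] rmin.
pose M := kermx (ad br s ^+ n).
have HM : (H <= M)%MS by apply/sub_kermxP/Hnil.
exists s; split=> //; rewrite -/M; apply/negPn/negP => MH.
have Mnil h : (h <= H)%MS -> M *m ad br h ^+ n = 0.
  move=> hH; apply: engel_minimal; first exact: submx_trans HM.
  by move=> t; apply: rmin; apply/asboolP; exists (s + t *: h); rewrite ?addmx_sub ?scalemx_sub.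
have [v [vM vH Hv]] : exists v, [/\ (v <= M)%MS, ~~ (v <= H)%MS
    & forall x, (x <= H)%MS -> (br x v <= H)%MS].
  apply: (engel_vector (leqnn _) Hsub HM (submx_refl M)) => //.
    by apply: ad_stableP => x u; apply: Hsub.
  apply: ad_stableP => x u xH uM; apply: engel_subalgebra => //.
  exact: submx_trans HM.
case/negP: vH; apply: Hnorm => y yH.
by rewrite brC eqmx_opp Hv.
Qed.

Lemma cartan_rank_min (H : 'M[C]_n) : cartan_subalgebra br H ->
  forall x, (\rank H <= \rank (kermx (ad br x ^+ n)))%N.
Proof. by move=> /cartan_engel[s [sH kH Hnil]]; apply: engel_rank_min kH. Qed.

End RankMin.

(** * Regularity and integrality *)

Section Weights.
Variables (C : numClosedFieldType) (n : nat).
Implicit Types (A B M : 'M[C]_n).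

Lemma eigen_natsum_disjoint A (c : C) m (P : pred nat) :
  (forall i, (i < m)%N -> P i -> c != i%:R) ->
  (eigenspace A c :&: \sum_(i < m | P i) eigenspace A i%:R = 0)%MS.
Proof.
(* [None] carries the eigenvalue [c], so that all eigenspaces form one family with distinct
   eigenvalues. *)
move=> Hc; pose a_ (o : option 'I_m) : C := if o is Some i then (i : nat)%:R else c.
pose Q (o : option 'I_m) := if o is Some i then P i else true.
have inj : {in Q &, injective a_}.
  move=> [i|] [j|] // Pi Pj; rewrite /a_.
  - by move/eqP; rewrite eqr_nat => /eqP/val_inj->.
  - by move/esym/eqP; rewrite (negbTE (Hc _ (ltn_ord i) Pi)).
  - by move/eqP; rewrite (negbTE (Hc _ (ltn_ord j) Pj)).
have /mxdirect_sumsP/(_ None isT) := mxdirect_sum_eigenspace A inj.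
set D := (_ :&: _)%MS => D0; apply/eqP; rewrite -submx0.
suff : (eigenspace A c :&: \sum_(i < m | P i) eigenspace A i%:R <= D)%MS by rewrite D0.
apply: capmxS; first exact: submx_refl.
by apply/sumsmx_subP => i Pi; apply: (sumsmx_sup (Some i)); rewrite /= ?Pi ?submx_refl.
Qed.

Lemma eigen_natsum_value A (c : C) m (v : 'rV[C]_n) : v != 0 -> v *m A = c *: v ->
  (v <= \sum_(i < m) eigenspace A i%:R)%MS -> exists i : nat, c = i%:R.
Proof.
move=> vn0 vA vS; apply: contrapT => H; case/negP: vn0; rewrite -submx0.
rewrite -(@eigen_natsum_disjoint A c m predT); first by rewrite sub_capmx vS andbT; apply/eigenspaceP.
by move=> i _ _; apply/eqP => ci; apply: H; exists i.
Qed.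

Lemma eigen_sum0 A m (u : nat -> 'rV[C]_n) :
  (forall i, (i < m)%N -> u i *m A = i%:R *: u i) -> \sum_(i < m) u i = 0 ->
  forall i, (i < m)%N -> u i = 0.
Proof.
elim: m => // m IH uA; rewrite big_ord_recr /= => u0.
have um : u m = 0.
  apply/eqP; rewrite -submx0 -(@eigen_natsum_disjoint A m%:R m predT).
    rewrite sub_capmx; apply/andP; split; first by apply/eigenspaceP/uA.
    have -> : u m = - \sum_(i < m) u i by apply/eqP; rewrite -addr_eq0 addrC u0.
    rewrite eqmx_opp; apply: summx_sub => i _; apply: (sumsmx_sup i) => //.
    by apply/eigenspaceP/uA; rewrite ltnW // ltnS.
  by move=> i im _; rewrite eqr_nat gtn_eqF.
move=> i; rewrite ltnS leq_eqVlt => /predU1P[->//|im]; apply: IH => //.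
  by move=> j jm; apply: uA; rewrite ltnW.
by move: u0; rewrite um addr0.
Qed.

(** In a common eigenbasis with eigenvalues (a_i, b_i), choose [c] off the zeros of the nonzero
    polynomials a_i + b_i X; then A + c B vanishes only on common null vectors. *)
Lemma diagonalizable_pencil A B : diagonalizable A -> diagonalizable B ->
  A *m B = B *m A -> exists c, forall v : 'rV[C]_n,
  v *m (A + c *: B) ^+ n = 0 -> v *m A = 0 /\ v *m B = 0.
Proof.
move=> dA dB AB.
have [_ _] := (codiagonalizableP [:: A; B]).
have [+ _] := codiagonalizableP [:: A; B] => /(_ _)[|P Pu /= /andP[PA /andP[PB _]]].
  split; first by move=> X Y; rewrite !inE => /orP[]/eqP-> /orP[]/eqP->; rewrite /comm_mx.
  by move=> X; rewrite !inE => /orP[]/eqP->.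
have row_eig X : diagonalizable_for P X -> exists d : 'rV[C]_n, forall i, row i P *m X = d 0 i *: row i P.
  move=> /diagonalizable_forPex[d /(simmxLR Pu) ->]; exists d => i.
  rewrite mxpoly.conjVmx // -row_mul !mulmxA mulmxV // mul1mx row_mul row_diag_mx.
  by rewrite -scalemxAl -rowE.
have [a aP] := row_eig _ PA; have [b bP] := row_eig _ PB.
pose q := \prod_(i | (a 0 i != 0) || (b 0 i != 0)) ((a 0 i)%:P + (b 0 i) *: 'X) : {poly C}.
have qn0 : q != 0.
  apply/prodf_neq0 => i ab; apply/eqP => /polyP H.
  have := H 0%N; have := H 1%N; rewrite !coefE !mulr0 !mulr1 addr0 add0r => b0 a0.
  by move: ab; rewrite a0 b0 eqxx.
have [c qc] : exists c, q.[c] != 0.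
  apply: contrapT => H; case/eqP: qn0; apply: poly_fun0 => t.
  by apply/eqP/negPn/negP => qt; apply: H; exists t.
exists c => v vc; pose u := v *m invmx P.
have uP : v = \sum_i u 0 i *: row i P by rewrite -mulmx_sum_row mulmxKV.
have vM (X : 'M[C]_n) (d : 'rV[C]_n) : (forall i, row i P *m X = d 0 i *: row i P) ->
    v *m X = (\row_i (u 0 i * d 0 i)) *m P.
  move=> HX; rewrite {1}uP mulmx_suml mulmx_sum_row; apply: eq_bigr => i _.
  by rewrite -scalemxAl HX scalerA mxE.
have cP i : row i P *m (A + c *: B) ^+ n = (\row_i (a 0 i + c * b 0 i) ^+ n) 0 i *: row i P.
  rewrite mxE; apply: eigenvector_exp.
  by rewrite mulmxDr -scalemxAr aP bP scalerDl scalerA.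
have u0 i : (a 0 i != 0) || (b 0 i != 0) -> u 0 i = 0.
  move=> ab; have : \row_i (u 0 i * (\row_i (a 0 i + c * b 0 i) ^+ n) 0 i) = 0.
    by rewrite -(mulmxK Pu (\row_i _)) -(vM _ _ cP) vc mul0mx.
  move=> /rowP/(_ i); rewrite !mxE => /eqP; rewrite mulf_eq0 expf_eq0.
  case/orP => [/eqP //|/andP[_ abc0]]; move: qc; rewrite /q horner_prod.
  move/prodf_neq0/(_ i ab); rewrite hornerD hornerC hornerZ hornerX mulrC.
  by rewrite abc0.
clearbody u; split; [rewrite (vM _ _ aP) | rewrite (vM _ _ bP)].
all: rewrite (_ : \row_i _ = 0) ?mul0mx //; apply/rowP => i; rewrite !mxE.
- by have [->|ai] := eqVneq (a 0 i) 0; rewrite ?mulr0 // u0 ?mul0r // ai.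
- by have [->|bi] := eqVneq (b 0 i) 0; rewrite ?mulr0 // u0 ?mul0r // bi orbT.
Qed.

(** With [F] commuting with [M], the trace of [M, A] F is 0, and [M, A] is [M] itself. *)
Lemma commutator_nilpotent A M : M *m A - A *m M = M -> M ^+ n = 0.
Proof.
move=> H; have [F [Fact _ _ Fcomm _]] := spectral_fun M (fun a => a^*).
have FM : F *m M = M *m F by apply: Fcomm.
apply: (nilpotent_trace_conj Fact) => //.
rewrite -{1}H mulmxBl raddfB /= -!mulmxA mxtrace_mulC -mulmxA FM subrr //.
Qed.

Lemma commuting_nilpotent A B : A *m B = B *m A -> A ^+ n = 0 -> (A *m B) ^+ n = 0.
Proof. by move=> AB An; rewrite mulmxE exprMn_comm // An mul0r. Qed.

Lemma last_nonzero_iterate M (v : 'rV[C]_n) : M ^+ n = 0 -> v != 0 ->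
  exists k, v *m M ^+ k != 0 /\ v *m M ^+ k *m M = 0.
Proof.
move=> Mn vn0; have exk : exists k, v *m M ^+ k == 0 by exists n; rewrite Mn mulmx0.
case: (ex_minnP exk) => -[|k] vk kmin; first by move: vk; rewrite expr0 mulmx1 (negbTE vn0).
exists k; split; last by rewrite -mulmxA mulmxE -exprSr; apply/eqP.
by apply/negP => /kmin; rewrite ltnn.
Qed.

End Weights.

Section Centralizer.
Variables (C : numClosedFieldType) (n : nat).
Variable br : 'rV[C]_n -> 'rV[C]_n -> 'rV[C]_n.
Context {Hlie : lie_algebra br}.

Lemma centralizer2P x1 x2 v :
  (v <= centralizer2 br x1 x2)%MS <-> br x1 v = 0 /\ br x2 v = 0.
Proof.
rewrite /centralizer2 sub_capmx; split.
  by case/andP => /sub_kermxP + /sub_kermxP; rewrite !adE.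
by case=> a b; apply/andP; split; apply/sub_kermxP; rewrite adE.
Qed.

End Centralizer.

(** * The centralizers of the nilpotent pair and of the semisimple pair *)

Section PrincipalPair.
Variables (C : numClosedFieldType) (n : nat).
Variable br : 'rV[C]_n -> 'rV[C]_n -> 'rV[C]_n.
Hypothesis ss : semisimple br.
Local Instance pair_lie : lie_algebra br := semisimple_lie_algebra ss.
Variables e1 e2 h1 h2 : 'rV[C]_n.
Hypothesis e12 : br e1 e2 = 0.
Hypothesis rkZ : has_rank_dim br (\rank (centralizer2 br e1 e2)).
Hypotheses (dh1 : ss_element br h1) (dh2 : ss_element br h2).
Hypothesis rel : pair_relations br e1 e2 h1 h2.
Implicit Types (x y z v w : 'rV[C]_n).

Local Notation Z := (centralizer2 br e1 e2).
Local Notation L := (centralizer2 br h1 h2).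
Local Notation E1 := (ad br e1).
Local Notation E2 := (ad br e2).
Local Notation eps := (ad br (e1 + e2)).

Lemma pair_E12 : E1 *m E2 = E2 *m E1.
Proof. by apply/eqP; rewrite eq_sym -subr_eq0 -ad_br e12 ad0. Qed.

Lemma pair_h12 : ad br h1 *m ad br h2 = ad br h2 *m ad br h1.
Proof. by case: rel => _ _ _ _ h12; apply/eqP; rewrite eq_sym -subr_eq0 -ad_br h12 ad0. Qed.

(** A generic combination h1 + c h2 exhibits L as the generalized kernel of a single element,
    central in L. *)
Lemma pair_regular : exists h, [/\ (h <= L)%MS, (forall x, (x <= L)%MS -> br h x = 0)
  & (kermx (ad br h ^+ n) == L)%MS].
Proof.
have [c cP] := diagonalizable_pencil dh1 dh2 pair_h12.
case: rel => _ _ _ _ h12.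
have hL x : (x <= L)%MS -> br (h1 + c *: h2) x = 0.
  by move=> /centralizer2P[a b]; rewrite brDl brZl a b scaler0 addr0.
exists (h1 + c *: h2); split=> //.
  by apply/centralizer2P; rewrite !brDr !brZr !brxx h12 (brC h2 h1) h12 oppr0 scaler0 addr0.
apply/andP; split; apply/rV_subP => v.
  move=> /sub_kermxP; rewrite adD adZ => /cP[]; rewrite !adE => a b.
  exact/centralizer2P.
move=> vL; apply/kermx_geig0; exists 1%N.
by rewrite raddf0 subr0 expr1 adE hL.
Qed.

Lemma pair_nilpotent : E1 ^+ n = 0 /\ E2 ^+ n = 0 /\ eps ^+ n = 0.
Proof.
case: rel => r11 r12 r21 r22 _; split; [|split].
- by apply: (@commutator_nilpotent _ _ (ad br h1)); rewrite -ad_br r11.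
- by apply: (@commutator_nilpotent _ _ (ad br h2)); rewrite -ad_br r22.
apply: (@commutator_nilpotent _ _ (ad br (h1 + h2))).
by rewrite -ad_br !brDl !brDr r11 r12 r21 r22 addr0 add0r.
Qed.

(** The booleans treat h1, h2 and h1 + h2 at once. *)
Lemma pair_weight (b1 b2 : bool) i j v (c : C) :
  let h := b1%:R *: h1 + b2%:R *: h2 in
  br h v = c *: v ->
  br h (v *m (E1 ^+ i *m E2 ^+ j)) = (c + (i * b1 + j * b2)%N%:R) *: (v *m (E1 ^+ i *m E2 ^+ j)).
Proof.
case: rel => r11 r12 r21 r22 _ h hv.
have he1 : br h e1 = b1%:R *: e1 by rewrite brDl !brZl r11 r21 scaler0 addr0.
have he2 : br h e2 = b2%:R *: e2 by rewrite brDl !brZl r12 r22 scaler0 add0r.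
have step e d u c' : br h e = d *: e -> br h u = c' *: u ->
    br h (u *m ad br e) = (c' + d) *: (u *m ad br e).
  by move=> he hu; rewrite adE br_jacobi he hu brZl brZr scalerDl addrC.
have steps e d u c' k : br h e = d *: e -> br h u = c' *: u ->
    br h (u *m ad br e ^+ k) = (c' + d *+ k) *: (u *m ad br e ^+ k).
  move=> he hu; elim: k => [|k IH]; first by rewrite expr0 mulmx1 mulr0n addr0.
  by rewrite exprSr -mulmxE mulmxA (step _ _ _ _ he IH) mulrSr addrA.
rewrite mulmxA (steps _ _ _ _ _ he2 (steps _ _ _ _ _ he1 hv)).
by rewrite natrD !natrM !mulr_natl -addrA.
Qed.

Lemma epsX k : eps ^+ k = \sum_(i < k.+1) (E1 ^+ (k - i) *m E2 ^+ i) *+ 'C(k, i).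
Proof. by rewrite adD exprDn_comm //; exact: pair_E12. Qed.

Lemma L_weight0 (b1 b2 : bool) v : (v <= L)%MS -> br (b1%:R *: h1 + b2%:R *: h2) v = 0 *: v.
Proof. by move=> /centralizer2P[a b]; rewrite brDl !brZl a b !scaler0 addr0 scale0r. Qed.

(* For [x] in [L] with [x eps^(k+1) = 0], [x eps^k] centralizes [e1] and [e2]; these
   vectors span a space of dimension [\rank L]. *)
Definition Wpart k : 'M[C]_n := ((L :&: kermx (eps ^+ k.+1))%MS *m eps ^+ k).
Definition Wsum : 'M[C]_n := (\sum_(k < n) Wpart k)%MS.

Lemma pair_weight0 (b1 b2 : bool) i j x : (x <= L)%MS ->
  let h := b1%:R *: h1 + b2%:R *: h2 in
  x *m (E1 ^+ i *m E2 ^+ j) *m ad br h = (i * b1 + j * b2)%N%:R *: (x *m (E1 ^+ i *m E2 ^+ j)).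
Proof. by move=> xL h; rewrite adE (pair_weight i j (L_weight0 b1 b2 xL)) add0r. Qed.

Lemma Wpart_weight k : (Wpart k <= eigenspace (ad br (h1 + h2)) k%:R)%MS.
Proof.
apply/rV_subP => v /submxP[u ->]; rewrite /Wpart mulmxA; set x := u *m _.
have xL : (x <= L)%MS by apply: submx_trans (submxMl _ _) _; apply: capmxSl.
apply/eigenspaceP; rewrite epsX mulmx_sumr mulmx_suml scaler_sumr.
apply: eq_bigr => i _; rewrite -scaler_nat -scalemxAr -scalemxAl.
have := pair_weight0 true true (k - i) i xL; rewrite /= !scale1r !muln1 => ->.
by rewrite subnK 1?mulrC ?scalerA 1?mulrC // -ltnS.
Qed.

Lemma Wsum_weights (b1 b2 : bool) :
  (Wsum <= \sum_(i < n.*2.+1) eigenspace (ad br (b1%:R *: h1 + b2%:R *: h2)) i%:R)%MS.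
Proof.
apply/sumsmx_subP => k _; apply/rV_subP => v /submxP[u ->]; rewrite /Wpart mulmxA; set x := u *m _.
have xL : (x <= L)%MS by apply: submx_trans (submxMl _ _) _; apply: capmxSl.
rewrite epsX mulmx_sumr; apply: summx_sub => i _.
rewrite -scaler_nat -scalemxAr; apply: scalemx_sub.
have lt : ((k - i) * b1 + i * b2 < n.*2.+1)%N.
  have := ltn_ord k; have := ltn_ord i.
  by case: b1; case: b2; rewrite /= ?muln0 ?muln1; lia.
apply: (sumsmx_sup (Ordinal lt)) => //; apply/eigenspaceP.
exact: pair_weight0.
Qed.

(** [Wpart m] is the image under eps^m of the part of L killed by eps^(m+1), with kernel the part
    killed by eps^m, so ranks telescope. The sum is direct because [Wpart k] has weight k for h1 +
    h2. *)
Lemma rank_Wsum : \rank Wsum = \rank L.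
Proof.
have H m : (m <= n)%N -> \rank (\sum_(k < m) Wpart k)%MS = \rank (L :&: kermx (eps ^+ m))%MS.
  elim: m => [|m IH] mn.
    by rewrite big_ord0 expr0 mxrank0; apply/esym/eqP; rewrite mxrank_eq0 -submx0 (submx_trans (capmxSr _ _)) // -(mulmx1 (kermx _)) mulmx_ker sub0mx.
  rewrite big_ord_recr /= mxrank_disjoint_sum; last first.
    have := @eigen_natsum_disjoint _ _ (ad br (h1 + h2)) m%:R m predT.
    set D := (_ :&: _)%MS => D0; apply/eqP; rewrite capmxC -submx0.
    suff : (Wpart m :&: \sum_(k < m) Wpart k <= D)%MS.
      by rewrite D0 // => i im _; rewrite eqr_nat gtn_eqF.
    apply: capmxS; first exact: Wpart_weight.
    by apply/sumsmx_subP => k _; apply: (sumsmx_sup k) => //; apply: Wpart_weight.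
  rewrite IH 1?ltnW // /Wpart -(mxrank_mul_ker (L :&: kermx (eps ^+ m.+1))%MS (eps ^+ m)) addnC.
  congr (_ + _)%N; apply/eqmx_rank/andP; split.
    rewrite sub_capmx capmxSr andbT sub_capmx capmxSl /=.
    apply: submx_trans (capmxSr _ _) _; apply/sub_kermxP.
    by rewrite exprSr -mulmxE mulmxA mulmx_ker mul0mx.
  by rewrite sub_capmx capmxSr andbT (submx_trans (capmxSl _ _)) ?capmxSl.
rewrite /Wsum H //; have [_ [_ ->]] := pair_nilpotent.
apply/eqmx_rank/andP; split; first exact: capmxSl.
by rewrite sub_capmx submx_refl; apply/sub_kermxP; rewrite mulmx0.
Qed.

Lemma Wpart_mem k v : (v <= Wpart k)%MS ->
  exists x, [/\ (x <= L)%MS, x *m eps ^+ k.+1 = 0 & v = x *m eps ^+ k].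
Proof.
move=> /submxP[u ->]; exists (u *m (L :&: kermx (eps ^+ k.+1))%MS); split.
- by apply: submx_trans (submxMl _ _) _; apply: capmxSl.
- by apply/sub_kermxP; apply: submx_trans (submxMl _ _) _; apply: capmxSr.
by rewrite mulmxA.
Qed.

(* [x eps^(k+1)] is a sum of terms of pairwise distinct [h1]-weights, so each
   of them vanishes. *)
Lemma Wsum_centralizes : (Wsum <= Z)%MS.
Proof.
apply/sumsmx_subP => k _; apply/rV_subP => v /Wpart_mem[x [xL x0 ->]].
pose u i := ('C(k.+1, i))%:R *: (x *m (E1 ^+ i *m E2 ^+ (k.+1 - i))).
have u0 : forall i, (i < k.+2)%N -> u i = 0.
  apply: (@eigen_sum0 _ _ (ad br h1) k.+2 u) => [j _|].
    rewrite /u -scalemxAl scalerA mulrC -scalerA; congr (_ *: _).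
    have := pair_weight0 true false j (k.+1 - j) xL.
    by rewrite /= scale1r scale0r addr0 muln1 muln0 addn0.
  rewrite -[RHS]x0 epsX mulmx_sumr (reindex_inj rev_ord_inj) /=; apply: eq_bigr => i _.
  have ik : (i <= k.+1)%N by rewrite -ltnS.
  by rewrite /u subSS subKn // bin_sub // -scaler_nat -scalemxAr.
have t0 i : (i < k.+2)%N -> x *m (E1 ^+ i *m E2 ^+ (k.+1 - i)) = 0.
  move=> ik; have /eqP := u0 i ik; rewrite scaler_eq0 pnatr_eq0 -leqn0 leqNgt bin_gt0.
  by rewrite -ltnS ik => /eqP.
apply/centralizer2P; rewrite -!adE epsX !mulmx_sumr !mulmx_suml.
split; apply: big1 => i _; rewrite -scaler_nat -scalemxAr -scalemxAl.
  have -> : x *m (E1 ^+ (k - i) *m E2 ^+ i) *m E1 = x *m (E1 ^+ (k - i).+1 *m E2 ^+ (k.+1 - (k - i).+1)).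
    have ik : (i <= k)%N by rewrite -ltnS.
    rewrite subSS subKn // exprSr -!mulmxE -!mulmxA; congr (_ *m (_ *m _)).
    by have := commrX i pair_E12; rewrite /GRing.comm !mulmxE.
  by rewrite t0 ?scaler0 // !ltnS leq_subr.
have -> : x *m (E1 ^+ (k - i) *m E2 ^+ i) *m E2 = x *m (E1 ^+ (k - i) *m E2 ^+ (k.+1 - (k - i))).
  have ik : (i <= k)%N by rewrite -ltnS.
  by rewrite subSn ?leq_subr // subKn // exprSr -!mulmxE -!mulmxA.
by rewrite t0 ?scaler0 // ltnS (leq_trans (leq_subr _ _)).
Qed.

Lemma rank_L : \rank L = \rank Z.
Proof.
have [H [cH rH]] := rkZ; have [h [_ _ /eqmxP hL]] := pair_regular.
apply/eqP; rewrite eqn_leq -{1}rank_Wsum mxrankS ?Wsum_centralizes //=.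
by rewrite -hL -rH cartan_rank_min.
Qed.

Lemma Z_sub_Wsum : (Z <= Wsum)%MS.
Proof.
by rewrite -(mxrank_leqif_sup Wsum_centralizes) rank_Wsum rank_L.
Qed.

Lemma L_nilpotent x : (x <= L)%MS -> L *m ad br x ^+ n = 0.
Proof.
have [H [cH rH]] := rkZ; have [h [_ _ /andP[hL Lh]]] := pair_regular.
move=> xL; apply/eqP; rewrite -submx0; apply: submx_trans (submxMr _ Lh) _.
rewrite engel_minimal ?sub0mx //; first exact: submx_trans Lh.
move=> t; have /eqmx_rank -> : (kermx (ad br h ^+ n) == L)%MS by apply/andP.
by rewrite rank_L -rH cartan_rank_min.
Qed.

Lemma L_subalgebra : lie_subalgebra br L.
Proof.
move=> x y /centralizer2P[a b] /centralizer2P[c d]; apply/centralizer2P.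
by rewrite (br_jacobi h1 x y) (br_jacobi h2 x y) a b c d !br0l !br0r !addr0.
Qed.

Lemma derived_L_sub : (brspace br L L <= L)%MS.
Proof. by apply: brspace_sub; apply: L_subalgebra. Qed.

(* [ad x] has a conjugate-eigenvalue derivation [F], which kills [L]. *)
Lemma derived_L_nilpotent x : (x <= brspace br L L)%MS -> ad br x ^+ n = 0.
Proof.
move=> xJ; have xL := submx_trans xJ derived_L_sub.
have [F [Fact _ _ Fcomm _]] := spectral_fun (ad br x) (fun a => a^*).
have FD : derivation br F.
  apply: (spectral_derivation (op := +%R) _ Fact).
    move=> a b y z; apply: derivation_geig => y' z'.
    by rewrite !adE br_jacobi.
  by move=> a b y z _ _ _; rewrite rmorphD.
have LF y : (y <= L)%MS -> y *m F = 0.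
  move=> yL; have gy : geig (ad br x) 0 y.
    exists n; rewrite raddf0 subr0; have /submxP[c ->] := yL.
    by rewrite -mulmxA L_nilpotent ?mulmx0.
  by rewrite (Fact _ _ gy) conjC0 scale0r.
apply: (nilpotent_trace_conj Fact); first by rewrite Fcomm.
have [U UP] : exists U : 'M[C]_n, forall z, (z <= U)%MS <-> \tr (ad br z *m F) = 0.
  apply: subspace_mx; first by rewrite ad0 mul0mx raddf0.
  by move=> a y z Hy Hz; rewrite adP mulmxDl -scalemxAl linearD linearZ /= Hy Hz mulr0 addr0.
apply/UP/(submx_trans xJ)/brspace_sub => a b aL bL; apply/UP.
have /derivationP/(_ b) FDb := FD.
rewrite ad_br mulmxBl raddfB /= -!mulmxA mxtrace_mulC -mulmxA -raddfB -mulmxBr.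
by rewrite -opprB -FDb (LF b bL) ad0 oppr0 mulmx0; apply: raddf0.
Qed.

(** By the Fitting decomposition of ad h, every vector is in L modulo [h, g]; and L is
    Killing-orthogonal to [h, g] because h commutes with L. *)
Lemma kill_L x : (x <= L)%MS -> (forall y, (y <= L)%MS -> kill br x y = 0) -> x = 0.
Proof.
move=> xL H; apply: (kill_nondegenerate ss) => z.
have [h [hL hx /andP[kL Lk]]] := pair_regular.
have [z0 [u [z0L ->]]] := fitting_split z kL.
rewrite killC -[z0]scale1r killP (killC br z0) H // mulr0 add0r.
by rewrite killC adE -kill_br brC hx // oppr0 /kill ad0 mul0mx raddf0.
Qed.

(* [ad x ad y] moves each term of the Engel flag of [L, L] acting on the algebra into
   the next one. *)
Lemma derived_L_kill x y : (x <= brspace br L L)%MS -> (y <= L)%MS -> kill br x y = 0.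
Proof.
set J := brspace br L L => xJ yL.
have JL : (J <= L)%MS := derived_L_sub.
have LJ u v : (u <= L)%MS -> (v <= J)%MS -> (br u v <= J)%MS.
  by move=> uL vJ; apply: brspace_mem => //; apply: submx_trans JL.
have Jsub : lie_subalgebra br J by move=> u v uJ; apply: LJ; apply: submx_trans JL.
pose W i := iter i (brspace br J) 1%:M.
have Wst i : ad_stable br L (W i).
  move=> u uL; elim: i => [|i IH]; first exact: submx1.
  suff : (W i.+1 <= kermx (ad br u *m cokermx (W i.+1)))%MS.
    by move/sub_kermxP => H; rewrite submxE -mulmxA H.
  apply: brspace_sub => j w jJ wW; apply/sub_kermxP; apply/eqP.
  rewrite mulmxA -submxE adE br_jacobi addmx_sub //; apply: brspace_mem => //.
    exact: LJ.
  by rewrite -adE (submx_trans (submxMr _ wW)).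
have Wr i : (\rank (W i) <= n - i)%N.
  elim: i => [|i IH]; first by rewrite subn0 rank_leq_col.
  have WS : (W i.+1 <= W i)%MS.
    apply: brspace_sub => j w jJ wW; rewrite -adE; apply: submx_trans (submxMr _ wW) _.
    by apply: Wst; apply: submx_trans JL.
  have [W0|Wn0] := eqVneq (W i) 0.
    by have := mxrankS WS; rewrite W0 mxrank0 leqn0 => /eqP->.
  have [U [UW WU KU]] : exists U : 'M[C]_n, [/\ (U <= W i)%MS, ~~ (W i <= U)%MS
      & forall x, (x <= J)%MS -> (W i *m ad br x <= U)%MS].
    apply: (engel_flag (N := 1%:M) (U := 0) Jsub); rewrite ?submx1 ?sub0mx ?submx0 //.
    - by move=> u uJ; rewrite derived_L_nilpotent ?mulmx0.
    - by move=> u _; rewrite mul0mx sub0mx.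
    - by move=> u uJ; apply: Wst; apply: submx_trans JL.
  have WSU : (W i.+1 <= U)%MS.
    apply: brspace_sub => j w jJ wW; rewrite -adE.
    exact: submx_trans (submxMr _ wW) (KU _ jJ).
  have : (\rank U < \rank (W i))%N.
    rewrite ltn_neqAle mxrankS // andbT; apply: contra WU => H.
    by rewrite -(mxrank_leqif_sup UW).
  have := mxrankS WSU; lia.
have nilW i : ((ad br x *m ad br y) ^+ i <= W i)%MS.
  elim: i => [|i IH]; first exact: submx1.
  rewrite exprSr -mulmxE mulmxA; apply: submx_trans (Wst i.+1 _ yL); apply: submxMr.
  apply: submx_trans (submxMr _ IH) _; apply/row_subP => k.
  by rewrite row_mul adE brspace_mem ?row_sub.
apply: (@mxtrace_nilpotent _ _ _ n); apply/eqP; rewrite -submx0.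
by apply: submx_trans (nilW n) _; have := Wr n; rewrite subnn leqn0 mxrank_eq0 => /eqP->; rewrite submx_refl.
Qed.

Lemma L_abelian x y : (x <= L)%MS -> (y <= L)%MS -> br x y = 0.
Proof.
move=> xL yL; apply: kill_L; first exact: L_subalgebra.
by move=> z; apply: derived_L_kill; apply: brspace_mem.
Qed.

Lemma L_cartan : cartan_subalgebra br L.
Proof.
split; first exact: L_subalgebra.
  exists 1%N; rewrite /= sub0mx andbT; apply: brspace_sub => x y xL yL.
  by rewrite L_abelian // sub0mx.
move=> x Hx; have [h [hL hx /andP[kL Lk]]] := pair_regular.
(* If [x] normalizes L, then [h, x] is in L and commutes with h, so (ad h)^2 kills [x]. *)
apply: submx_trans kL; apply/kermx_geig0; exists 2.
rewrite raddf0 subr0 expr2 -mulmxE mulmxA !adE hx //.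
by rewrite brC eqmx_opp Hx.
Qed.

Lemma Z_ind (P : 'rV[C]_n -> Prop) : P 0 ->
  (forall a u v, P u -> P v -> P (a *: u + v)) ->
  (forall k v, (v <= Wpart k)%MS -> P v) -> forall v, (v <= Z)%MS -> P v.
Proof.
move=> P0 PD PW v vZ; have [S SP] := subspace_mx P0 PD.
apply/SP; apply: submx_trans (submx_trans vZ Z_sub_Wsum) _.
by apply/sumsmx_subP => k _; apply/rV_subP => w /PW /SP.
Qed.

(** For x, y in L the bracket [x, y] is 0. Expanding its image under eps^(j+k) by Leibniz, with x
    eps^(j+1) = y eps^(k+1) = 0, leaves only a binomial multiple of [x eps^j, y eps^k]. *)
Lemma Z_abelian x y : (x <= Z)%MS -> (y <= Z)%MS -> br x y = 0.
Proof.
move=> xZ yZ; move: x xZ; apply: Z_ind; first exact: br0l.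
  by move=> a u v Hu Hv; rewrite brDl brZl Hu Hv scaler0 addr0.
move=> j _ /Wpart_mem[x [xL x0 ->]]; move: y yZ; apply: Z_ind; first exact: br0r.
  by move=> a u v Hu Hv; rewrite brDr brZr Hu Hv scaler0 addr0.
move=> k _ /Wpart_mem[y [yL y0 ->]].
have := @Ad_leibniz _ _ (ad br) eps x (j + k).
have epsder z : ad br z *m eps = eps *m ad br z + ad br (z *m eps).
  by rewrite adE ad_br [RHS]addrC subrK.
move=> /(_ epsder)/(congr1 (mulmx y)); rewrite mulmxA adE L_abelian // mul0mx mulmx_sumr.
have jk : (j < (j + k).+1)%N by rewrite ltnS leq_addr.
rewrite (bigD1 (Ordinal jk)) //= big1 => [|i ij]; last first.
  rewrite -scalemxAr mulmxA adE; case: (ltngtP i j) => [lt|gt|eq].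
  - rewrite (mulmx_exp_le (m := k.+1) _ y0) ?br0r ?scaler0 //; lia.
  - by rewrite (mulmx_exp_le gt x0) br0l scaler0.
  - by case/negP: ij; apply/eqP/val_inj.
rewrite addr0 addKn -scalemxAr mulmxA adE => /esym/eqP; rewrite scaler_eq0 pnatr_eq0.
by rewrite -leqn0 leqNgt bin_gt0 leq_addr => /eqP.
Qed.

Lemma moved_to_Z v : v != 0 -> exists i j,
  v *m (E1 ^+ i *m E2 ^+ j) != 0 /\ (v *m (E1 ^+ i *m E2 ^+ j) <= Z)%MS.
Proof.
have [n1 [n2 _]] := pair_nilpotent => vn0.
have [i [vi vi1]] := last_nonzero_iterate n1 vn0.
have [j [vj vj1]] := last_nonzero_iterate n2 vi.
exists i, j; rewrite mulmxA; split=> //; apply/centralizer2P; rewrite -!adE vj1; split=> //.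
have c : E2 ^+ j *m E1 = E1 *m E2 ^+ j.
  by have := commrX j pair_E12; rewrite /GRing.comm !mulmxE.
by rewrite -mulmxA c mulmxA vi1 mul0mx.
Qed.

(** Products of powers of ad e1 and ad e2 commute with ad x. They move an eigenvector of ad x to a
    nonzero element of Z with the same eigenvalue, which is 0 because Z is abelian. *)
Lemma Z_nilpotent x : (x <= Z)%MS -> ad br x ^+ n = 0.
Proof.
move=> xZ; apply: nilpotent_eig => a v vn0 vx; have [i [j [wn0 wZ]]] := moved_to_Z vn0.
have /centralizer2P[x1 x2] := xZ.
have comm e : br e x = 0 -> ad br x *m ad br e = ad br e *m ad br x.
  by move=> ex; apply/eqP; rewrite -subr_eq0 -ad_br ex ad0.
have : v *m (E1 ^+ i *m E2 ^+ j) *m ad br x = a *: (v *m (E1 ^+ i *m E2 ^+ j)).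
  have c : GRing.comm (ad br x) (E1 ^+ i *m E2 ^+ j).
    by apply: commrM; apply: commrX; apply: comm.
  rewrite -mulmxA; have -> : E1 ^+ i *m E2 ^+ j *m ad br x = ad br x *m (E1 ^+ i *m E2 ^+ j) by rewrite !mulmxE.
  by rewrite [LHS]mulmxA vx -scalemxAl.
rewrite adE Z_abelian // => /esym/eqP; rewrite scaler_eq0 (negbTE wn0) orbF.
by move/eqP.
Qed.

(** Such an ad x is nilpotent and commutes with ad y for y in L, so it is Killing-orthogonal to
    L. *)
Lemma Z_cap_L x : (x <= Z)%MS -> (x <= L)%MS -> x = 0.
Proof.
move=> xZ xL; apply: kill_L => // y yL; apply: (@mxtrace_nilpotent _ _ _ n).
apply: commuting_nilpotent; last exact: Z_nilpotent.
by apply/eqP; rewrite eq_sym -subr_eq0 -ad_br L_abelian // ad0.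
Qed.

Lemma pair_integral : integral_ad_eigenvalues br h1 /\ integral_ad_eigenvalues br h2.
Proof.
have main (b1 b2 : bool) : integral_ad_eigenvalues br (b1%:R *: h1 + b2%:R *: h2).
  move=> a /eigenvalueP[v va vn0]; have [i [j [wn0 wZ]]] := moved_to_Z vn0.
  rewrite adE in va; have := pair_weight i j va; rewrite -[LHS]adE => wa.
  have wW := submx_trans wZ Z_sub_Wsum.
  have [k ak] := eigen_natsum_value wn0 wa (submx_trans wW (Wsum_weights b1 b2)).
  exists (k%:Z - (i * b1 + j * b2)%N%:Z); rewrite rmorphB /= -!pmulrn -ak.
  by rewrite addrK.
split; first by have := main true false; rewrite /= scale1r scale0r addr0.
by have := main false true; rewrite /= scale1r scale0r add0r.
Qed.

End PrincipalPair.

(** * Conjugacy of the semisimple pairs *)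

Section Zariski.
Variables (C : numClosedFieldType) (n : nat).

Lemma polyfun_curve (p : 'M[C]_n -> C) (G : 'M[{poly C}]_n) : polyfun p ->
  exists q : {poly C}, forall t, p (evalmx t G) = q.[t].
Proof.
elim=> [c|i j|p1 p2 _ [q1 H1] _ [q2 H2]|p1 p2 _ [q1 H1] _ [q2 H2]].
- by exists c%:P => t; rewrite hornerC.
- by exists (G i j) => t; rewrite mxE.
- by exists (q1 + q2) => t; rewrite hornerD H1 H2.
- by exists (q1 * q2) => t; rewrite hornerM H1 H2.
Qed.

(** If neither closed set contained the whole curve from [A0] to [A], each would impose a nonzero
    polynomial equation on the parameter; the product of the two would vanish everywhere. *)
Lemma zconnected_curves (X : 'M[C]_n -> Prop) (A0 : 'M[C]_n) :
  (forall A, X A -> exists G : 'M[{poly C}]_n,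
     [/\ forall t, X (evalmx t G), evalmx 0 G = A0 & evalmx 1 G = A]) ->
  X A0 -> zconnected X.
Proof.
move=> HX X0 Z1 Z2 cZ1 cZ2 cover disj.
wlog Z10 : Z1 Z2 cZ1 cZ2 cover disj / Z1 A0.
  move=> H; case: (cover _ X0) => [|Z20]; first exact: H.
  have [] := H Z2 Z1 cZ2 cZ1 _ _ Z20; last 2 first.
  - by right.
  - by left.
  - by move=> A /cover[]; [right | left].
  by move=> A XA Z2A Z1A; apply: disj XA Z1A Z2A.
left=> A XA; apply: contrapT => nZ1A.
have nZ20 : ~ Z2 A0 by move=> Z20; apply: disj X0 Z10 Z20.
have [G [XG G0 G1]] := HX _ XA.
have nonzero (W : 'M[C]_n -> Prop) B : zclosed W -> ~ W B -> (exists s, evalmx s G = B) ->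
    exists2 q : {poly C}, q != 0 & forall t, W (evalmx t G) -> q.[t] = 0.
  move=> [P [Pp WP]] nWB [s sB]; apply: contrapT => H; apply: nWB; apply/WP => p Pp0.
  have [q qE] := polyfun_curve G (Pp _ Pp0); apply: contrapT => pB.
  apply: H; exists q; last by move=> t /WP/(_ _ Pp0); rewrite qE.
  by apply/eqP => q0; apply: pB; rewrite -sB qE q0 horner0.
have [q1 q10 H1] := nonzero _ _ cZ1 nZ1A (ex_intro _ 1 G1).
have [q2 q20 H2] := nonzero _ _ cZ2 nZ20 (ex_intro _ 0 G0).
have : q1 * q2 = 0.
  apply: poly_fun0 => t; rewrite hornerM.
  by case: (cover _ (XG t)) => [/H1->|/H2->]; rewrite ?mul0r ?mulr0.
by move/eqP; rewrite mulf_eq0 (negbTE q10) (negbTE q20).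
Qed.

Definition mxpolyfun p q (F : 'M[C]_n -> 'M[C]_(p, q)) :=
  forall i j, polyfun (fun A => F A i j).

Lemma polyfun_ext (p q : 'M[C]_n -> C) : (forall A, p A = q A) -> polyfun q -> polyfun p.
Proof. by move=> pq; rewrite (funext pq). Qed.

Lemma polyfun_sum (I : Type) (r : seq I) (P : pred I) (F : I -> 'M[C]_n -> C) :
  (forall i, polyfun (F i)) -> polyfun (fun A => \sum_(i <- r | P i) F i A).
Proof.
move=> HF; elim: r => [|i r IH].
  by apply: polyfun_ext (polyfun_cst _ 0) => A; rewrite big_nil.
apply: (@polyfun_ext _ (fun A => (if P i then F i A else 0) + \sum_(i <- r | P i) F i A)).
  by move=> A; rewrite big_cons; case: (P i); rewrite ?add0r.
by apply: polyfun_add => //; case: (P i) => //; apply: polyfun_cst.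
Qed.

Lemma mxpolyfun_cst p q (B : 'M[C]_(p, q)) : mxpolyfun (fun=> B).
Proof. by move=> i j; apply: polyfun_cst. Qed.

Lemma mxpolyfun_id : mxpolyfun (fun A => A).
Proof. by move=> i j; apply: polyfun_coord. Qed.

Lemma mxpolyfun_add p q (F G : 'M[C]_n -> 'M[C]_(p, q)) :
  mxpolyfun F -> mxpolyfun G -> mxpolyfun (fun A => F A + G A).
Proof.
move=> HF HG i j; apply: polyfun_ext (polyfun_add (HF i j) (HG i j)) => A.
by rewrite mxE.
Qed.

Lemma mxpolyfun_mul p q r (F : 'M[C]_n -> 'M[C]_(p, q)) (G : 'M[C]_n -> 'M[C]_(q, r)) :
  mxpolyfun F -> mxpolyfun G -> mxpolyfun (fun A => F A *m G A).
Proof.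
move=> HF HG i j; apply: (@polyfun_ext _ (fun A => \sum_k F A i k * G A k j)).
  by move=> A; rewrite mxE.
by apply: polyfun_sum => k; apply: polyfun_mul.
Qed.

Lemma mxpolyfun_scale p q (f : 'M[C]_n -> C) (F : 'M[C]_n -> 'M[C]_(p, q)) :
  polyfun f -> mxpolyfun F -> mxpolyfun (fun A => f A *: F A).
Proof.
move=> Hf HF i j; apply: polyfun_ext (polyfun_mul Hf (HF i j)) => A.
by rewrite mxE.
Qed.

Lemma mxpolyfun_sum p q (I : Type) (r : seq I) (P : pred I) (F : I -> 'M[C]_n -> 'M[C]_(p, q)) :
  (forall i, mxpolyfun (F i)) -> mxpolyfun (fun A => \sum_(i <- r | P i) F i A).
Proof.
move=> HF i j; apply: (@polyfun_ext _ (fun A => \sum_(k <- r | P k) F k A i j)).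
  by move=> A; rewrite summxE.
by apply: polyfun_sum => k; apply: HF.
Qed.

Lemma mxpolyfun_exp p (F : 'M[C]_n -> 'M[C]_p) k :
  mxpolyfun F -> mxpolyfun (fun A => F A ^+ k).
Proof.
move=> HF; elim: k => [|k IH]; first exact: mxpolyfun_cst.
have := mxpolyfun_mul HF IH; congr mxpolyfun; apply/funext => A.
by rewrite exprS mulmxE.
Qed.

Lemma zclosed_mx0 p q (F : 'M[C]_n -> 'M[C]_(p, q)) : mxpolyfun F -> zclosed (fun A => F A = 0).
Proof.
move=> HF; exists (fun f => exists i j, f = fun A => F A i j); split.
  by move=> f [i [j ->]]; apply: HF.
move=> A; split=> [FA f [i [j ->]]|H]; first by rewrite FA mxE.
apply/matrixP => i j; rewrite [RHS]mxE.
exact: (H (fun A => F A i j) (ex_intro _ i (ex_intro _ j erefl))).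
Qed.

End Zariski.

(** * Exponentials of nilpotent matrices and derivations *)

Section NilpotentExp.
Variables (C : numClosedFieldType) (n : nat).

Definition invfact j : C := (j`!)%:R^-1.

Lemma invfactP j : invfact j * (j`!)%:R = 1.
Proof. by rewrite /invfact mulVf // pnatr_eq0 -lt0n fact_gt0. Qed.

(* Products of powers of two commuting [D], [E] with [D ^+ n = E ^+ n = 0] vanish in
   total degree [2n], so this truncation loses nothing. *)
Definition nexp (D : 'M[C]_n) : 'M[C]_n := texp invfact (n.*2.+2) D.

Lemma nexp0 : nexp 0 = 1%:M.
Proof. exact: (texp0 _ invfactP). Qed.

Lemma nexpD (D E : 'M[C]_n) : D *m E = E *m D -> D ^+ n = 0 -> E ^+ n = 0 ->
  nexp (D + E) = nexp D *m nexp E.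
Proof.
move=> DE Dn En; apply: (texpD invfactP DE) => i j ij.
have [ni|] := leqP n i; first by rewrite -(subnK ni) exprD En mulr0 mulmx0.
by move=> iN; rewrite -(@subnK n j) 1?exprD ?Dn ?mulr0 ?mul0mx //; lia.
Qed.

Lemma nexp_unit (D : 'M[C]_n) : D ^+ n = 0 -> nexp D *m nexp (- D) = 1%:M.
Proof.
move=> Dn; rewrite -nexpD ?subrr ?nexp0 //; first by rewrite mulmxN mulNmx.
by rewrite exprNn Dn mulr0.
Qed.

Lemma nexp_conj (D g h : 'M[C]_n) : g *m h = 1%:M -> h *m g = 1%:M ->
  nexp (g *m D *m h) = g *m nexp D *m h.
Proof.
move=> gh hg; rewrite /nexp /texp mulmx_sumr mulmx_suml; apply: eq_bigr => k _.
rewrite -scalemxAr -scalemxAl; congr (_ *: _).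
elim: (val k) => [|j IH]; first by rewrite !expr0 mulmx1.
by rewrite !exprS -!mulmxE IH -!mulmxA (mulmxA h g) hg mul1mx.
Qed.

Lemma nexp_fix (D : 'M[C]_n) (v : 'rV[C]_n) : v *m D = 0 -> v *m nexp D = v.
Proof.
move=> vD; rewrite /nexp /texp big_ord_recl mulmxDr mulmx_sumr big1 => [|i _].
  by rewrite addr0 expr0 -[invfact _]mulr1 -[1]/((0`!)%:R) invfactP scale1r mulmx1.
by rewrite /bump /= -scalemxAr exprS -mulmxE mulmxA vD mul0mx scaler0.
Qed.

Lemma nexp_square0 (D : 'M[C]_n) (v : 'rV[C]_n) : v *m D *m D = 0 -> v *m nexp D = v + v *m D.
Proof.
move=> vD; rewrite /nexp /texp !big_ord_recl !mulmxDr mulmx_sumr big1 => [|i _].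
  rewrite addr0 /bump /= expr0 expr1 /invfact !invr1 !scale1r mulmx1 //.
by rewrite /bump /= -scalemxAr !exprS -!mulmxE !mulmxA vD mul0mx scaler0.
Qed.

Lemma nexp_unipotent (D : 'M[C]_n) : D ^+ n = 0 -> unipotent (nexp D).
Proof.
move=> Dn; exists n; pose S := \sum_(i < n.*2.+1) invfact i.+1 *: D ^+ i.
have -> : nexp D - 1%:M = D *m S.
  rewrite /nexp /texp big_ord_recl expr0 {1}/invfact invr1 scale1r addrC addKr mulmx_sumr; apply: eq_bigr => i _.
  by rewrite -scalemxAr /bump /= exprS -mulmxE.
apply: commuting_nilpotent => //; rewrite mulmx_sumr mulmx_suml; apply: eq_bigr => i _.
by rewrite -scalemxAr -scalemxAl !mulmxE -exprS -exprSr.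
Qed.

Variable br : 'rV[C]_n -> 'rV[C]_n -> 'rV[C]_n.
Context {Hlie : lie_algebra br}.

Lemma nexp_ad_bracket (D : 'M[C]_n) x : derivation br D -> D ^+ n = 0 ->
  ad br x *m nexp D = nexp D *m ad br (x *m nexp D).
Proof.
move=> /derivationP HD Dn.
have HD' z : ad br z *m D = D *m ad br z + ad br (z *m D) by rewrite HD addrC subrK.
have := @texp_Ad _ _ (ad br) (adP (Hlie := Hlie)) _ invfactP D x (n.*2.+2) HD'.
rewrite big1 ?addr0 // => i _; rewrite big1 // => j ij.
have [ni|] := leqP n i; first by rewrite -(subnK ni) exprD Dn mulr0 mulmx0 ad0 mulmx0 scaler0.
by move=> iN; rewrite -(@subnK n j) 1?exprD ?Dn ?mulr0 ?mul0mx ?scaler0 //; lia.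
Qed.

Lemma nexp_aut y : ad br y ^+ n = 0 -> lie_aut br (nexp (ad br y)).
Proof.
move=> yn; split; first by case: (mulmx1_unit (nexp_unit yn)).
have yD : derivation br (ad br y) by move=> u v; rewrite !adE br_jacobi.
by move=> u v; rewrite -(adE _ v) -mulmxA nexp_ad_bracket // mulmxA adE.
Qed.

End NilpotentExp.

(** * The unipotent group exp (ad Z) and its action on semisimple pairs *)

Section Uniqueness.
Variables (C : numClosedFieldType) (n : nat).
Variable br : 'rV[C]_n -> 'rV[C]_n -> 'rV[C]_n.
Hypothesis ss : semisimple br.
Local Instance uniqueness_lie : lie_algebra br := semisimple_lie_algebra ss.
Variables e1 e2 h1 h2 : 'rV[C]_n.
Hypothesis e12 : br e1 e2 = 0.
Hypothesis rkZ : has_rank_dim br (\rank (centralizer2 br e1 e2)).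
Hypotheses (dh1 : ss_element br h1) (dh2 : ss_element br h2).
Hypothesis rel : pair_relations br e1 e2 h1 h2.
Implicit Types (x y z v w : 'rV[C]_n).

Local Notation Z := (centralizer2 br e1 e2).
Local Notation L := (centralizer2 br h1 h2).
Local Notation h := (h1 + h2).

Let Zab := Z_abelian ss e12 rkZ dh1 dh2 rel.
Let Znil := Z_nilpotent ss e12 rkZ dh1 dh2 rel.

Lemma Z_stable (a b : C) v : (v <= Z)%MS -> (br (a *: h1 + b *: h2) v <= Z)%MS.
Proof.
case: rel => r11 r12 r21 r22 _ vZ; have /centralizer2P[v1 v2] := vZ.
apply/centralizer2P; rewrite (br_jacobi e1) (br_jacobi e2) v1 v2 !br0r !addr0.
rewrite !brDr !brZr (brC e1 h1) (brC e1 h2) (brC e2 h1) (brC e2 h2) r11 r12 r21 r22.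
by rewrite !oppr0 !scaler0 addr0 add0r !brZl !brNl v1 v2 !oppr0 !scaler0.
Qed.

(** Z is graded by h1 + h2 with weights in N, and its part of weight 0 is [Wpart] at 0, which lies
    in L and so meets Z only in 0. *)
Lemma Z_weight0 v : (v <= Z)%MS -> br h v = 0 -> v = 0.
Proof.
move=> vZ hv; apply: (Z_cap_L ss e12 rkZ dh1 dh2 rel) => //.
have [n0|n_gt0] := posnP n.
  suff -> : v = 0 by rewrite sub0mx.
  by apply/rowP => i; have := ltn_ord i; rewrite {2}n0.
have /sub_sumsmxP[u vE] := submx_trans vZ (Z_sub_Wsum ss e12 rkZ dh1 dh2 rel).
pose i0 := Ordinal n_gt0; pose w := u i0 *m Wpart br e1 e2 h1 h2 i0.
have wL : (w <= L)%MS.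
  have wW : (w <= Wpart br e1 e2 h1 h2 i0)%MS by rewrite submxMl.
  by have [x [xL _ ->]] := Wpart_mem wW; rewrite expr0 mulmx1.
suff -> : v = w by [].
apply/eqP; rewrite -subr_eq0 -submx0.
rewrite -(@eigen_natsum_disjoint _ _ (ad br h) 0 n (fun k => 0 < k)%N); last first.
  by move=> i _ i_gt0; rewrite eq_sym pnatr_eq0 -lt0n.
rewrite sub_capmx; apply/andP; split.
  apply/eigenspaceP; rewrite adE scale0r brBr hv; have /centralizer2P[w1 w2] := wL.
  by rewrite brDl w1 w2 addr0 subr0.
rewrite vE (bigD1 i0) // -/w addrAC subrr add0r; apply: summx_sub => i i_neq0.
apply: (sumsmx_sup i); first by rewrite lt0n.
by apply: submx_trans (submxMl _ _) _; apply: Wpart_weight rel _.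
Qed.

Lemma Z_solve c : (c <= Z)%MS -> exists2 y : 'rV[C]_n, (y <= Z)%MS & br h y = c.
Proof.
move=> cZ; have hE : h = 1 *: h1 + 1 *: h2 by rewrite !scale1r.
have ZA : (Z *m ad br h <= Z)%MS.
  by apply/row_subP => i; rewrite row_mul adE {1}hE Z_stable ?row_sub.
have rZA : \rank (Z *m ad br h) = \rank Z.
  apply/mxrank_injP; rewrite -submx0; apply/rV_subP => v; rewrite sub_capmx => /andP[vZ].
  by move=> /sub_kermxP; rewrite adE => /(Z_weight0 vZ)->; rewrite sub0mx.
have : (Z <= Z *m ad br h)%MS by rewrite -(mxrank_leqif_sup ZA) rZA.
move=> /(submx_trans cZ)/submxP[d ->]; exists (d *m Z); first exact: submxMl.
by rewrite -adE mulmxA.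
Qed.

Definition Zexp (A : 'M[C]_n) := exists2 y : 'rV[C]_n, (y <= Z)%MS & A = nexp (ad br y).

Lemma Zexp_curve y : (y <= Z)%MS -> exists G : 'M[{poly C}]_n,
  [/\ forall t, Zexp (evalmx t G), evalmx 0 G = 1%:M & evalmx 1 G = nexp (ad br y)].
Proof.
move=> yZ; pose G := \sum_(j < n.*2.+2) (@invfact C j)%:P *: ('X *: constmx (ad br y)) ^+ j.
have GE t : evalmx t G = nexp (ad br (t *: y)).
  rewrite evalmx_sum; apply: eq_bigr => j _.
  by rewrite evalmxZ evalmxX evalmxZ evalmx_const hornerC hornerX adZ.
exists G; split=> [t||]; rewrite GE ?scale0r ?scale1r ?ad0 ?nexp0 //.
by exists (t *: y); rewrite ?scalemx_sub.
Qed.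

Lemma Zexp1 : Zexp 1%:M.
Proof. by exists 0; rewrite ?sub0mx ?ad0 ?nexp0. Qed.

Lemma Zexp_connected : zconnected Zexp.
Proof.
apply: (zconnected_curves (A0 := 1%:M)); last exact: Zexp1.
by move=> A [y yZ ->]; apply: Zexp_curve.
Qed.

Lemma Zexp_subgroup : subgroup Zexp.
Proof.
split; first exact: Zexp1.
  move=> _ _ [x xZ ->] [y yZ ->]; exists (x + y); first by rewrite addmx_sub.
  rewrite adD nexpD ?Znil //; apply/eqP; rewrite -subr_eq0 -ad_br.
  by rewrite Zab // ad0.
move=> _ [y yZ ->]; have U := nexp_unit (Znil yZ).
have [yu _] := mulmx1_unit U; split=> //; exists (- y); first by rewrite eqmx_opp.
by rewrite adN -[RHS](mulKmx yu) U mulmx1.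
Qed.

(* [y] is recovered from [A = exp (ad y)] by a linear map applied to [h A - h]. *)
Lemma Zexp_closed : closed_in_GL Zexp.
Proof.
have [Q QZ] : exists Q : 'M[C]_n, (Q <= Z)%MS /\
    forall y, (y <= Z)%MS -> br y h *m Q = y.
  have free : row_free (row_base Z *m ad br h).
    rewrite /row_free; apply/eqP.
    rewrite -[RHS](eq_row_base Z); apply/mxrank_injP; rewrite -submx0; apply/rV_subP => v; rewrite sub_capmx.
    rewrite eq_row_base => /andP[vZ /sub_kermxP]; rewrite adE => /(Z_weight0 vZ)->.
    by rewrite sub0mx.
  exists (- (pinvmx (row_base Z *m ad br h) *m row_base Z)); split.
    by rewrite eqmx_opp (submx_trans (submxMl _ _)) // eq_row_base.
  move=> y; rewrite -(eq_row_base Z) => /submxP[d ->].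
  rewrite mulmxN brC mulNmx opprK -adE.
  rewrite -[d *m row_base Z *m _]mulmxA; set M := row_base Z *m ad br h.
  by rewrite mulmxA -(mulmxA d) (mulmxVp free) mulmx1.
case: QZ => QZ Qy.
(* For A = exp (ad y), h A - h is [y, h], as y commutes with [y, h] in Z. Conversely [F A = 0]
   writes A as an exponential of an element in the image of [Q], hence of Z. *)
pose F (A : 'M[C]_n) := A - nexp (ad br ((h *m A - h) *m Q)).
have Fpoly : mxpolyfun F.
  have Fv : mxpolyfun (fun A : 'M[C]_n => (h *m A - h) *m Q).
    apply: mxpolyfun_mul; last exact: mxpolyfun_cst.
    apply: mxpolyfun_add; last exact: mxpolyfun_cst.
    by apply: mxpolyfun_mul; [apply: mxpolyfun_cst | apply: mxpolyfun_id].
  have Fad : mxpolyfun (fun A : 'M[C]_n => ad br ((h *m A - h) *m Q)).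
    have -> : (fun A : 'M[C]_n => ad br ((h *m A - h) *m Q)) =
        (fun A => \sum_i ((h *m A - h) *m Q) 0 i *: ad br (delta_mx 0 i)).
      apply/funext => A; rewrite {1}[(h *m A - h) *m Q]row_sum_delta.
      by elim/big_rec2: _ => [|i u v _ IH]; rewrite ?ad0 // adP IH.
    by apply: mxpolyfun_sum => i; apply: mxpolyfun_scale; [apply: Fv | apply: mxpolyfun_cst].
  have -> : F = (fun A => A + (-1) *: nexp (ad br ((h *m A - h) *m Q))).
    by apply/funext => A; rewrite scaleN1r.
  apply: mxpolyfun_add; first exact: mxpolyfun_id.
  apply: mxpolyfun_scale; first exact: polyfun_cst.
  apply: mxpolyfun_sum => i; apply: mxpolyfun_scale; first exact: polyfun_cst.
  exact: mxpolyfun_exp.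
exists (fun A => F A = 0); split; first exact: zclosed_mx0.
move=> A; split=> [[y yZ ->]|[/eqP + _]].
  split; last by case: (mulmx1_unit (nexp_unit (Znil yZ))).
  have hy : (br y h <= Z)%MS.
    by rewrite brC eqmx_opp -[h1]scale1r -[h2]scale1r Z_stable.
  rewrite /F nexp_square0; last by rewrite !adE Zab.
  by rewrite (addrC h) addrK adE Qy // subrr.
rewrite subr_eq0 => /eqP AE; exists ((h *m A - h) *m Q) => //.
exact: submx_trans (submxMl _ _) QZ.
Qed.

Lemma Zexp_adjoint A : Zexp A -> adjoint_group br A.
Proof.
move=> XA; exists Zexp; split=> //; first by move=> _ [y yZ ->]; apply: nexp_aut; apply: Znil.
  exact: Zexp_connected.
exact: Zexp1.
Qed.

(** An automorphism g fixing e1 and e2 preserves Z and conjugates exp (ad y) into exp (ad (y g)). *)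
Lemma Zexp_normal : normal_in Zexp (centralizer_grp br e1 e2).
Proof.
split=> [A XA|g _ [[X [Xaut _ _ Xg]] [g1 g2]] [y yZ ->]].
  split; first exact: Zexp_adjoint.
  case: XA => y /centralizer2P[y1 y2] ->.
  by split; apply: nexp_fix; rewrite adE brC ?y1 ?y2 oppr0.
have [gu gbr] := Xaut _ Xg; have /centralizer2P[y1 y2] := yZ.
exists (y *m g).
  by apply/centralizer2P; rewrite -{1}g1 -{1}g2 -!gbr y1 y2 !mul0mx.
rewrite -(nexp_conj _ (mulVmx gu) (mulmxV gu)); congr nexp.
apply/row_matrixP => i; rewrite !rowE !mulmxA !adE gbr.
by rewrite mulmxKV.
Qed.

Lemma Zexp_radical A : Zexp A -> unipotent_radical (centralizer_grp br e1 e2) A.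
Proof.
move=> XA; exists Zexp; split=> //; split.
- exact: Zexp_subgroup.
- exact: Zexp_closed.
- exact: Zexp_connected.
- exact: Zexp_normal.
by move=> _ [y yZ ->]; apply: nexp_unipotent; apply: Znil.
Qed.

Lemma pair_conjugate h1' h2' : pair_relations br e1 e2 h1' h2' ->
  exists2 u, Zexp u & h1 *m u = h1' /\ h2 *m u = h2'.
Proof.
case: rel => r11 r12 r21 r22 h12 [s11 s12 s21 s22 s12'].
set c1 := h1' - h1; set c2 := h2' - h2.
have c1Z : (c1 <= Z)%MS.
  by apply/centralizer2P; rewrite (brC e1) (brC e2) !brBl r11 s11 r12 s12 !subrr oppr0.
have c2Z : (c2 <= Z)%MS.
  by apply/centralizer2P; rewrite (brC e1) (brC e2) !brBl r21 s21 r22 s22 !subrr oppr0.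
have h1E : h1' = c1 + h1 by rewrite subrK.
have h2E : h2' = c2 + h2 by rewrite subrK.
clearbody c1 c2; have c12 : br h1 c2 = br h2 c1.
  (* As Z is abelian, [h1', h2'] = 0 reduces to the compatibility [h1, c2] = [h2, c1]. *)
  have := s12'; rewrite h1E h2E.
  rewrite brDl !brDr h12 addr0 (Zab c1Z c2Z) add0r (brC c1) addrC.
  by move/eqP; rewrite subr_eq0 => /eqP.
(* Only the sum of the two equations is solved; compatibility then yields each of them. *)
have [y yZ hy] : exists2 y : 'rV[C]_n, (y <= Z)%MS & br h y = - (c1 + c2).
  by apply: Z_solve; rewrite eqmx_opp addmx_sub.
(* With k commuting with h, [h, [k, y]] = [k, [h, y]] = - [k, c1 + c2] = - [h, c], so [k, y] + c has
   weight 0 in Z and vanishes. *)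
have main (a b : C) c : (c <= Z)%MS -> br (a *: h1 + b *: h2) (c1 + c2) = br h c ->
    br y (a *: h1 + b *: h2) = c.
  set k := a *: h1 + b *: h2 => cZ kc.
  have hk : br h k = 0.
    by rewrite brDl !brDr !brZr !brxx (brC h2 h1) h12 oppr0 !scaler0 !addr0.
  have : br k y + c = 0.
    apply: Z_weight0; first by rewrite addmx_sub // Z_stable.
    by rewrite brDr br_jacobi hk br0l add0r hy brNr kc addNr.
  by rewrite (brC y) => /eqP; rewrite addr_eq0 => /eqP ->; rewrite opprK.
have y1 : br y h1 = c1.
  have := main 1 0 c1 c1Z; rewrite scale1r scale0r addr0; apply.
  by rewrite brDr brDl c12.
have y2 : br y h2 = c2.
  have := main 0 1 c2 c2Z; rewrite scale1r scale0r add0r; apply.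
  by rewrite brDr brDl -c12 addrC.
exists (nexp (ad br y)); first by exists y.
split; rewrite nexp_square0 !adE ?y1 ?y2 ?Zab //.
  by rewrite h1E addrC.
by rewrite h2E addrC.
Qed.

End Uniqueness.

Theorem theorem1p2 (R : realType) (n : nat)
  (br : 'rV[R[i]]_n -> 'rV[R[i]]_n -> 'rV[R[i]]_n) (e1 e2 : 'rV[R[i]]_n) :
  semisimple br -> principal_nilpotent_pair br e1 e2 ->
  (exists h1 h2 : 'rV[R[i]]_n,
     [/\ ss_element br h1, ss_element br h2,
         pair_relations br e1 e2 h1 h2,
         regular_pair br h1 h2
       & integral_ad_eigenvalues br h1 /\ integral_ad_eigenvalues br h2]) /\
  (forall h1 h2 h1' h2' : 'rV[R[i]]_n,
     ss_element br h1 -> ss_element br h2 -> pair_relations br e1 e2 h1 h2 ->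
     ss_element br h1' -> ss_element br h2' -> pair_relations br e1 e2 h1' h2' ->
     exists u : 'M[R[i]]_n,
       unipotent_radical (centralizer_grp br e1 e2) u /\
       h1 *m u = h1' /\ h2 *m u = h2').
Proof.
move=> ss [e12 rkZ scale]; split=> [|h1 h2 h1' h2' dh1 dh2 rel dh1' dh2' rel'].
  have [g [[X [Xaut _ _ Xg]] [g1 g2]]] : exists g, adjoint_group br g /\
      e1 *m g = 2%:R *: e1 /\ e2 *m g = 3%:R *: e2.
    by apply: scale; rewrite pnatr_eq0.
  have [h1 [h2 [dh1 dh2 rel]]] := pair_from_aut ss (Xaut _ Xg) g1 g2.
  exists h1, h2; have int := pair_integral ss e12 rkZ dh1 dh2 rel.
  have car := L_cartan ss e12 rkZ dh1 dh2 rel.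
  split; [exact: dh1 | exact: dh2 | exact: rel | exact car | exact int].
have [u Zu hu] := pair_conjugate ss e12 rkZ dh1 dh2 rel rel'.
have rad := Zexp_radical ss e12 rkZ dh1 dh2 rel Zu.
exists u; split; [exact rad | exact hu].
Qed.
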